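(* Let $p:\mathbf{R}^d\to[1,\infty]$ be a globally $\log$-Hölder continuous exponent function and let $W:\mathbf{R}^d\to\mathbf{F}^{n\times n}$ be a matrix weight. Then the following are equivalent: (i) $M:L^{p(\cdot)}_W(\mathbf{R}^d;\mathcal{K})\to L^{p(\cdot)}_W(\mathbf{R}^d;\mathcal{K})_{\mathrm{weak}}$; (ii) $W\in A_{p(\cdot)}$; (iii) $L^{p(\cdot)}_W(\mathbf{R}^d;\mathbf{F}^n)\in A_{\mathrm{strong}}$. Moreover, in this case the respective constants $\|M\|_{L^{p(\cdot)}_W(\mathbf{R}^d;\mathcal{K})\to L^{p(\cdot)}_W(\mathbf{R}^d;\mathcal{K})_{\mathrm{weak}}}$, $[W]_{p(\cdot)}$ and $[L^{p(\cdot)}_W(\mathbf{R}^d;\mathbf{F}^n)]_{A_{\mathrm{strong}}}$ are equivalent up to constants depending on $n$, $d$, and the global $\log$-Hölder regularity constants of $p$.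
   Context: $d,n\ge 1$ are fixed integers, $\mathbf{F}$ is $\mathbf{R}$ or $\mathbf{C}$, $u\cdot v=\sum_{k=1}^n u_k\overline{v_k}$ and $|u|=|u\cdot u|^{1/2}$ on $\mathbf{F}^n$. $L^0(\mathbf{R}^d;\mathbf{F}^n)$ is the space of measurable functions $\mathbf{R}^d\to\mathbf{F}^n$ (modulo a.e. equality; Lebesgue measure), $L^0(\mathbf{R}^d)$ the case of $\mathbf{F}$-valued functions. A cube is a cube in $\mathbf{R}^d$ with sides parallel to the coordinate axes. A matrix weight is a measurable $W:\mathbf{R}^d\to\mathbf{F}^{n\times n}$ that is Hermitian positive definite a.e. **Variable Lebesgue spaces.** For $1\le p<\infty$ let $\phi_p(t)=\frac1pt^p$, and $\phi_\infty(t)=\infty\cdot\mathbf{1}_{(1,\infty)}(t)$. For measurable $p:\mathbf{R}^d\to[1,\infty]$ and $f\in L^0(\mathbf{R}^d)$ let $\rho_{p(\cdot)}(f)=\int_{\mathbf{R}^d}\phi_{p(x)}(|f(x)|)\,dx$. $L^{p(\cdot)}(\mathbf{R}^d)$ is the space of $f\in L^0(\mathbf{R}^d)$ with $\rho_{p(\cdot)}(f/\lambda)<\infty$ for some $\lambda>0$, with norm $\inf\{\lambda>0:\rho_{p(\cdot)}(f/\lambda)\le1\}$. $\mathbf{X}:=L^{p(\cdot)}_W(\mathbf{R}^d;\mathbf{F}^n)$ is the space of $f\in L^0(\mathbf{R}^d;\mathbf{F}^n)$ with $\|f\|_{\mathbf{X}}:=\||Wf|\|_{L^{p(\cdot)}(\mathbf{R}^d)}<\infty$.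 Its Köthe dual $\mathbf{X}'$ is the space of $g\in L^0(\mathbf{R}^d;\mathbf{F}^n)$ with $\sup_{\|f\|_{\mathbf{X}}=1}\int|f\cdot g|\,dx<\infty$. $p$ is globally $\log$-Hölder continuous if there are $C_1,C_2>0$ and $p_\infty\in[1,\infty]$ with $$\Big|\frac1{p(x)}-\frac1{p(y)}\Big|\le\frac{C_1}{\log(e+\frac1{|x-y|})},\qquad\Big|\frac1{p(x)}-\frac1{p_\infty}\Big|\le\frac{C_2}{\log(e+|x|)}$$ for all $x,y\in\mathbf{R}^d$ (with $1/\infty=0$). **Muckenhoupt conditions.** For a pairwise disjoint collection of cubes $\mathcal{P}$, $T_{\mathcal{P}}f:=\sum_{Q\in\mathcal{P}}\langle f\rangle_Q\mathbf{1}_Q$, $\langle f\rangle_Q=\frac1{|Q|}\int_Qf\,dx$; $T_Q:=T_{\{Q\}}$. Writing $T_{\mathcal{P}}:\mathbf{X}\to\mathbf{X}$ means every $f\in\mathbf{X}$ is integrable over each $Q\in\mathcal{P}$ and $T_{\mathcal{P}}$ is bounded on $\mathbf{X}$. $\mathbf{X}\in A$ (resp. $\mathbf{X}\in A_{\mathrm{strong}}$) means $\mathbf{1}_Qu\in\mathbf{X}$ and $\mathbf{1}_Qu\in\mathbf{X}'$ for all cubes $Q$ and $u\in\mathbf{F}^n$, and $[\mathbf{X}]_A:=\sup_Q\|T_Q\|_{\mathbf{X}\to\mathbf{X}}<\infty$ (resp. $[\mathbf{X}]_{A_{\mathrm{strong}}}:=\sup_{\mathcal{P}}\|T_{\mathcal{P}}\|_{\mathbf{X}\to\mathbf{X}}<\infty$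 over all pairwise disjoint collections of cubes). $W\in A_{p(\cdot)}$ means $L^{p(\cdot)}_W(\mathbf{R}^d;\mathbf{F}^n)\in A$, and $[W]_{p(\cdot)}:=[L^{p(\cdot)}_W(\mathbf{R}^d;\mathbf{F}^n)]_A$. **Convex-set valued weak-type bound.** $\mathcal{K}$ is the collection of non-empty closed convex $K\subseteq\mathbf{F}^n$ with $\lambda u\in K$ for $u\in K$, $\lambda\in\mathbf{F}$, $|\lambda|=1$. $L^0(\mathbf{R}^d;\mathcal{K})$ is the set of $F:\mathbf{R}^d\to\mathcal{K}$ such that $\{x:F(x)\cap E\ne\emptyset\}$ is measurable for every measurable (equivalently, every open) $E\subseteq\mathbf{F}^n$. $S^0(\mathbf{R}^d;F)$ is the set of $f\in L^0(\mathbf{R}^d;\mathbf{F}^n)$ with $f(x)\in F(x)$ a.e. $L^{p(\cdot)}_W(\mathbf{R}^d;\mathcal{K})=\mathbf{X}[\mathcal{K}]$ is the set of $F\in L^0(\mathbf{R}^d;\mathcal{K})$ for which $S^0(\mathbf{R}^d;F)$ is bounded in $\mathbf{X}$, with $\|F\|_{\mathbf{X}[\mathcal{K}]}=\sup_{f\in S^0(\mathbf{R}^d;F)}\|f\|_{\mathbf{X}}$. $L^1_{\mathrm{loc}}(\mathbf{R}^d;\mathcal{K})$ is the set of $F\in L^0(\mathbf{R}^d;\mathcal{K})$ such that for each cube $Q$ the set $S^0(\mathbf{R}^d;F\mathbf{1}_Q)$ is bounded in $L^1(\mathbf{R}^d;\mathbf{F}^n)$ ($F\mathbf{1}_Q$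 equals $F$ on $Q$ and $\{0\}$ off $Q$). For such $F$, $\langle F\rangle_Q:=\{\frac1{|Q|}\int_Qf\,dx:f\in S^0(\mathbf{R}^d;F\mathbf{1}_Q)\}$ and $MF(x):=\overline{\bigcup_{Q\ni x}\langle F\rangle_Q}$. Statement (i) means that $\mathbf{X}[\mathcal{K}]\subseteq L^1_{\mathrm{loc}}(\mathbf{R}^d;\mathcal{K})$ and there is $C>0$ with $\sup_{u\in\mathbf{F}^n}\|\mathbf{1}_{\{x:u\in MF(x)\}}u\|_{\mathbf{X}}\le C\|F\|_{\mathbf{X}[\mathcal{K}]}$ for all $F\in\mathbf{X}[\mathcal{K}]$; the smallest $C$ is the norm of $M$ in (i). *)

(* Defs.v *)
From HB Require Import structures.
From mathcomp Require Import all_boot all_order all_algebra.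
From mathcomp Require Import complex.
From mathcomp Require Import all_classical all_reals all_analysis.
From mathcomp Require Import measurable_realfun.

Set Implicit Arguments.
Unset Strict Implicit.
Unset Printing Implicit Defensive.

Import Order.TTheory GRing.Theory Num.Theory.
Import numFieldNormedType.Exports.

Local Open Scope classical_set_scope.
Local Open Scope ring_scope.

Section tuple_measure_step.
Context {R : realType} {d : nat}.
Variable m : {sigma_finite_measure set (d.-tuple R) -> \bar R}.
Local Open Scope ereal_scope.

Definition tuple_cons (x : R * d.-tuple R) : d.+1.-tuple R :=
  [tuple of x.1 :: x.2].

Lemma measurable_tuple_cons : measurable_fun [set: R * d.-tuple R] tuple_cons.
Proof. exact: (measurable_cons (f := fst) (g := snd)). Qed.

(* Lebesgue measure on the first coordinate times [m] on the other ones. *)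
Definition tuple_measure_step : set (d.+1.-tuple R) -> \bar R :=
  pushforward (@lebesgue_measure R \x m) tuple_cons.

Let step0 : tuple_measure_step set0 = 0.
Proof. by rewrite /tuple_measure_step /pushforward preimage_set0 measure0. Qed.

Let step_ge0 A : 0 <= tuple_measure_step A.
Proof. by rewrite /tuple_measure_step /pushforward measure_ge0. Qed.

Let step_sigma_additive : semi_sigma_additive tuple_measure_step.
Proof.
move=> F mF tF mUF; rewrite /tuple_measure_step /pushforward preimage_bigcup.
have mpre A : measurable A -> measurable (tuple_cons @^-1` A).
  by move=> mA; rewrite -[X in measurable X]setTI; exact: measurable_tuple_cons.
apply: measure_semi_sigma_additive.
- by move=> i; exact: mpre.
- apply/trivIsetP => /= i j _ _ ij; rewrite -preimage_setI.
  by move/trivIsetP : tF => /(_ _ _ _ _ ij) ->//; rewrite preimage_set0.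
- by rewrite -preimage_bigcup; exact: mpre.
Qed.

HB.instance Definition _ := isMeasure.Build _ _ _ tuple_measure_step
  step0 step_ge0 step_sigma_additive.

Let step_sigma_finite : sigma_finite setT tuple_measure_step.
Proof.
have [/= F [FT ndF Foo]] :=
  (sigma_finiteP _ _).1 (@sigma_finiteT _ _ _ (@lebesgue_measure R)).
have [/= G [GT ndG Goo]] := (sigma_finiteP _ _).1 (sigma_finiteT m).
pose uncons (t : d.+1.-tuple R) : R * d.-tuple R :=
  (thead t, [tuple of behead t]).
have unconsK x : uncons (tuple_cons x) = x.
  by case: x => a b; rewrite /uncons; congr pair; exact/val_inj.
have muncons : measurable_fun setT uncons.
  apply/measurable_fun_pairP; split => /=; first exact: measurable_tnth.
  exact: measurable_behead.
exists (fun i => uncons @^-1` (F i `*` G i)).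
  rewrite -preimage_bigcup (_ : \bigcup_i _ = setT) ?preimage_setT//.
  apply/seteqP; split => // -[x y] _.
  have [i _ Fix] : (\bigcup_i F i) x by rewrite -FT.
  have [j _ Gjy] : (\bigcup_i G i) y by rewrite -GT.
  exists (maxn i j) => //; split => /=.
  - by move: x Fix; exact/subsetPset/ndF/leq_maxl.
  - by move: y Gjy; exact/subsetPset/ndG/leq_maxr.
move=> i; have [mF Fioo] := Foo i; have [mG Gioo] := Goo i; split.
  by rewrite -[X in measurable X]setTI; apply: muncons => //; exact: measurableX.
rewrite /tuple_measure_step /pushforward -comp_preimage.
rewrite (_ : uncons \o tuple_cons = id) ?preimage_id; last exact/funext.
by rewrite product_measure1E// lte_mul_pinfty// ge0_fin_numE.
Qed.

HB.instance Definition _ := Measure_isSigmaFinite.Build _ _ _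
  tuple_measure_step step_sigma_finite.

End tuple_measure_step.

Fixpoint borel_lebesgue (R : realType) (d : nat) :
    {sigma_finite_measure set (d.-tuple R) -> \bar R} :=
  match d with
  | 0 => \d_([tuple] : 0.-tuple R)
  | d'.+1 => tuple_measure_step (borel_lebesgue R d')
  end.

(* R^d with its Lebesgue (i.e. completed Borel) sigma-algebra. *)
Definition Rd (R : realType) (d : nat) :
    measurableType (mu_ext (borel_lebesgue R d)).-cara :=
  caratheodory_type (mu_ext (borel_lebesgue R d)).

Definition leb (R : realType) (d : nat) : {measure set (Rd R d) -> \bar R} :=
  @completed_measure_extension _ _ _ (borel_lebesgue R d).

Definition dist_Rd (R : realType) (d : nat) (x y : Rd R d) : R :=
  Num.sqrt (\sum_(i < d) (tnth x i - tnth y i) ^+ 2).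

Definition norm_Rd (R : realType) (d : nat) (x : Rd R d) : R :=
  Num.sqrt (\sum_(i < d) tnth x i ^+ 2).

(* Each side may be open, closed or half-open. *)
Definition is_cube (R : realType) (d : nat) (Q : set (Rd R d)) : Prop :=
  exists (a : 'I_d -> R) (l : R) (bl br : 'I_d -> bool), 0 < l /\
    Q = [set x : Rd R d | forall i : 'I_d,
           tnth x i \in Interval (BSide (bl i) (a i)) (BSide (br i) (a i + l))].

Definition disjoint_cubes (R : realType) (d : nat)
    (P : set (set (Rd R d))) : Prop :=
  P `<=` @is_cube R d /\ trivIset P id.

Inductive scalar_kind := RealScalars | ComplexScalars.

Definition sfield (R : realType) (k : scalar_kind) : numFieldType :=
  match k with RealScalars => R | ComplexScalars => R[i] end.

Definition sc_Re (R : realType) (k : scalar_kind) : sfield R k -> R :=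
  match k return sfield R k -> R with
  | RealScalars => fun x => x
  | ComplexScalars => fun z => complex.Re z
  end.

Definition sc_Im (R : realType) (k : scalar_kind) : sfield R k -> R :=
  match k return sfield R k -> R with
  | RealScalars => fun=> 0
  | ComplexScalars => fun z => complex.Im z
  end.

(* a + i b, where b is ignored over the reals. *)
Definition sc_mk (R : realType) (k : scalar_kind) : R -> R -> sfield R k :=
  match k return R -> R -> sfield R k with
  | RealScalars => fun a _ => a
  | ComplexScalars => fun a b => Complex a b
  end.

Definition sc_conj (R : realType) (k : scalar_kind) (z : sfield R k) :
  sfield R k := sc_mk k (sc_Re z) (- sc_Im z).

Section matrix_weighted_spaces.
Context {R : realType} {k : scalar_kind} {d n : nat}.

Local Notation F := (sfield R k).
Local Notation X := (Rd R d).
Local Notation V := 'cV[sfield R k]_n.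
Local Notation mu := (leb R d).

Definition sc_abs (z : F) : R := sc_Re `|z|.

Definition vdot (u v : V) : F := \sum_(i < n) u i 0 * sc_conj (v i 0).

Definition vnorm (u : V) : R := Num.sqrt (sc_abs (vdot u u)).

(* An element of L^0 is represented by any function in its a.e.-class; the Borel
   sets of F^n are generated by real and imaginary parts of the coordinates. *)
Definition L0 (f : X -> V) : Prop :=
  forall i, measurable_fun setT (fun x => sc_Re (f x i 0)) /\
            measurable_fun setT (fun x => sc_Im (f x i 0)).

Definition integrable_on (Q : set X) (f : X -> V) : Prop :=
  forall i, mu.-integrable Q (fun x => (sc_Re (f x i 0))%:E) /\
            mu.-integrable Q (fun x => (sc_Im (f x i 0))%:E).

Definition average (Q : set X) (f : X -> V) : V :=
  \col_i sc_mk k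
    ((fine (mu Q))^-1 * \int[mu]_(x in Q) sc_Re (f x i 0))
    ((fine (mu Q))^-1 * \int[mu]_(x in Q) sc_Im (f x i 0)).

Definition indic_vec (A : set X) (u : V) : X -> V := fun x => (\1_A x : F) *: u.

Definition matrix_weight (W : X -> 'M[F]_n) : Prop :=
  (forall i j, measurable_fun setT (fun x => sc_Re (W x i j)) /\
               measurable_fun setT (fun x => sc_Im (W x i j))) /\
  {ae mu, forall x, W x = (map_mx (@sc_conj R k) (W x))^T /\
                    forall u : V, u != 0 -> 0 < vdot (W x *m u) u}.

Definition exponent (p : X -> \bar R) : Prop :=
  measurable_fun setT p /\ (forall x, 1 <= p x)%E.

Definition phi (q : \bar R) (t : R) : \bar R :=
  match q with
  | r%:E => (r^-1 * t `^ r)%:E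
  | +oo%E => if t <= 1 then 0%E else +oo%E
  | -oo%E => 0%E (* junk *)
  end.

Definition modular (p : X -> \bar R) (f : X -> R) : \bar R :=
  (\int[mu]_x phi (p x) `|f x|%R)%E.

(* It is +oo when no lambda qualifies, that is, when f is not in L^p(.). *)
Definition Lp_norm (p : X -> \bar R) (f : X -> R) : \bar R :=
  ereal_inf [set l%:E | l in
    [set l : R | 0 < l /\ (modular p (fun x => (f x / l)%R) <= 1)%E]].

Definition LpW_norm (p : X -> \bar R) (W : X -> 'M[F]_n) (f : X -> V) : \bar R :=
  Lp_norm p (fun x => vnorm (W x *m f x)).

(* 1/p(x), with 1/oo = 0 *)
Definition recip (q : \bar R) : R := fine q^-1%E.

(* When x = y, the quotient 1 / |x - y| is 0 instead of oo; both conventions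
   make the first bound trivial. *)
Definition log_Holder_with (C1 C2 : R) (p : X -> \bar R) : Prop :=
  exists pinf : \bar R, (1 <= pinf)%E /\
    (forall x y, `|recip (p x) - recip (p y)|
                   <= C1 / ln (expR 1 + (dist_Rd x y)^-1)) /\
    (forall x, `|recip (p x) - recip pinf| <= C2 / ln (expR 1 + norm_Rd x)).

Definition globally_log_Holder (p : X -> \bar R) : Prop :=
  exists C1 C2 : R, 0 < C1 /\ 0 < C2 /\ log_Holder_with C1 C2 p.

(* A normed space of functions is given by its norm N, extended by +oo to the
   measurable functions outside the space. *)

Definition in_space (N : (X -> V) -> \bar R) (f : X -> V) : Prop :=
  L0 f /\ (N f < +oo)%E.

Definition in_Kothe_dual (N : (X -> V) -> \bar R) (g : X -> V) : Prop :=
  L0 g /\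
  (ereal_sup [set \int[mu]_x (sc_abs (vdot (f x) (g x)))%:E
             | f in [set f | in_space N f /\ N f = 1]] < +oo)%E.

(* When the members of P are pairwise disjoint, at most one term of this finitely
   supported sum is nonzero. *)
Definition averaging (P : set (set X)) (f : X -> V) : X -> V :=
  fun x => \sum_(Q \in P) indic_vec Q (average Q f) x.

Definition averaging_bound (N : (X -> V) -> \bar R) (P : set (set X))
    (C : R) : Prop :=
  forall f, in_space N f ->
    (forall Q, P Q -> integrable_on Q f) /\
    in_space N (averaging P f) /\ (N (averaging P f) <= C%:E * N f)%E.

(* The operator norm of T_P : X -> X, +oo if T_P does not act boundedly on X. *)
Definition averaging_norm (N : (X -> V) -> \bar R) (P : set (set X)) : \bar R :=
  ereal_inf [set C%:E | C in [set C : R | 0 <= C /\ averaging_bound N P C]].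

Definition A_const (N : (X -> V) -> \bar R) : \bar R :=
  ereal_sup [set averaging_norm N [set Q] | Q in @is_cube R d].

Definition A_strong_const (N : (X -> V) -> \bar R) : \bar R :=
  ereal_sup [set averaging_norm N P | P in @disjoint_cubes R d].

Definition contains_cube_indicators (N : (X -> V) -> \bar R) : Prop :=
  forall (Q : set X) (u : V), is_cube Q ->
    in_space N (indic_vec Q u) /\ in_Kothe_dual N (indic_vec Q u).

Definition class_A (N : (X -> V) -> \bar R) : Prop :=
  contains_cube_indicators N /\ (A_const N < +oo)%E.

Definition class_A_strong (N : (X -> V) -> \bar R) : Prop :=
  contains_cube_indicators N /\ (A_strong_const N < +oo)%E.

Definition in_K (K : set V) : Prop :=
  [/\ K !=set0, closed K, convex_set (K : set (convex_lmodType V)) &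
      forall (u : V) (a : F), K u -> `|a| = 1 -> K (a *: u)].

(* Only open E are tested; by completeness of the Lebesgue measure all Borel sets
   E then satisfy the same condition. *)
Definition L0K (G : X -> set V) : Prop :=
  (forall x, in_K (G x)) /\
  (forall E : set V, open E -> measurable [set x | G x `&` E !=set0]).

Definition S0 (G : X -> set V) (f : X -> V) : Prop :=
  L0 f /\ {ae mu, forall x, G x (f x)}.

Definition K_norm (N : (X -> V) -> \bar R) (G : X -> set V) : \bar R :=
  ereal_sup [set N f | f in S0 G].

Definition in_spaceK (N : (X -> V) -> \bar R) (G : X -> set V) : Prop :=
  [/\ L0K G, S0 G `<=` in_space N & (K_norm N G < +oo)%E].

Definition restrict_K (G : X -> set V) (Q : set X) : X -> set V :=
  fun x => if x \in Q then G x else [set 0].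

Definition L1locK (G : X -> set V) : Prop :=
  L0K G /\ forall Q, is_cube Q ->
    (ereal_sup [set \int[mu]_x (vnorm (f x))%:E
               | f in S0 (restrict_K G Q)] < +oo)%E.

Definition averageK (Q : set X) (G : X -> set V) : set V :=
  [set average Q f | f in S0 (restrict_K G Q)].

Definition maximal (G : X -> set V) : X -> set V :=
  fun x => closure (\bigcup_(Q in [set Q | is_cube Q /\ Q x]) averageK Q G).

(* in_space records that the functions 1_{x | u in MG(x)} u are measurable, as
   having a norm requires. *)
Definition maximal_weak_bound (N : (X -> V) -> \bar R) (C : R) : Prop :=
  forall G, in_spaceK N G ->
    (forall u : V, in_space N (indic_vec [set x | maximal G x u] u)) /\
    (ereal_sup [set N (indic_vec [set x | maximal G x u] u) | u in [set: V]]
       <= C%:E * K_norm N G)%E.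

Definition maximal_weak (N : (X -> V) -> \bar R) : Prop :=
  in_spaceK N `<=` L1locK /\ exists C : R, 0 < C /\ maximal_weak_bound N C.

Definition maximal_weak_norm (N : (X -> V) -> \bar R) : \bar R :=
  ereal_inf [set C%:E | C in [set C : R | 0 < C /\ maximal_weak_bound N C]].

End matrix_weighted_spaces.

Definition comparable_up_to (R : realType) (K : R) (a b : \bar R) : Prop :=
  (a <= K%:E * b)%E /\ (b <= K%:E * a)%E.

(* Main.v *)
Require Import Defs.
From mathcomp Require Import all_boot all_order all_algebra.
From mathcomp Require Import complex.
From mathcomp Require Import all_classical all_reals all_analysis.
From mathcomp Require Import measurable_realfun.
From mathcomp Require Import ring lra.

(** The three conditions are related by A => A_strong => weak type => A, with explicit
    constants; X is the space, ||f|| the norm of f in it, and T_P the averaging operator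
    of a family P of cubes.

    _From single cubes to disjoint families._ Suppose that h vanishes off a disjoint family
    of cubes and ||1_Q h|| <= K ||1_Q f|| for each Q of the family. If the exponent is constant,
    ||h|| <= K ||f|| since p-th powers of norms add up. For a log-Hoelder exponent the same holds
    up to a constant ([gLp_localization], [Lp_norm_localization]). Normalize f to modular
    at most 1, fix an integrable w > 0 of integral at most 1 decaying like |x|^(-d-1), and let
    B be the integral over Q of phi_p(|f|) + w. Since phi_q(B^(1/q) s) = B phi_q(s), the exponent
    may be treated as constant on Q as soon as B^(1/p) is, up to a factor; and it is, because
    |1/p(x) - 1/p(y)| |ln B| is bounded for x and y in Q, thanks to the lower bound for B
    that comes from w ([cube_oscillation]). Then the modular of a fixed multiple of h on Q is at most
    B/2, and the sum of all B is at most 2. For h = |W T_P f| and the scalar function |W f|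
    the hypothesis is the bound for T_Q, so A implies A_strong ([averaging_bound_strong]).

    _From disjoint families to the maximal operator._ If u belongs to MF(x), then u is close
    to an average over a cube containing x of a selection f of F. By the one-third trick
    ([one_third_trick], [dyadic_cover]) this cube lies in a cube R, at most 6 times as long, of
    one of 2^d dyadic grids. As F has convex values containing 0, extending f by 0 and
    shrinking it gives a selection with average close to 6^-d u over R. In each grid the
    maximal R are disjoint, their selections glue to a single one, f_P, and 6^d T_P f_P is close
    to u on all of them. So the norm of u on the set where u is in MF is at most
    a constant times the sum of the norms of the 2^d functions T_P f_P, up to errors that
    vanish in the limit ([near_maximal_bound], [maximal_weak_bound_of_strong]).

    _From the maximal operator to single cubes._ For f in X let F(x) be the set of all a f(x),
    |a| <= 1. It has the norm of f, and <f>_Q is in MF(x) for each x in Q, so the weak bound for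
    u = <f>_Q bounds T_Q f = 1_Q u ([averaging_bound_of_weak]). Indicators are in X because
    T_Q 1_E u is a multiple of 1_Q u for E a subset of Q on which W is bounded, and in the
    Koethe dual because the bound for T_Q, tested on f times the sign of a coordinate,
    controls the integral of |f| over Q ([integral_le_N],
    [contains_cube_indicators_of_averaging]). *)

Set Implicit Arguments.
Unset Strict Implicit.
Unset Printing Implicit Defensive.

Import Order.TTheory GRing.Theory Num.Theory.
Import numFieldNormedType.Exports.

Local Open Scope classical_set_scope.
Local Open Scope ring_scope.

(** * Lebesgue measure of boxes *)

Section boxes.
Context {R : realType}.

Definition box d (A : 'I_d -> set R) : set (Rd R d) :=
  [set x | forall i, A i (tnth x i)].

Lemma box_tuple_measurable d (A : 'I_d -> set R) :
  (forall i, measurable (A i)) ->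
  measurable ([set x | forall i, A i (tnth x i)] : set (d.-tuple R)).
Proof.
move=> mA.
rewrite (_ : [set _ | _] = \bigcap_(i in [set: 'I_d]) ((fun x : d.-tuple R => tnth x i) @^-1` A i)).
  apply: fin_bigcap_measurable => // i _.
  by have := @measurable_tnth _ R d i measurableT (A i) (mA i); rewrite setTI.
by apply/seteqP; split => x /= h i *; apply: h.
Qed.

Lemma borel_lebesgue_box d (A : 'I_d -> set R) :
  (forall i, measurable (A i)) ->
  borel_lebesgue R d [set x | forall i, A i (tnth x i)] =
    (\prod_(i < d) lebesgue_measure (A i))%E.
Proof.
elim: d A => [|d ih] A mA.
  rewrite big_ord0 /= diracE mem_set//=; by case.
rewrite big_ord_recl /= /tuple_measure_step /pushforward.
rewrite (_ : _ @^-1` _ = A ord0 `*` [set x | forall i, A (lift ord0 i) (tnth x i)]).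
  have mB : measurable [set x : d.-tuple R | forall i, A (lift ord0 i) (tnth x i)].
    by apply: (@box_tuple_measurable d (fun i => A (lift ord0 i))) => i; exact: mA.
  rewrite product_measure1E//; last exact: mA.
  congr (_ * _)%E; apply: (ih (fun i => A (lift ord0 i))) => i; exact: mA.
apply/seteqP; split => -[x y] /=.
  move=> h; split; first by have := h ord0; rewrite (tnth_nth 0).
  by move=> i; have := h (lift ord0 i); rewrite /tuple_cons !(tnth_nth 0)/=.
move=> [h0 h] i; case: (unliftP ord0 i) => [j ->|->].
  by have := h j; rewrite /tuple_cons !(tnth_nth 0)/=.
by rewrite (tnth_nth 0).
Qed.

Lemma tuple_measurable_Rd d (A : set (d.-tuple R)) :
  measurable A -> measurable (A : set (Rd R d)).
Proof. by move=> mA; apply: sub_caratheodory; exact: sub_sigma_algebra. Qed.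

Lemma leb_tupleE d (A : set (d.-tuple R)) :
  measurable A -> leb R d A = borel_lebesgue R d A.
Proof. by move=> mA; rewrite /leb /= /completed_measure_extension measurable_mu_extE. Qed.

Lemma box_measurable d (A : 'I_d -> set R) :
  (forall i, measurable (A i)) -> measurable (box A).
Proof. by move=> mA; apply: tuple_measurable_Rd; exact: box_tuple_measurable. Qed.

Lemma leb_box d (A : 'I_d -> set R) : (forall i, measurable (A i)) ->
  leb R d (box A) = (\prod_(i < d) lebesgue_measure (A i))%E.
Proof.
move=> mA; rewrite -borel_lebesgue_box// -leb_tupleE//.
exact: box_tuple_measurable.
Qed.

End boxes.

(** * Cubes and an integrable weight *)

Section spread_weight.
Context {R : realType} {disp} {X : measurableType disp} (mu : {measure set X -> \bar R}).
Variable B : nat -> set X.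
Hypothesis mB : forall j, measurable (B j).
Hypothesis B_fin : forall j, exists2 b : R, 0 < b & mu (B j) = b%:E.

Let wterm j (x : X) : \bar R :=
  ((1 / (2 ^ j.+1)%:R / fine (mu (B j)))%:E * (\1_(B j) x)%:E)%E.

(** For the sets [-2^j, 2^j]^d this is, up to constants, the integrable function
    (1 + |x|)^(-d-1); in the form of a series its integrals are easy to estimate. *)
Definition spread_weight (x : X) : \bar R := (\sum_(j <oo) wterm j x)%E.

Let coef_ge0 j : 0 <= 1 / (2 ^ j.+1)%:R / fine (mu (B j)) :> R.
Proof. by rewrite !divr_ge0// fine_ge0. Qed.

Let wterm_ge0 j x : (0 <= wterm j x)%E.
Proof. by rewrite mule_ge0// lee_fin. Qed.

Let wterm_meas j D : measurable_fun D (wterm j).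
Proof.
apply: emeasurable_funM => //; apply/measurable_EFinP; exact: measurable_indic.
Qed.

Lemma spread_weight_ge0 x : (0 <= spread_weight x)%E.
Proof. by apply: nneseries_ge0. Qed.

Lemma measurable_spread_weight D : measurable D -> measurable_fun D spread_weight.
Proof. by move=> mD; apply: ge0_emeasurable_sum. Qed.

Let integral_wterm j D : measurable D -> (\int[mu]_(x in D) wterm j x =
  (1 / (2 ^ j.+1)%:R / fine (mu (B j)))%:E * mu (B j `&` D))%E.
Proof.
move=> mD; rewrite ge0_integralZl ?lee_fin//; last first.
  by apply/measurable_EFinP; exact: measurable_indic.
by rewrite integral_indic.
Qed.

Lemma integral_spread_weight : (\int[mu]_x spread_weight x <= 1)%E.
Proof.
rewrite integral_nneseries//.
rewrite (@eq_eseriesr _ _ (fun j => (1 / (2 ^ j.+1)%:R)%:E)).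
  exact: epsilon_trick0.
move=> j _; rewrite integral_wterm// setIT.
by have [b b0 ->] := B_fin j; rewrite -EFinM divfK// gt_eqF.
Qed.

Lemma integral_spread_weight_ge j D : measurable D ->
  ((1 / (2 ^ j.+1)%:R / fine (mu (B j)))%:E * mu (B j `&` D) <=
    \int[mu]_(x in D) spread_weight x)%E.
Proof.
move=> mD; rewrite -integral_wterm//; apply: ge0_le_integral => //.
  exact: measurable_spread_weight.
move=> x Dx; apply: le_trans (nneseries_lim_ge j.+1 _) => //.
by rewrite big_mkord big_ord_recr /= leeDr// sume_ge0.
Qed.

End spread_weight.

Section cubes.
Context {R : realType} {d : nat}.
Local Notation X := (Rd R d).
Local Notation mu := (leb R d).

Definition cube (a : 'I_d -> R) (l : R) (bl br : 'I_d -> bool) : set X :=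
  [set x : X | forall i, tnth x i \in Interval (BSide (bl i) (a i)) (BSide (br i) (a i + l))].

Definition ocube (a : 'I_d -> R) (l : R) : set X :=
  cube a l (fun=> false) (fun=> true).

Lemma ocubeE a l x : ocube a l x <-> forall i, a i < tnth x i < a i + l.
Proof. by split=> h i; have := h i; rewrite in_itv. Qed.

Lemma is_cubeP (Q : set X) : is_cube Q -> exists a l bl br, 0 < l /\ Q = cube a l bl br.
Proof. by move=> [a [l [bl [br [l0 ->]]]]]; exists a, l, bl, br. Qed.

Lemma is_cube_cube a l bl br : 0 < l -> is_cube (cube a l bl br).
Proof. by move=> l0; exists a, l, bl, br. Qed.

Lemma mem_cube a l bl br x : cube a l bl br x -> forall i, a i <= tnth x i <= a i + l.
Proof.
move=> h i; have := h i; rewrite in_itv /=.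
case: (bl i); case: (br i) => /andP[h1 h2]; apply/andP; split => //; exact: ltW.
Qed.

Lemma ocube_sub a l bl br : ocube a l `<=` cube a l bl br.
Proof.
move=> x /ocubeE h i; have /andP[h1 h2] := h i; rewrite in_itv/=.
by case: (bl i); case: (br i); rewrite /= ?h1 ?h2 ?(ltW h1) ?(ltW h2).
Qed.

Lemma cube_measurable (Q : set X) : is_cube Q -> measurable Q.
Proof.
move=> /is_cubeP[a [l [bl [br [_ ->]]]]].
exact: (@box_measurable R d (fun i => [set` Interval (BSide (bl i) (a i)) (BSide (br i) (a i + l))])).
Qed.

Lemma leb_cube a l bl br : 0 < l -> mu (cube a l bl br) = (l ^+ d)%:E.
Proof.
move=> l0.
rewrite (@leb_box R d (fun i => [set` Interval (BSide (bl i) (a i)) (BSide (br i) (a i + l))]))//.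
rewrite (eq_bigr (fun=> l%:E)).
  by rewrite prodEFin prodr_const card_ord.
move=> i _; rewrite lebesgue_measure_itv /= lte_fin ltrDl l0 -EFinD.
by rewrite addrC addKr.
Qed.

Lemma leb_is_cube (Q : set X) : is_cube Q -> exists2 m : R, 0 < m & mu Q = m%:E.
Proof.
move=> /is_cubeP[a [l [bl [br [l0 ->]]]]]; exists (l ^+ d); first exact: exprn_gt0.
exact: leb_cube.
Qed.

Lemma is_cube_rat (Q : set X) : is_cube Q ->
  exists q : {ffun 'I_d -> rat}, Q [tuple (ratr (q i) : R) | i < d].
Proof.
move=> /is_cubeP[a [l [bl [br [l0 ->]]]]].
have /choice[q hq] : forall i, exists q : rat, a i < ratr q < a i + l.
  move=> i; have [|q] := @rat_in_itvoo R (a i) (a i + l); first by rewrite ltrDl.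
  by rewrite in_itv => ?; exists q.
exists [ffun i => q i]; apply: ocube_sub; apply/ocubeE => i.
by rewrite tnth_mktuple ffunE.
Qed.

(** Disjoint cubes contain different rational points, so there are countably many. *)
Lemma disjoint_cubes_enum (P : set (set X)) : disjoint_cubes P ->
  exists F : nat -> set X, [/\ forall n, P (F n) \/ F n = set0, trivIset setT F &
    forall Q, P Q -> exists n, F n = Q].
Proof.
move=> [Pc tP].
have /choice[q hq] : forall Q : set X, exists q : {ffun 'I_d -> rat},
    is_cube Q -> Q [tuple (ratr (q i) : R) | i < d].
  move=> Q; have [/is_cube_rat[q hq]|nQ] := pselect (is_cube Q); first by exists q.
  by exists [ffun=> 0%R].
have inj Q Q' : P Q -> P Q' -> q Q = q Q' -> Q = Q'.
  move=> PQ PQ' qQ; apply: tP => //.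
  exists [tuple (ratr (q Q i) : R) | i < d]; split; first by apply: hq; exact: Pc.
  by rewrite qQ; apply: hq; exact: Pc.
pose F n := [set x | exists Q, [/\ P Q, choice.pickle (q Q) = n & Q x]].
have FE Q : P Q -> F (choice.pickle (q Q)) = Q.
  move=> PQ; apply/seteqP; split => x.
    by move=> [Q' [PQ' /(pcan_inj choice.pickleK) /inj ->]].
  by move=> Qx; exists Q.
exists F; split.
- move=> n; have [[Q [PQ qn]]|] := pselect (exists Q, P Q /\ choice.pickle (q Q) = n).
    by left; rewrite -qn FE.
  move=> h; right; rewrite -subset0 => x [Q [PQ qn _]]; apply: h; by exists Q.
- move=> n m _ _ [x [[Q [PQ qn Qx]] [Q' [PQ' qm Q'x]]]].
  rewrite -qn -qm; congr (choice.pickle (q _)); apply: tP => //; by exists x.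
- by move=> Q PQ; exists (choice.pickle (q Q)); exact: FE.
Qed.

Lemma bigcup_enum (P : set (set X)) (F : nat -> set X) :
  (forall n, P (F n) \/ F n = set0) -> (forall Q, P Q -> exists n, F n = Q) ->
  \bigcup_(Q in P) Q = \bigcup_n F n.
Proof.
move=> PF FP; apply/seteqP; split => x.
  by move=> [Q /FP[n <-] ?]; exists n.
by move=> [n _]; have [PFn ?|->//] := PF n; exists (F n).
Qed.

Lemma norm_Rd_coord (x : X) i : `|tnth x i| <= norm_Rd x.
Proof.
rewrite -sqrtr_sqr ler_sqrt ?sumr_ge0// => [|j _]; last exact: sqr_ge0.
by rewrite (bigD1 i)//= lerDl sumr_ge0// => j _; exact: sqr_ge0.
Qed.

Lemma norm_Rd_ge0 (x : X) : 0 <= norm_Rd x.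
Proof. exact: sqrtr_ge0. Qed.

Lemma dist_Rd_cube a l bl br (x y : X) : 0 < l -> cube a l bl br x -> cube a l bl br y ->
  dist_Rd x y <= d%:R * l.
Proof.
move=> l0 /mem_cube Qx /mem_cube Qy.
have dl : 0 <= d%:R * l by rewrite mulr_ge0// ltW.
rewrite -(ger0_norm dl) -sqrtr_sqr ler_sqrt ?sqr_ge0//.
apply: (@le_trans _ _ (\sum_(i < d) l ^+ 2)).
  apply: ler_sum => i _; have := Qx i; have := Qy i; nra.
rewrite sumr_const card_ord -[X in X <= _]mulr_natl exprMn ler_wpM2r ?sqr_ge0//.
rewrite -natrX ler_nat; case: (d) => // k; by rewrite leq_pmulr.
Qed.

Definition dyadic_ball (j : nat) : set X :=
  cube (fun=> - 2 ^+ j) (2 ^+ j.+1) (fun=> true) (fun=> false).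

Lemma dyadic_ballE j x : dyadic_ball j x <-> forall i, `|tnth x i| <= 2 ^+ j.
Proof.
by split=> h i; have := h i; rewrite in_itv/= ler_norml exprS (_ : - _ + _ = 2^+j) //; lra.
Qed.

Lemma dyadic_ball_cube j : is_cube (dyadic_ball j).
Proof. by apply: is_cube_cube; rewrite exprn_gt0. Qed.

Lemma leb_dyadic_ball j : mu (dyadic_ball j) = ((2 ^+ j.+1) ^+ d)%:E.
Proof. by rewrite leb_cube// exprn_gt0. Qed.

(** The part of Q near x contains a cube of side min(1, l), which lies in the ball [-2^j, 2^j]^d
    with 2^j of the order of |x| + 1. *)
Lemma cube_spread_weight a l bl br (x : X) : 0 < l -> cube a l bl br x ->
  ((Num.min 1 l ^+ d / (4 * (norm_Rd x + 1)) ^+ d.+1)%:E <=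
     \int[mu]_(y in cube a l bl br) spread_weight mu dyadic_ball y)%E.
Proof.
move=> l0 Qx; set m := Num.min 1 l.
have m0 : 0 < m by rewrite lt_min ltr01.
have m1 : m <= 1 by rewrite ge_min lexx.
have ml : m <= l by rewrite ge_min lexx orbT.
have x0 := norm_Rd_ge0 x.
have [j [j1 j2]] : exists j, norm_Rd x + 1 <= 2 ^+ j /\ 2 ^+ j <= 2 * (norm_Rd x + 1).
  have ex : exists j, norm_Rd x + 1 <= 2 ^+ j.
    exists (Num.bound (norm_Rd x + 1)); apply/ltW/upper_nthrootP; exact: leqnn.
  have := ex_minnP ex => -[[|j] hj jmin]; first by exists 0%N; split => //; lra.
  exists j.+1; split => //; rewrite exprS ler_pM2l//.
  by rewrite leNgt; apply/negP => /ltW /jmin; rewrite ltnn.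
apply: le_trans (integral_spread_weight_ge _ _ j _) => //; last first.
- by apply: cube_measurable; exact: is_cube_cube.
- by move=> i; apply: cube_measurable; exact: dyadic_ball_cube.
pose b i := Num.max (a i) (tnth x i - m).
have sub : ocube b m `<=` dyadic_ball j `&` cube a l bl br.
  move=> y /ocubeE hy; split.
    apply/dyadic_ballE => i; have /andP[] := hy i; rewrite /b gt_max => /andP[h1 h2] h3.
    have := mem_cube Qx i => /andP[h4 h5].
    have := norm_Rd_coord x i; rewrite ler_norml => /andP[h6 h7].
    have : b i <= tnth x i by rewrite ge_max h4 gerBl ltW.
    rewrite /b => h8; rewrite ler_norml; lra.
  apply: ocube_sub; apply/ocubeE => i; have /andP[] := hy i.
  have := mem_cube Qx i => /andP[h4 h5].
  rewrite /b gt_max => /andP[h1 h2] h3; rewrite h1 /=.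
  apply: (lt_le_trans h3); rewrite -lerBrDr ge_max; apply/andP; split; lra.
rewrite leb_dyadic_ball.
apply: (@le_trans _ _ ((1 / (2 ^ j.+1)%:R / (2 ^+ j.+1) ^+ d)%:E * mu (ocube b m))%E).
  rewrite leb_cube// -EFinM lee_fin mulrC ler_wpM2r ?exprn_ge0 ?(ltW m0)//.
  rewrite natrX -mulrA -invfM -exprS mul1r lef_pV2 ?posrE ?exprn_gt0//; last first.
    by rewrite mulr_gt0// ltr_wpDl.
  by rewrite lerXn2r ?nnegrE ?exprn_ge0// ?mulr_ge0 ?addr_ge0// exprS; lra.
rewrite lee_wpmul2l// ?lee_fin ?divr_ge0 ?exprn_ge0//.
apply: le_measure sub; rewrite inE.
  by apply: cube_measurable; exact: is_cube_cube.
by apply: measurableI; apply: cube_measurable; [exact: dyadic_ball_cube|exact: is_cube_cube].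
Qed.

End cubes.

(** * The functions phi and the variable Lebesgue norm *)

Section phi_lemmas.
Context {R : realType}.
Implicit Types (q : \bar R) (s t c B : R).

Lemma phi_ge0 q t : 0 <= t -> (1 <= q)%E -> (0 <= phi q t)%E.
Proof.
case: q => [r| |]//= t0 r1; last by case: ifP.
by rewrite lee_fin mulr_ge0 ?powR_ge0// invr_ge0 (le_trans ler01).
Qed.

Lemma phi0 q : (1 <= q)%E -> phi q 0 = 0%E.
Proof.
case: q => [r| |]//= r1; last by rewrite ler01.
by rewrite powR0 ?mulr0// gt_eqF// (lt_le_trans ltr01).
Qed.

Lemma phi_homo q s t : (1 <= q)%E -> 0 <= s -> s <= t -> (phi q s <= phi q t)%E.
Proof.
case: q => [r| |]//= r1 s0 st; last first.
  case: ifPn => [_|]; first by case: ifP.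
  by rewrite -ltNge => /lt_le_trans/(_ st); rewrite ltNge => /negbTE ->.
have r0 : 0 <= r by exact: le_trans ler01 r1.
by rewrite lee_fin ler_wpM2l ?invr_ge0// ge0_ler_powR// nnegrE// (le_trans s0).
Qed.

(** phi_q is convex and vanishes at 0. *)
Lemma phi_contract q c t : (1 <= q)%E -> 0 <= c <= 1 -> 0 <= t ->
  (phi q (c * t) <= c%:E * phi q t)%E.
Proof.
move=> q1 /andP[c0 c1] t0; have [->|cneq0] := eqVneq c 0.
  by rewrite mul0r phi0// mul0e.
have cgt0 : 0 < c by rewrite lt_neqAle eq_sym cneq0.
case: q q1 => [r| |]//= r1; last first.
  have [t1|t1] := leP t 1; first by rewrite mulr_ile1 ?mule0.
  by rewrite gt0_muley ?lte_fin ?leey.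
rewrite lee_fin mulrCA ler_wpM2l ?invr_ge0 ?(le_trans ler01)// powRM//.
rewrite ler_wpM2r ?powR_ge0//.
by rewrite -[leRHS]powRr1// ger_powR// cgt0.
Qed.

(** The exponent q enters the scaling of phi_q only through B^(1/q). For q = oo both sides
    are 0 or oo. *)
Lemma phi_scale q B t : (1 <= q)%E -> 0 < B -> 0 <= t ->
  phi q (B `^ recip q * t) = (B%:E * phi q t)%E.
Proof.
rewrite /recip; case: q => [r| |]//= r1 B0 t0; last first.
  by rewrite powRr0 mul1r; case: ifP; rewrite ?mule0// gt0_muley ?lte_fin.
have r0 : 0 < r by exact: lt_le_trans ltr01 r1.
rewrite /inve gt_eqF//= powRM ?powR_ge0// -powRrM mulVf ?gt_eqF// powRr1 ?(ltW B0)//.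
by rewrite mulrCA.
Qed.

(** The bound is uniform in q: t^q / q >= (1 + q ln t) / q, as e^s >= 1 + s. *)
Lemma phi_ge_ln q t : (1 <= q)%E -> 1 <= t -> ((ln t)%:E <= phi q t)%E.
Proof.
case: q => [r| |]//= r1 t1; last first.
  case: ifPn => t1'; last by rewrite leey.
  by have -> : t = 1; [apply/eqP; rewrite eq_le t1' t1|rewrite ln1].
have r0 : 0 < r by exact: lt_le_trans ltr01 r1.
have t0 : 0 < t by exact: lt_le_trans ltr01 t1.
rewrite lee_fin -(ler_pM2l r0) mulrA divff ?gt_eqF// mul1r /powR gt_eqF//.
by apply: le_trans (expR_ge1Dx _); rewrite lerDr.
Qed.

Lemma phi_le_id q t : (1 <= q)%E -> 0 <= t <= 1 -> (phi q t <= t%:E)%E.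
Proof.
move=> q1 t01; rewrite -[X in phi _ X]mulr1; apply: (le_trans (phi_contract q1 t01 _)) => //.
rewrite -[leRHS]mule1 lee_wpmul2l//; first by case/andP: t01.
case: q q1 => [r| |]//= r1; last by rewrite lexx.
by rewrite lee_fin powR1 mulr1 invf_le1// (lt_le_trans ltr01).
Qed.

Lemma recip_ge0 q : (1 <= q)%E -> 0 <= recip q.
Proof.
rewrite /recip; case: q => [r| |]//= r1; rewrite /inve gt_eqF ?(lt_le_trans ltr01)//=.
by rewrite invr_ge0 (le_trans ler01).
Qed.

Lemma recip_le1 q : (1 <= q)%E -> recip q <= 1.
Proof.
rewrite /recip; case: q => [r| |]//= r1; rewrite /inve gt_eqF ?(lt_le_trans ltr01)//=.
by rewrite invf_le1// (lt_le_trans ltr01).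
Qed.

(** The exponent varies with x, so the power is written through exp and ln, which
    reduces the claim to measurability in p and f separately. *)
Lemma measurable_phi {disp} {X : measurableType disp} D (p : X -> \bar R) (f : X -> R) :
  measurable_fun setT p -> (forall x, 1 <= p x)%E ->
  measurable_fun setT f -> measurable_fun D (fun x => phi (p x) `|f x|).
Proof.
move=> mp p1 mf; apply: measurable_funTS.
rewrite (_ : (fun _ => _) = (fun x => if p x == +oo%E then
    (if `|f x| <= 1 then 0%E else +oo%E) else
    (expR (- ln (fine (p x))) *
      (if `|f x| == 0 then 0 else expR (fine (p x) * ln `|f x|)))%:E)); last first.
  apply/funext => x; case: (p x) (p1 x) => [r| |]//= r1.
  have r0 : 0 < r by exact: lt_le_trans ltr01 r1.
  rewrite expRN lnK ?posrE// /powR; case: ifPn => // _.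
  by rewrite gt_eqF.
have mnf : measurable_fun setT (fun x => `|f x|) by exact: measurableT_comp.
have mfp : measurable_fun setT (fun x => fine (p x)).
  by apply: measurableT_comp.
apply: measurable_fun_ifT; first exact: measurable_fun_eqe.
  by apply: measurable_fun_ifT => //; exact: measurable_fun_ler.
apply/measurable_EFinP; apply: measurable_funM.
  apply: measurableT_comp => //; apply: measurableT_comp => //.
  by apply: measurableT_comp => //; exact: measurable_ln.
apply: measurable_fun_ifT => //; first exact: measurable_fun_eqr.
apply: measurableT_comp => //; apply: measurable_funM => //.
by apply: measurableT_comp => //; exact: measurable_ln.
Qed.

End phi_lemmas.

Lemma le_scale_gt {R : realType} (K : R) (A x : \bar R) : 0 < K -> (0 <= A)%E ->
  (forall l : R, (A < l%:E)%E -> (x <= (K * l)%:E)%E) -> (x <= K%:E * A)%E.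
Proof.
move=> K0; case: A => [a| |]// a0 h; last by rewrite gt0_muley ?lte_fin ?leey.
apply/lee_addgt0Pr => e e0; rewrite -EFinM -EFinD.
have := h (a + e / K); rewrite lte_fin ltrDl divr_gt0// => /(_ isT).
by rewrite mulrDr mulrCA divff ?gt_eqF// mulr1.
Qed.

Section Lp.
Context {R : realType} {disp} {X : measurableType disp} (mu : {measure set X -> \bar R}).
Variable p : X -> \bar R.
Hypothesis mp : measurable_fun setT p.
Hypothesis p1 : forall x, (1 <= p x)%E.
Implicit Types (f g h : X -> R) (l : R).

(** [modular] and [Lp_norm] over an arbitrary measure space. *)
Definition gmodular f : \bar R := (\int[mu]_x phi (p x) `|f x|)%E.

Definition gLp f : \bar R := ereal_inf [set l%:E | l in
    [set l : R | 0 < l /\ (gmodular (fun x => (f x / l)%R)%R <= 1)%E]].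

Let mphi D f : measurable_fun setT f -> measurable_fun D (fun x => phi (p x) `|f x|).
Proof. exact: measurable_phi. Qed.

Lemma gLp_ge0 f : (0 <= gLp f)%E.
Proof. by apply: le_ereal_inf_tmp => _ [l [l0 _] <-]; rewrite lee_fin ltW. Qed.

Lemma gmodular_ae_homo f g : measurable_fun setT f -> measurable_fun setT g ->
  {ae mu, forall x, `|f x| <= `|g x|} -> (gmodular f <= gmodular g)%E.
Proof.
move=> mf mg fg; apply: ae_ge0_le_integral => //.
- by move=> x _; exact: phi_ge0.
- exact: mphi.
- by move=> x _; exact: phi_ge0.
- exact: mphi.
- by apply: filterS fg => x fgx _; exact: phi_homo.
Qed.

Lemma gmodular_homo f g : measurable_fun setT f -> measurable_fun setT g ->
  (forall x, `|f x| <= `|g x|) -> (gmodular f <= gmodular g)%E.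
Proof. by move=> mf mg fg; apply: gmodular_ae_homo => //; exact: aeW. Qed.

Lemma gLp_le f l : 0 < l -> (gmodular (fun x => f x / l)%R <= 1)%E -> (gLp f <= l%:E)%E.
Proof. by move=> l0 fl; apply: ereal_inf_lbound; exists l. Qed.

Let mdiv f l : measurable_fun setT f -> measurable_fun setT (fun x => f x / l).
Proof. by move=> mf; exact: measurable_funM. Qed.

Lemma gLp_lt f l : measurable_fun setT f -> (gLp f < l%:E)%E ->
  0 < l /\ (gmodular (fun x => f x / l)%R <= 1)%E.
Proof.
move=> mf /ereal_inf_lt[_ [m [m0 fm] <-]]; rewrite lte_fin => ml.
have l0 : 0 < l by exact: lt_trans ml.
split=> //; apply: le_trans fm; apply: gmodular_homo; rewrite //; try exact: mdiv.
move=> x; rewrite !normrM ler_wpM2l// !ger0_norm ?invr_ge0 ?ltW//.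
by rewrite ltf_pV2.
Qed.

Lemma gLp_ae_homo f g : measurable_fun setT f -> measurable_fun setT g ->
  {ae mu, forall x, `|f x| <= `|g x|} -> (gLp f <= gLp g)%E.
Proof.
move=> mf mg fg; apply: le_ereal_inf_tmp => _ [l [l0 gl] <-].
apply: gLp_le => //; apply: le_trans gl; apply: gmodular_ae_homo; try exact: mdiv.
by apply: filterS fg => x fgx; rewrite !normrM ler_wpM2r.
Qed.

Lemma gLp_homo f g : measurable_fun setT f -> measurable_fun setT g ->
  (forall x, `|f x| <= `|g x|) -> (gLp f <= gLp g)%E.
Proof. by move=> mf mg fg; apply: gLp_ae_homo => //; exact: aeW. Qed.

Lemma gmodular0 : gmodular (fun=> 0) = 0%E.
Proof. by apply: integral0_eq => x _; rewrite normr0 phi0. Qed.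

Lemma gLp0 : gLp (fun=> 0) = 0%E.
Proof.
apply/eqP; rewrite eq_le gLp_ge0 andbT; apply/lee_addgt0Pr => e e0; rewrite add0e.
by apply: gLp_le => //; under eq_fun do rewrite mul0r; rewrite gmodular0.
Qed.

Lemma gLpZ c f : measurable_fun setT f -> (gLp (fun x => c * f x)%R <= `|c|%:E * gLp f)%E.
Proof.
move=> mf; have [->|c0] := eqVneq c 0.
  by under eq_fun do rewrite mul0r; rewrite gLp0 normr0 mul0e.
have c0' : 0 < `|c| by rewrite normr_gt0.
apply: le_scale_gt => //; first exact: gLp_ge0.
move=> l /(gLp_lt mf)[l0 fl]; apply: gLp_le; first by rewrite mulr_gt0.
apply: le_trans fl; apply: gmodular_homo; try by apply: mdiv => //; exact: measurable_funM.
move=> x; rewrite !normrM !normfV normrM normr_id invfM mulrACA divff ?gt_eqF//.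
by rewrite mul1r.
Qed.

Lemma gmodular_contract c f : measurable_fun setT f -> 0 <= c <= 1 ->
  (gmodular (fun x => c * f x)%R <= c%:E * gmodular f)%E.
Proof.
move=> mf c01; have c0 : 0 <= c by case/andP: c01.
rewrite -ge0_integralZl//; last 2 first.
  exact: mphi.
  by move=> x _; exact: phi_ge0.
apply: ge0_le_integral => //.
- by move=> x _; exact: phi_ge0.
- by apply: mphi; exact: measurable_funM.
- by apply: emeasurable_funM => //; exact: mphi.
by move=> x _; rewrite normrM (ger0_norm c0) phi_contract.
Qed.

(** Dominating h by the largest of K functions costs the factor K, because
    dividing by K makes the K modulars add up to at most 1. *)
Lemma gLp_max (I : finType) (f : I -> X -> R) h A : (0 < #|I|)%N ->
  measurable_fun setT h -> (forall i, measurable_fun setT (f i)) ->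
  (forall x, exists i, `|h x| <= `|f i x|) ->
  (forall i, gLp (f i) <= A)%E -> (gLp h <= (#|I|%:R : R)%:E * A)%E.
Proof.
move=> I0 mh mf hf fA.
have K0 : 0 < #|I|%:R :> R by rewrite ltr0n.
have [i0 _] : exists i : I, true by move/card_gt0P: I0 => [i _]; exists i.
have A0 : (0 <= A)%E by exact: le_trans (gLp_ge0 _) (fA i0).
apply: le_scale_gt => // l Al.
have l0 : 0 < l by rewrite -lte_fin (le_lt_trans _ Al).
have fl i : (gmodular (fun x => f i x / l)%R <= 1)%E.
  by have [] := gLp_lt (mf i) (le_lt_trans (fA i) Al).
apply: gLp_le; first exact: mulr_gt0.
pose g i x := (#|I|%:R)^-1 * (f i x / l).
have mg i : measurable_fun setT (g i) by apply: measurable_funM => //; exact: mdiv.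
apply: (@le_trans _ _ (\sum_(i : I) gmodular (g i))%E); last first.
  apply: (@le_trans _ _ (\sum_(i : I) (#|I|%:R^-1)%:E)%E).
    apply: lee_sum => i _; apply: le_trans (gmodular_contract _ _) _.
    - exact: mdiv.
    - by rewrite invr_ge0 ler0n invf_le1//= ler1n.
    rewrite -[leRHS]mule1 lee_wpmul2l// lee_fin invr_ge0; exact: ltW.
  by rewrite sumEFin lee_fin sumr_const -[X in X <= _]mulr_natl divff ?gt_eqF.
rewrite -ge0_integral_sum//; last 2 first.
  by move=> i; exact: mphi.
  by move=> i x _; exact: phi_ge0.
apply: ge0_le_integral => //.
- by move=> x _; exact: phi_ge0.
- by apply: mphi; exact: mdiv.
- by apply: emeasurable_sum => i; exact: mphi.
move=> x _; have [i hi] := hf x; rewrite (bigD1 i)//= .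
apply: (@le_trans _ _ (phi (p x) `|g i x|)).
  apply: phi_homo => //; rewrite /g invfM !normrM mulrCA ler_wpM2l//.
  by rewrite ler_wpM2r.
by rewrite leeDl// sume_ge0// => j _; exact: phi_ge0.
Qed.

Lemma gmodular_indic E f : measurable E ->
  gmodular (fun x => \1_E x * f x) = (\int[mu]_(x in E) phi (p x) `|f x|)%E.
Proof.
move=> mE; rewrite [RHS]integral_mkcond; apply: eq_integral => x _.
rewrite patchE indicE; case: ifPn => xE; first by rewrite mul1r.
by rewrite mul0r normr0 phi0.
Qed.

(** Monotone convergence, applied to the modular. *)
Lemma gLp_bigcup (E : nat -> set X) f A : measurable_fun setT f ->
  (forall j, measurable (E j)) -> nondecreasing_seq E ->
  (forall j, gLp (fun x => \1_(E j) x * f x)%R <= A)%E ->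
  (gLp (fun x => \1_(\bigcup_j E j) x * f x)%R <= A)%E.
Proof.
move=> mf mE ndE EA.
have A0 : (0 <= A)%E by exact: le_trans (gLp_ge0 _) (EA 0%N).
rewrite -[A]mul1e; apply: le_scale_gt => // l Al; rewrite mul1r.
have l0 : 0 < l by rewrite -lte_fin (le_lt_trans _ Al).
apply: gLp_le => //; under eq_fun do rewrite -mulrA.
rewrite gmodular_indic; last exact: bigcup_measurable.
have mfl := mdiv l mf.
have H : (\int[mu]_(x in E i) phi (p x) `|(f x / l)%R| @[i --> \oo] -->
    \int[mu]_(x in \bigcup_i E i) phi (p x) `|(f x / l)%R|)%E.
  apply: ge0_nondecreasing_set_cvg_integral => //; first by move=> i; exact: mphi.
  by move=> i x _; exact: phi_ge0.
rewrite -(cvg_lim _ H)//; apply: lime_le; first by apply/cvg_ex; eexists; exact: H.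
apply: nearW => i; rewrite -gmodular_indic//.
have [] := gLp_lt _ (le_lt_trans (EA i) Al); first by apply: measurable_funM.
by move=> _; under eq_fun do rewrite -mulrA.
Qed.

End Lp.

(** * Localization of norms to a disjoint family *)

Section localization.
Context {R : realType} {disp} {X : measurableType disp} (mu : {measure set X -> \bar R}).
Variables (p : X -> \bar R) (F : nat -> set X) (w : X -> \bar R) (C : R).
Hypothesis mp : measurable_fun setT p.
Hypothesis p1 : forall x, (1 <= p x)%E.
Hypothesis mF : forall n, measurable (F n).
Hypothesis tF : trivIset setT F.
Hypothesis mw : measurable_fun setT w.
Hypothesis w0 : forall x, (0 <= w x)%E.
Hypothesis w1 : (\int[mu]_x w x <= 1)%E.
Hypothesis C1 : 1 <= C.
Hypothesis osc : forall n B x y, F n x -> F n y -> (\int[mu]_(z in F n) w z <= B%:E)%E ->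
  B <= 2 -> 0 < B /\ B `^ recip (p y) <= C * B `^ recip (p x).

Local Notation Lp := (gLp mu p).

(** Let B be the integral of phi(f/l) + w over the set F n. As B^(1/p) is constant on F n up to
    the factor C, [phi_scale] treats the exponent like a constant one: the norm of f on F n
    is at most l C B^(1/p(x0)), so that of h is at most K times this, and undoing the
    scaling bounds the modular of h by B. The factor 4 makes it B / 2. *)
Lemma localization_step n (f h : X -> R) (K l : R) : 0 < K -> 0 < l ->
  measurable_fun setT f -> measurable_fun setT h ->
  (\int[mu]_x phi (p x) `|(f x / l)%R| <= 1)%E ->
  (Lp (fun x => \1_(F n) x * h x)%R <= K%:E * Lp (fun x => \1_(F n) x * f x)%R)%E ->
  (\int[mu]_(x in F n) phi (p x) `|(h x / (4 * K * C ^+ 2 * l))%R| <=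
   2^-1%:E * \int[mu]_(x in F n) (phi (p x) `|(f x / l)%R| + w x))%E.
Proof.
move=> K0 l0 mf mh fl hK.
have [F0|/set0P[x0 Fx0]] := eqVneq (F n) set0.
  by rewrite F0 !integral_set0 mule0.
have mfl : measurable_fun setT (fun x => f x / l) by exact: measurable_funM.
have mphil D : measurable_fun D (fun x => phi (p x) `|(f x / l)%R|) by exact: measurable_phi.
have phil x : (0 <= phi (p x) `|(f x / l)%R|)%E by exact: phi_ge0.
have mg D : measurable_fun D (fun x => phi (p x) `|(f x / l)%R| + w x)%E.
  by apply: emeasurable_funD => //; exact: measurable_funTS.
have g0 x : (0 <= phi (p x) `|(f x / l)%R| + w x)%E by exact: adde_ge0.
have [B BE B2] : exists2 B : R,
    (\int[mu]_(x in F n) (phi (p x) `|(f x / l)%R| + w x) = B%:E)%E & B <= 2.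
  have H2 : (\int[mu]_(x in F n) (phi (p x) `|(f x / l)%R| + w x) <= 2%:E)%E.
    apply: (@le_trans _ _ (\int[mu]_x (phi (p x) `|(f x / l)%R| + w x))%E).
      exact: ge0_subset_integral.
    by rewrite ge0_integralD// (_ : 2%:E = 1 + 1)%E ?leeD// -EFinD.
  have H0 : (0 <= \int[mu]_(x in F n) (phi (p x) `|(f x / l)%R| + w x))%E.
    exact: integral_ge0.
  exists (fine (\int[mu]_(x in F n) (phi (p x) `|(f x / l)%R| + w x))%E).
    by rewrite fineK// ge0_fin_numE// (le_lt_trans H2)// ltry.
  by rewrite -lee_fin fineK// ge0_fin_numE// (le_lt_trans H2)// ltry.
have wB : (\int[mu]_(z in F n) w z <= B%:E)%E.
  rewrite -BE; apply: ge0_le_integral => //; first exact: measurable_funTS.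
  by move=> x _; rewrite leeDr.
have fB : (\int[mu]_(x in F n) phi (p x) `|(f x / l)%R| <= B%:E)%E.
  by rewrite -BE; apply: ge0_le_integral => // x _; rewrite leeDl.
have oscB x y (Fx : F n x) (Fy : F n y) := osc Fx Fy wB B2.
have [B0 _] := oscB _ _ Fx0 Fx0.
pose t0 := B `^ recip (p x0).
have t00 : 0 < t0 by exact: powR_gt0.
have C0 : 0 < C by exact: lt_le_trans ltr01 C1.
have m1f : measurable_fun setT (fun x => \1_(F n) x * f x) by exact: measurable_funM.
have m1h : measurable_fun setT (fun x => \1_(F n) x * h x) by exact: measurable_funM.
(* the scaling by B^(1/p) turns the bound B of the modular into 1 *)
have fQ : (Lp (fun x => \1_(F n) x * f x)%R <= (l * (C * t0))%:E)%E.
  apply: gLp_le; first by rewrite !mulr_gt0.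
  under eq_fun do rewrite -mulrA; rewrite gmodular_indic//.
  apply: (@le_trans _ _ (\int[mu]_(x in F n) (B^-1%:E * phi (p x) `|(f x / l)%R|))%E).
    apply: ge0_le_integral => //.
    - by move=> x _; exact: phi_ge0.
    - by apply: measurable_phi => //; exact: measurable_funM.
    - by apply: emeasurable_funM.
    move=> x Fx; rewrite -phi_scale ?invr_gt0//.
    apply: phi_homo => //; rewrite invfM mulrA normrM mulrC ler_wpM2r//.
    rewrite ger0_norm; last by rewrite invr_ge0 ltW// mulr_gt0.
    have -> : B^-1 `^ recip (p x) = (B `^ recip (p x))^-1.
      by rewrite -[B^-1]powR_inv1 ?(ltW B0)// -powRrM mulN1r powRN.
    rewrite lef_pV2 ?posrE ?powR_gt0 ?mulr_gt0//.
    by have [] := oscB _ _ Fx0 Fx.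
  rewrite ge0_integralZl ?lee_fin ?invr_ge0 ?(ltW B0)//.
  apply: le_trans (lee_wpmul2l _ fB) _; first by rewrite lee_fin invr_ge0 ltW.
  by rewrite -EFinM mulVf ?gt_eqF.
(* 2 K instead of K, since only a strict bound for the norm bounds the modular *)
pose l' := 2 * K * (l * (C * t0)).
have [l'0 hQ] : 0 < l' /\ (gmodular mu p (fun x => \1_(F n) x * h x / l')%R <= 1)%E.
  apply: gLp_lt => //; apply: (le_lt_trans hK).
  apply: (@le_lt_trans _ _ (K%:E * (l * (C * t0))%:E)%E).
    by rewrite lee_wpmul2l// lee_fin ltW.
  rewrite -EFinM lte_fin /l' ltr_pM2r ?mulr_gt0//; lra.
rewrite BE.
apply: (@le_trans _ _ (\int[mu]_(x in F n) ((2^-1 * B)%:E * phi (p x) `|(h x / l')%R|))%E).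
  apply: ge0_le_integral => //.
  - by move=> x _; exact: phi_ge0.
  - by apply: measurable_phi => //; exact: measurable_funM.
  - by apply: emeasurable_funM => //; apply: measurable_phi => //; exact: measurable_funM.
  move=> x Fx; rewrite EFinM -muleA -phi_scale//.
  apply: le_trans (phi_contract _ _ _) => //; last 2 first.
  - by rewrite invr_ge0 ler0n invf_le1// ler1n.
  - by rewrite mulr_ge0// powR_ge0.
  apply: phi_homo => //.
  have -> : h x / (4 * K * C ^+ 2 * l) = 2^-1 * (t0 / C) * (h x / l').
    rewrite /l'; field; by rewrite !gt_eqF.
  rewrite [leLHS]normrM mulrA ler_wpM2r// ger0_norm; last first.
    by rewrite ltW// mulr_gt0 ?invr_gt0// divr_gt0.
  rewrite ler_wpM2l ?invr_ge0// ler_pdivrMr// mulrC.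
  by have [] := oscB _ _ Fx Fx0.
rewrite ge0_integralZl//; last 3 first.
- by apply: measurable_phi => //; exact: measurable_funM.
- by move=> x _; exact: phi_ge0.
- by rewrite lee_fin mulr_ge0 ?invr_ge0 ?ltW.
rewrite -EFinM -[leRHS]mule1 lee_wpmul2l//; first by rewrite lee_fin mulr_ge0 ?invr_ge0 ?ltW.
by rewrite -gmodular_indic//; under eq_fun do rewrite mulrA.
Qed.

(** Norms are not additive over disjoint sets but modulars are. The integral of
    phi(f/l) + w is at most 2, so the halves given by [localization_step] add up to at
    most 1. *)
Lemma gLp_localization (f h : X -> R) (K : R) : 0 < K ->
  measurable_fun setT f -> measurable_fun setT h ->
  (forall n, Lp (fun x => \1_(F n) x * h x)%R <= K%:E * Lp (fun x => \1_(F n) x * f x)%R)%E ->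
  (forall x, ~ (\bigcup_n F n) x -> h x = 0) ->
  (Lp h <= (4 * K * C ^+ 2)%:E * Lp f)%E.
Proof.
move=> K0 mf mh hK h0.
have C0 : 0 < C by exact: lt_le_trans ltr01 C1.
apply: le_scale_gt; [by rewrite !mulr_gt0// exprn_gt0|exact: gLp_ge0|].
move=> l /(gLp_lt mp p1 mf)[l0 fl].
apply: gLp_le; first by rewrite !mulr_gt0// exprn_gt0.
set l' := 4 * K * C ^+ 2 * l.
have mfl : measurable_fun setT (fun x => f x / l) by exact: measurable_funM.
have mhl : measurable_fun setT (fun x => h x / l') by exact: measurable_funM.
have mphil D : measurable_fun D (fun x => phi (p x) `|(f x / l)%R|) by exact: measurable_phi.
have phil x : (0 <= phi (p x) `|(f x / l)%R|)%E by exact: phi_ge0.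
have mg D : measurable_fun D (fun x => phi (p x) `|(f x / l)%R| + w x)%E.
  by apply: emeasurable_funD => //; exact: measurable_funTS.
have g0 x : (0 <= phi (p x) `|(f x / l)%R| + w x)%E by exact: adde_ge0.
have -> : (fun x => h x / l') = (fun x => \1_(\bigcup_n F n) x * (h x / l')).
  apply/funext => x; rewrite indicE; case: (boolP (_ \in _)) => [_|]; first by rewrite mul1r.
  by rewrite notin_setE => /h0 ->; rewrite mul0r mulr0.
have mUF : measurable (\bigcup_n F n) by exact: bigcup_measurable.
rewrite gmodular_indic// ge0_integral_bigcup//; last 2 first.
- exact: measurable_phi.
- by move=> x _; exact: phi_ge0.
apply: (@le_trans _ _ (\sum_(n <oo) (2^-1%:E * \int[mu]_(x in F n) (phi (p x) `|(f x / l)%R| + w x)))%E).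
  apply: lee_nneseries => n _.
    by move=> _; apply: integral_ge0 => x _; exact: phi_ge0.
  exact: localization_step.
rewrite nneseriesZl//; last by move=> n _; exact: integral_ge0.
rewrite -ge0_integral_bigcup//.
apply: (@le_trans _ _ (2^-1%:E * 2%:E)%E); last by rewrite -EFinM mulVf.
rewrite lee_wpmul2l// ?lee_fin ?invr_ge0//.
apply: (@le_trans _ _ (\int[mu]_x (phi (p x) `|(f x / l)%R| + w x))%E).
  exact: ge0_subset_integral.
by rewrite ge0_integralD// (_ : 2%:E = 1 + 1)%E ?leeD// -EFinD.
Qed.

End localization.

(** * Exponents on a cube *)

Section oscillation.
Context {R : realType} {d : nat}.
Local Notation X := (Rd R d).
Local Notation mu := (leb R d).

Lemma dist_Rd_eq0 (x y : X) : dist_Rd x y = 0 -> x = y.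
Proof.
move=> /eqP; rewrite sqrtr_eq0 => s0; apply: eq_from_tnth => i.
apply/eqP; rewrite -subr_eq0 -sqrf_eq0 eq_le sqr_ge0 andbT; apply: le_trans s0.
by rewrite (bigD1 i)//= lerDl sumr_ge0// => j _; exact: sqr_ge0.
Qed.

(** Its logarithm bounds |1/p(x) - 1/p(y)| |ln B| when B <= 2 is at least the lower bound
    min(1, l)^d / (4 (|z| + 1))^(d+1) of [cube_spread_weight]. *)
Definition osc_const (C1 C2 : R) : R :=
  expR (ln 2 + d.+1%:R * (ln 4 + 2 * C2) + d%:R * (C1 + d%:R)).

Lemma osc_const_ge1 C1 C2 : 0 < C1 -> 0 < C2 -> 1 <= osc_const C1 C2.
Proof.
move=> C10 C20; rewrite -expR0 ler_expR !addr_ge0//.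
- by rewrite ln_ge0// ler1n.
- by rewrite mulr_ge0// addr_ge0 ?mulr_ge0 ?ltW// ln_gt0// ltr1n.
- by rewrite mulr_ge0// addr_ge0// ltW.
Qed.

Lemma osc_const_gt0 C1 C2 : 0 < osc_const C1 C2.
Proof. exact: expR_gt0. Qed.

Let expR1_gt1 : 1 < expR 1 :> R.
Proof. by rewrite -[X in X < _]expR0 ltr_expR. Qed.

Let ln_expRD_gt0 (t : R) : 0 <= t -> 0 < ln (expR 1 + t).
Proof. by move=> t0; rewrite ln_gt0// (lt_le_trans expR1_gt1)// lerDl. Qed.

(** The condition at infinity compensates a factor (|z| + 1)^(-1): both exponents are
    compared with the limit exponent. *)
Lemma osc_le_norm (C1 C2 : R) (p : X -> \bar R) (x y z : X) : 0 < C2 ->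
  log_Holder_with C1 C2 p -> norm_Rd z <= norm_Rd x -> norm_Rd z <= norm_Rd y ->
  `|recip (p x) - recip (p y)| * ln (norm_Rd z + 1) <= 2 * C2.
Proof.
move=> C20 [pinf [_ [_ hinf]]] zx zy.
have z0 := norm_Rd_ge0 z.
have bnd u : norm_Rd z <= norm_Rd u ->
    `|recip (p u) - recip pinf| <= C2 / ln (expR 1 + norm_Rd z).
  move=> zu; apply: le_trans (hinf u) _; rewrite ler_wpM2l ?(ltW C20)//.
  rewrite lef_pV2 ?posrE ?ln_expRD_gt0 ?norm_Rd_ge0//.
  by rewrite ler_ln ?lerD2l// posrE ltr_pwDl ?expR_gt0// norm_Rd_ge0.
have L0 := ln_expRD_gt0 z0.
have -> : 2 * C2 = 2 * C2 / ln (expR 1 + norm_Rd z) * ln (expR 1 + norm_Rd z).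
  by rewrite divfK// gt_eqF.
apply: ler_pM => //.
- by rewrite ln_ge0// lerDr.
- have -> : recip (p x) - recip (p y) =
      (recip (p x) - recip pinf) - (recip (p y) - recip pinf) by ring.
  apply: le_trans (ler_normB _ _) _.
  by rewrite -mulrA mulr_natl mulr2n lerD// bnd.
- rewrite [expR 1 + _]addrC ler_ln ?lerD2l ?posrE ?ltr_wpDl ?expR_gt0//; exact: ltW.
Qed.

(** The local condition compensates a factor min(1, l)^(-1), as |x - y| <= d l in a cube
    of side l; ln d <= d takes care of the factor d. *)
Lemma osc_le_side (C1 C2 : R) (p : X -> \bar R) a l bl br (x y : X) : 0 < C1 -> 0 < l ->
  exponent p -> log_Holder_with C1 C2 p -> cube a l bl br x -> cube a l bl br y ->
  `|recip (p x) - recip (p y)| * - ln (Num.min 1 l) <= C1 + d%:R.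
Proof.
move=> C10 l0 [_ p1] [pinf [_ [hloc _]]] Qx Qy.
have C1d : 0 <= C1 + d%:R by rewrite addr_ge0// ltW.
have [l1|l1] := leP 1 l; first by rewrite ln1 oppr0 mulr0.
have [/dist_Rd_eq0 ->|dxy] := eqVneq (dist_Rd x y) 0.
  by rewrite subrr normr0 mul0r.
have d0 : 0 < dist_Rd x y by rewrite lt_neqAle eq_sym dxy sqrtr_ge0.
have dl := dist_Rd_cube l0 Qx Qy.
have dn0 : 0 < d%:R :> R by rewrite -(pmulr_lgt0 _ l0) (lt_le_trans d0).
have di0 : 0 < (dist_Rd x y)^-1 by rewrite invr_gt0.
set D := ln (expR 1 + (dist_Rd x y)^-1).
have D0 : 0 < D by apply: ln_expRD_gt0; exact: ltW.
have del1 : `|recip (p x) - recip (p y)| <= 1.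
  have := recip_ge0 (p1 x); have := recip_le1 (p1 x).
  have := recip_ge0 (p1 y); have := recip_le1 (p1 y).
  by rewrite ler_norml; lra.
have lnl : - ln l <= d%:R + D.
  rewrite -lnV ?posrE//; apply: (@le_trans _ _ (ln (d%:R * (dist_Rd x y)^-1))).
    rewrite ler_ln ?posrE ?invr_gt0 ?mulr_gt0//.
    by rewrite ler_pdivlMr// mulrC ler_pdivrMr// .
  rewrite lnM ?posrE// lerD//; first by rewrite ltW// ln_sublinear.
  by rewrite ler_ln ?posrE ?addr_gt0 ?expR_gt0// lerDr ltW// expR_gt0.
apply: le_trans (ler_wpM2l (normr_ge0 _) lnl) _.
rewrite mulrDr addrC lerD//; first by rewrite -ler_pdivlMr// hloc.
by rewrite ler_piMl.
Qed.

(** B is bounded below because of the weight, and |1/p(x) - 1/p(y)| |ln B| stays bounded: the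
    condition at infinity, used at the point of smaller norm, absorbs the power of |x| + 1
    and the local condition absorbs the power of min(1, l). *)
Lemma cube_oscillation (C1 C2 : R) (p : X -> \bar R) (Q : set X) B (x y : X) :
  0 < C1 -> 0 < C2 -> exponent p -> log_Holder_with C1 C2 p -> is_cube Q -> Q x -> Q y ->
  (\int[mu]_(z in Q) spread_weight mu dyadic_ball z <= B%:E)%E -> B <= 2 ->
  0 < B /\ B `^ recip (p y) <= osc_const C1 C2 * B `^ recip (p x).
Proof.
move=> C10 C20 ep lH /is_cubeP[a [l [bl [br [l0 ->]]]]] Qx Qy wB B2.
have [z [Qz zx zy]] : exists z, [/\ cube a l bl br z,
    norm_Rd z <= norm_Rd x & norm_Rd z <= norm_Rd y].
  by have [xy|/ltW yx] := leP (norm_Rd x) (norm_Rd y); [exists x|exists y].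
have z0 := norm_Rd_ge0 z.
set m := Num.min 1 l.
have m0 : 0 < m by rewrite lt_min ltr01.
have := le_trans (cube_spread_weight l0 Qz) wB; rewrite lee_fin -/m.
set e := _ / _ => eB.
have z4 : 0 < 4 * (norm_Rd z + 1) by rewrite mulr_gt0// ltr_wpDl.
have e0 : 0 < e by rewrite divr_gt0// exprn_gt0.
have B0 : 0 < B by exact: lt_le_trans eB.
split => //.
set c := ln 2 + d.+1%:R * (ln 4 + 2 * C2) + d%:R * (C1 + d%:R).
rewrite /osc_const -/c /powR gt_eqF// -expRD ler_expR.
rewrite -lerBlDr -mulrBl; apply: le_trans (ler_norm _) _; rewrite normrM.
have p1 := ep.2.
have del1 : `|recip (p y) - recip (p x)| <= 1.
  have := recip_ge0 (p1 x); have := recip_le1 (p1 x).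
  have := recip_ge0 (p1 y); have := recip_le1 (p1 y).
  by rewrite ler_norml; lra.
have ln20 : 0 <= ln 2 :> R by rewrite ln_ge0// ler1n.
have ln40 : 0 <= ln 4 :> R by rewrite ln_ge0// ler1n.
have c2 : ln 2 <= c.
  rewrite /c -addrA lerDl addr_ge0// mulr_ge0// addr_ge0//; last exact: ltW.
  by rewrite mulr_ge0// ltW.
have [lnB|lnB] := leP 0 (ln B).
  apply: le_trans c2; rewrite (ger0_norm lnB).
  apply: (@le_trans _ _ (ln B)); first by rewrite ler_piMl.
  by rewrite ler_ln ?posrE.
rewrite (ltr0_norm lnB) distrC.
have lne : - ln B <= d.+1%:R * (ln 4 + ln (norm_Rd z + 1)) + d%:R * - ln m.
  apply: (@le_trans _ _ (- ln e)); first by rewrite lerN2 ler_ln.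
  rewrite /e lnM ?posrE ?invr_gt0 ?exprn_gt0// lnV ?posrE ?exprn_gt0//.
  rewrite !lnXn// lnM ?posrE//; last by rewrite ltr_wpDl.
  by rewrite -(mulr_natl (ln m)) -(mulr_natl (ln 4 + _) d.+1) opprD opprK mulrN addrC.
apply: le_trans (ler_wpM2l (normr_ge0 _) lne) _.
have h1 := osc_le_norm C20 lH zx zy.
have h2 := osc_le_side C10 l0 ep lH Qx Qy.
rewrite distrC in del1.
move: h1 h2 del1; set D := `|_|; set N := ln (_ + 1); set M := - ln _ => h1 h2 del1.
have D0 : 0 <= D by exact: normr_ge0.
rewrite mulrDr /c -addrA.
apply: (@le_trans _ _ (d.+1%:R * (ln 4 + 2 * C2) + d%:R * (C1 + d%:R))); last by rewrite lerDr.
apply: lerD; rewrite mulrCA ler_wpM2l//.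
by rewrite mulrDr lerD// ler_piMl.
Qed.

(** The weight w is the series over the cubes [dyadic_ball], for which [cube_oscillation]
    gives the oscillation bound that [gLp_localization] asks for. *)
Lemma Lp_norm_localization (C1 C2 : R) (p : X -> \bar R) (P : set (set X))
    (f h : X -> R) (K : R) :
  0 < C1 -> 0 < C2 -> exponent p -> log_Holder_with C1 C2 p -> disjoint_cubes P -> 0 < K ->
  measurable_fun setT f -> measurable_fun setT h ->
  (forall Q, P Q -> (Lp_norm p (fun x => \1_Q x * h x)%R <=
                     K%:E * Lp_norm p (fun x => \1_Q x * f x)%R)%E) ->
  (forall x, ~ (\bigcup_(Q in P) Q) x -> h x = 0) ->
  (Lp_norm p h <= (4 * K * osc_const C1 C2 ^+ 2)%:E * Lp_norm p f)%E.
Proof.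
move=> C10 C20 ep lH dP K0 mf mh hK h0; have [mp p1] := ep.
have [F [PF tF FP]] := disjoint_cubes_enum dP.
have mF n : measurable (F n).
  have [/dP.1 PFn|->] := PF n; [exact: cube_measurable|exact: measurable0].
have mB j : measurable (@dyadic_ball R d j).
  by apply: cube_measurable; exact: dyadic_ball_cube.
apply: (@gLp_localization _ _ _ mu p F (spread_weight mu dyadic_ball)).
- exact: mp.
- exact: p1.
- exact: mF.
- exact: tF.
- by apply: measurable_spread_weight => //; exact: measurableT.
- by move=> x; exact: spread_weight_ge0.
- by apply: integral_spread_weight => // j; apply: leb_is_cube; exact: dyadic_ball_cube.
- exact: osc_const_ge1.
- move=> n B x y Fx Fy; apply: cube_oscillation => //.
  by have [/dP.1|F0] := PF n => //; rewrite F0 in Fx.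
- exact: K0.
- exact: mf.
- exact: mh.
- move=> n; have [PFn|->] := PF n; first exact: hK.
  have E g : (fun x : X => \1_set0 x * g x) = (fun=> 0 : R).
    by apply/funext => x; rewrite indic0 mul0r.
  by rewrite !E gLp0// mule0.
- by move=> x hx; apply: h0; rewrite (bigcup_enum PF FP).
Qed.

End oscillation.

(** * Scalars and vectors *)

Section scalars.
Context {R : realType} {k : scalar_kind}.
Local Notation F := (sfield R k).
Local Notation sRe := (@sc_Re R k).
Local Notation sIm := (@sc_Im R k).
Implicit Types (z w : F) (r s : R).

Definition sc_real r : F := sc_mk k r 0.

Lemma sc_eqP z w : sRe z = sRe w -> sIm z = sIm w -> z = w.
Proof. by case: k z w => //= -[a b] [a' b'] /= -> ->. Qed.

Lemma sc_mkK z : sc_mk k (sRe z) (sIm z) = z.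
Proof. by case: k z => //= -[]. Qed.

Lemma sc_Re_mk r s : sRe (sc_mk k r s) = r.
Proof. by case: k. Qed.

Lemma sc_Im_mk0 r : sIm (sc_mk k r 0) = 0.
Proof. by case: k. Qed.

Lemma sc_Re0 : sRe 0 = 0. Proof. by case: k. Qed.
Lemma sc_Im0 : sIm 0 = 0. Proof. by case: k. Qed.
Lemma sc_Re1 : sRe 1 = 1. Proof. by case: k. Qed.
Lemma sc_Im1 : sIm 1 = 0. Proof. by case: k. Qed.
Lemma sc_ReD z w : sRe (z + w) = sRe z + sRe w.
Proof. by case: k z w => //= -[a b] [a' b']. Qed.
Lemma sc_ImD z w : sIm (z + w) = sIm z + sIm w.
Proof. by case: k z w => //= [_ _|[a b] [a' b']//]; rewrite addr0. Qed.
Lemma sc_ReN z : sRe (- z) = - sRe z.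
Proof. by case: k z => //= -[a b]. Qed.
Lemma sc_ImN z : sIm (- z) = - sIm z.
Proof. by case: k z => //= [_|[a b]//]; rewrite oppr0. Qed.
Lemma sc_ReB z w : sRe (z - w) = sRe z - sRe w.
Proof. by rewrite sc_ReD sc_ReN. Qed.
Lemma sc_ImB z w : sIm (z - w) = sIm z - sIm w.
Proof. by rewrite sc_ImD sc_ImN. Qed.
Lemma sc_ReM z w : sRe (z * w) = sRe z * sRe w - sIm z * sIm w.
Proof. by case: k z w => //= [a b|[a b] [a' b']//]; rewrite mulr0 subr0. Qed.
Lemma sc_ImM z w : sIm (z * w) = sRe z * sIm w + sIm z * sRe w.
Proof. by case: k z w => //= [a b|[a b] [a' b']//]; rewrite mulr0 mul0r addr0. Qed.

Lemma sc_Re_sum (I : Type) (s : seq I) (P : pred I) (f : I -> F) :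
  sRe (\sum_(i <- s | P i) f i) = \sum_(i <- s | P i) sRe (f i).
Proof. by apply: (big_morph sRe sc_ReD sc_Re0). Qed.
Lemma sc_Im_sum (I : Type) (s : seq I) (P : pred I) (f : I -> F) :
  sIm (\sum_(i <- s | P i) f i) = \sum_(i <- s | P i) sIm (f i).
Proof. by apply: (big_morph sIm sc_ImD sc_Im0). Qed.

Lemma sc_Re_real r : sRe (sc_real r) = r.
Proof. exact: sc_Re_mk. Qed.
Lemma sc_Im_real r : sIm (sc_real r) = 0.
Proof. exact: sc_Im_mk0. Qed.

Lemma sc_ReZ r z : sRe (sc_real r * z) = r * sRe z.
Proof. by rewrite sc_ReM sc_Re_real sc_Im_real mul0r subr0. Qed.
Lemma sc_ImZ r z : sIm (sc_real r * z) = r * sIm z.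
Proof. by rewrite sc_ImM sc_Re_real sc_Im_real mul0r addr0. Qed.

Lemma sc_real_nat (n : nat) : sc_real n%:R = n%:R :> F.
Proof.
apply: sc_eqP; rewrite ?sc_Re_real ?sc_Im_real; elim: n => [|n ih].
- by rewrite sc_Re0.
- by rewrite -[in RHS]addn1 natrD sc_ReD -ih sc_Re1 -natr1.
- by rewrite sc_Im0.
- by rewrite -[in RHS]addn1 natrD sc_ImD -ih sc_Im1 addr0.
Qed.

Lemma sc_real0 : sc_real 0 = 0 :> F. Proof. exact: (sc_real_nat 0). Qed.
Lemma sc_real1 : sc_real 1 = 1 :> F. Proof. exact: (sc_real_nat 1). Qed.

Lemma sc_indic (X : Type) (A : set X) x : (\1_A x : F) = sc_real (\1_A x).
Proof. by rewrite !indicE sc_real_nat. Qed.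

Lemma sc_realB r s : sc_real (r - s) = sc_real r - sc_real s.
Proof. by apply: sc_eqP; rewrite ?sc_ReB ?sc_ImB ?sc_Re_real ?sc_Im_real// subrr. Qed.

Lemma sc_realM r s : sc_real (r * s) = sc_real r * sc_real s.
Proof. by apply: sc_eqP; rewrite ?sc_ReZ ?sc_ImZ ?sc_Re_real ?sc_Im_real// mulr0. Qed.

Lemma sc_le0_real r : (0 <= sc_real r) = (0 <= r).
Proof. by rewrite /sc_real; case: k => //=; rewrite lecE/= eqxx. Qed.

Lemma sc_le_real r s : (sc_real r <= sc_real s) = (r <= s).
Proof. by rewrite -subr_ge0 -sc_realB sc_le0_real subr_ge0. Qed.

Lemma sc_lt_real r s : (sc_real r < sc_real s) = (r < s).
Proof.
by rewrite !lt_def sc_le_real; congr (~~ _ && _); apply/eqP/eqP => [/(congr1 sRe)|->//];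
  rewrite !sc_Re_real.
Qed.

Lemma sc_norm z : `|z| = sc_real (Num.sqrt (sRe z ^+ 2 + sIm z ^+ 2)).
Proof.
rewrite /sc_real; case: k z => /= [a|[a b]]//.
by rewrite expr0n addr0 sqrtr_sqr.
Qed.

Lemma sc_absE z : sc_abs z = Num.sqrt (sRe z ^+ 2 + sIm z ^+ 2).
Proof. by rewrite /sc_abs sc_norm sc_Re_real. Qed.

Lemma sc_normE z : `|z| = sc_real (sc_abs z).
Proof. by rewrite sc_norm sc_absE. Qed.

Lemma sc_abs_ge0 z : 0 <= sc_abs z.
Proof. by rewrite sc_absE sqrtr_ge0. Qed.

Lemma sc_absM z w : sc_abs (z * w) = sc_abs z * sc_abs w.
Proof.
by have := normrM z w; rewrite !sc_normE -sc_realM => /(congr1 sRe); rewrite !sc_Re_real.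
Qed.

Lemma sc_abs_real r : sc_abs (sc_real r) = `|r|.
Proof. by rewrite sc_absE sc_Re_real sc_Im_real expr0n addr0 sqrtr_sqr. Qed.

Lemma sc_Re_le_abs z : `|sRe z| <= sc_abs z.
Proof. by rewrite sc_absE -sqrtr_sqr ler_wsqrtr// lerDl sqr_ge0. Qed.

Lemma sc_Im_le_abs z : `|sIm z| <= sc_abs z.
Proof. by rewrite sc_absE -sqrtr_sqr ler_wsqrtr// lerDr sqr_ge0. Qed.

Lemma sc_abs_le z : sc_abs z <= `|sRe z| + `|sIm z|.
Proof.
rewrite sc_absE -[leRHS]ger0_norm ?addr_ge0// -sqrtr_sqr ler_wsqrtr//.
rewrite sqrrD !real_normK ?num_real// -addrA [X in _ <= _ + X]addrC addrA lerDl.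
by rewrite mulrn_wge0// mulr_ge0.
Qed.

Lemma sc_realM_mk (c a b : R) : sc_real c * sc_mk k a b = sc_mk k (c * a) (c * b).
Proof. by rewrite /sc_real; case: k => //=; simpc. Qed.

Lemma sc_absN (z : F) : sc_abs (- z) = sc_abs z.
Proof. by rewrite !sc_absE sc_ReN sc_ImN !sqrrN. Qed.

Lemma sc_abs_triangle (z w : F) : sc_abs (z + w) <= sc_abs z + sc_abs w.
Proof.
have := ler_normD z w; rewrite !sc_normE.
rewrite (_ : sc_real _ + sc_real _ = sc_real (sc_abs z + sc_abs w)) ?sc_le_real//.
by apply: sc_eqP; rewrite ?sc_ReD ?sc_ImD ?sc_Re_real ?sc_Im_real// addr0.
Qed.

Lemma sc_abs_sum (I : finType) (z : I -> F) : sc_abs (\sum_i z i) <= \sum_i sc_abs (z i).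
Proof.
elim/big_rec2: _ => [|i r s _ ih]; first by rewrite -sc_real0 sc_abs_real normr0.
by apply: le_trans (sc_abs_triangle _ _) _; rewrite lerD2l.
Qed.

End scalars.

Section vectors.
Context {R : realType} {k : scalar_kind} {n : nat}.
Local Notation F := (sfield R k).
Local Notation V := 'cV[sfield R k]_n.
Implicit Types (u v : V).

Lemma vnormE u : vnorm u = Num.sqrt (\sum_i sc_abs (u i 0) ^+ 2).
Proof.
have vdotE : vdot u u = sc_real (\sum_i sc_abs (u i 0) ^+ 2).
  rewrite /vdot; apply: sc_eqP; rewrite ?sc_Re_sum ?sc_Im_sum ?sc_Re_real ?sc_Im_real.
    apply: eq_bigr => i _; rewrite sc_absE sqr_sqrtr ?addr_ge0 ?sqr_ge0// sc_ReM /sc_conj.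
    by case: k u => u /=; rewrite ?mul0r ?subr0 ?expr0n ?addr0 ?expr2// mulrN opprK.
  rewrite big1// => i _; rewrite sc_ImM /sc_conj.
  by case: k u => u /=; rewrite ?mul0r ?mulr0 ?addr0// mulrN mulrC addNr.
rewrite /vnorm vdotE sc_abs_real ger0_norm// sumr_ge0// => i _; exact: sqr_ge0.
Qed.

Lemma vnorm_ge0 u : 0 <= vnorm u.
Proof. exact: sqrtr_ge0. Qed.

Lemma vnormZ (a : F) u : vnorm (a *: u) = sc_abs a * vnorm u.
Proof.
rewrite !vnormE -[sc_abs a]ger0_norm ?sc_abs_ge0// -sqrtr_sqr -sqrtrM ?sqr_ge0//.
congr Num.sqrt; rewrite mulr_sumr; apply: eq_bigr => i _.
by rewrite mxE sc_absM exprMn.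
Qed.

Lemma vnorm0 : vnorm (0 : V) = 0.
Proof. by rewrite -[0](scale0r (0 : V)) vnormZ -sc_real0 sc_abs_real normr0 mul0r. Qed.

Lemma vnorm_coord u i : sc_abs (u i 0) <= vnorm u.
Proof.
rewrite vnormE -[leLHS]ger0_norm ?sc_abs_ge0// -sqrtr_sqr ler_wsqrtr//.
by rewrite (bigD1 i)//= lerDl sumr_ge0// => j _; exact: sqr_ge0.
Qed.

Lemma vnorm_le_sum u : vnorm u <= \sum_i sc_abs (u i 0).
Proof.
have S0 : 0 <= \sum_i sc_abs (u i 0) by apply: sumr_ge0 => i _; exact: sc_abs_ge0.
rewrite vnormE -[leRHS]ger0_norm// -sqrtr_sqr ler_wsqrtr// expr2 mulr_suml.
apply: ler_sum => i _; rewrite expr2 ler_wpM2l ?sc_abs_ge0//.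
by rewrite (bigD1 i)//= lerDl sumr_ge0// => j _; exact: sc_abs_ge0.
Qed.

Lemma vnorm_le_coord u c : (forall i, sc_abs (u i 0) <= c) -> vnorm u <= n%:R * c.
Proof.
move=> uc; apply: (le_trans (vnorm_le_sum u)); apply: le_trans (ler_sum _ (fun i _ => uc i)) _.
by rewrite sumr_const card_ord mulr_natl.
Qed.

(** A maximum instead of a sum, as [gLp_max] estimates the norm of a maximum. *)
Lemma vnormD_max u v : vnorm (u + v) <= 2 * Num.max (vnorm u) (vnorm v).
Proof.
set M := Num.max _ _.
have M0 : 0 <= M by rewrite le_max vnorm_ge0.
have sq (w : V) : vnorm w ^+ 2 = \sum_i sc_abs (w i 0) ^+ 2.
  by rewrite vnormE sqr_sqrtr// sumr_ge0// => i _; exact: sqr_ge0.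
rewrite -(ler_pXn2r (n := 2))// ?nnegrE ?vnorm_ge0 ?mulr_ge0// sq.
apply: (@le_trans _ _ (2 * vnorm u ^+ 2 + 2 * vnorm v ^+ 2)).
  rewrite !sq !mulr_sumr -big_split/=; apply: ler_sum => i _.
  have tri : sc_abs ((u + v) i 0) <= sc_abs (u i 0) + sc_abs (v i 0).
    by rewrite mxE; exact: sc_abs_triangle.
  have := sc_abs_ge0 (u i 0); have := sc_abs_ge0 (v i 0); have := sc_abs_ge0 ((u + v) i 0).
  move: tri; set a := sc_abs _; set b := sc_abs _; set c := sc_abs _ => *.
  have : 0 <= (b - c) ^+ 2 by exact: sqr_ge0.
  nra.
have uM : vnorm u <= M by rewrite le_max lexx.
have vM : vnorm v <= M by rewrite le_max lexx orbT.
have := vnorm_ge0 u; have := vnorm_ge0 v; nra.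
Qed.

End vectors.

Lemma measurable_sqrt {R : realType} : measurable_fun setT (@Num.sqrt R).
Proof. by apply: continuous_measurable_fun; exact: sqrt_continuous. Qed.

Lemma measurable_le {R : realType} {disp} {X : measurableType disp} (f g : X -> R) :
  measurable_fun setT f -> measurable_fun setT g -> measurable [set x | f x <= g x].
Proof.
move=> mf mg; rewrite -[X in measurable X]setTI.
by apply: measurable_fun_le => //; exact: measurableT.
Qed.

Section measurable_scalars.
Context {R : realType} {k : scalar_kind} {disp} {X : measurableType disp}.
Local Notation F := (sfield R k).
Implicit Types (f g : X -> F).

Definition measurable_scalar f : Prop := measurable_fun setT (fun x => sc_Re (f x)) /\
  measurable_fun setT (fun x => sc_Im (f x)).

Lemma msc_cst (z : F) : measurable_scalar (fun=> z).
Proof. by split. Qed.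

Lemma mscD f g : measurable_scalar f -> measurable_scalar g ->
  measurable_scalar (fun x => f x + g x).
Proof.
move=> [f1 f2] [g1 g2]; split.
  by under eq_fun do rewrite sc_ReD; exact: measurable_funD.
by under eq_fun do rewrite sc_ImD; exact: measurable_funD.
Qed.

Lemma mscM f g : measurable_scalar f -> measurable_scalar g ->
  measurable_scalar (fun x => f x * g x).
Proof.
move=> [f1 f2] [g1 g2]; split.
  by under eq_fun do rewrite sc_ReM; apply: measurable_funB; exact: measurable_funM.
by under eq_fun do rewrite sc_ImM; apply: measurable_funD; exact: measurable_funM.
Qed.

Lemma msc_real (f : X -> R) : measurable_fun setT f -> measurable_scalar (fun x => sc_real (f x)).
Proof.
move=> mf; split; first by under eq_fun do rewrite sc_Re_real.
by rewrite (_ : (fun x => _) = cst 0)//; apply/funext => x; rewrite sc_Im_real.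
Qed.

Lemma msc_indic (A : set X) : measurable A -> measurable_scalar (fun x => \1_A x : F).
Proof.
move=> mA; rewrite (_ : (fun x => _) = (fun x => sc_real (\1_A x))).
  by apply: msc_real; exact: measurable_indic.
by apply/funext => x; exact: sc_indic.
Qed.

Lemma msc_sum (I : Type) (s : seq I) (f : I -> X -> F) :
  (forall i, measurable_scalar (f i)) -> measurable_scalar (fun x => \sum_(i <- s) f i x).
Proof.
move=> mf; elim: s => [|i s ih]; first by under eq_fun do rewrite big_nil; exact: msc_cst.
by under eq_fun do rewrite big_cons; exact: mscD.
Qed.

Lemma msc_prod (I : Type) (s : seq I) (f : I -> X -> F) :
  (forall i, measurable_scalar (f i)) -> measurable_scalar (fun x => \prod_(i <- s) f i x).
Proof.
move=> mf; elim: s => [|i s ih]; first by under eq_fun do rewrite big_nil; exact: msc_cst.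
by under eq_fun do rewrite big_cons; exact: mscM.
Qed.

Lemma measurable_sc_abs f : measurable_scalar f -> measurable_fun setT (fun x => sc_abs (f x)).
Proof.
move=> [f1 f2]; under eq_fun do rewrite sc_absE.
apply: (@measurableT_comp _ _ _ _ _ _ (@Num.sqrt R)) => /=.
  exact: measurable_sqrt.
by apply: measurable_funD; exact: measurable_funX.
Qed.

Lemma measurable_vnorm n (f : X -> 'cV[F]_n) : (forall i, measurable_scalar (fun x => f x i 0)) ->
  measurable_fun setT (fun x => vnorm (f x)).
Proof.
move=> mf; under eq_fun do rewrite vnormE.
apply: (@measurableT_comp _ _ _ _ _ _ (@Num.sqrt R)) => /=.
  exact: measurable_sqrt.
by apply: measurable_sum => i; apply: measurable_funX; exact: measurable_sc_abs.
Qed.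

Lemma mscZ n (s : X -> F) (f : X -> 'cV[F]_n) i :
  measurable_scalar s -> measurable_scalar (fun x => f x i 0) ->
  measurable_scalar (fun x => (s x *: f x) i 0).
Proof.
move=> ms mf; rewrite (_ : (fun x => _) = (fun x => s x * f x i 0)); first exact: mscM.
by apply/funext => x; rewrite mxE.
Qed.

Lemma msc_mulmx m n (A : X -> 'M[F]_(m, n)) (f : X -> 'cV[F]_n) :
  (forall i j, measurable_scalar (fun x => A x i j)) ->
  (forall i, measurable_scalar (fun x => f x i 0)) ->
  forall i, measurable_scalar (fun x => (A x *m f x) i 0).
Proof.
move=> mA mf i; under eq_fun do rewrite mxE.
by apply: msc_sum => j; exact: mscM.
Qed.

Lemma msc_det n (A : X -> 'M[F]_n) : (forall i j, measurable_scalar (fun x => A x i j)) ->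
  measurable_scalar (fun x => \det (A x)).
Proof.
move=> mA; apply: msc_sum => s; apply: mscM; first exact: msc_cst.
by apply: msc_prod => i.
Qed.

Lemma msc_adj n (A : X -> 'M[F]_n) : (forall i j, measurable_scalar (fun x => A x i j)) ->
  forall i j, measurable_scalar (fun x => (\adj (A x)) i j).
Proof.
move=> mA i j; under eq_fun do rewrite mxE.
apply: mscM; first exact: msc_cst.
by apply: msc_det => i' j'; under eq_fun do rewrite !mxE.
Qed.

Lemma measurable_entry_sum n (A : X -> 'M[F]_n) :
  (forall i j, measurable_scalar (fun x => A x i j)) ->
  measurable_fun setT (fun x => \sum_i \sum_j sc_abs (A x i j)).
Proof.
move=> mA; apply: measurable_sum => i; apply: measurable_sum => j.
exact: measurable_sc_abs.
Qed.

End measurable_scalars.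

(** * Matrix-weighted norms and averaging operators *)

Lemma measurable_fun_piecewise {R : realType} {disp} {X : measurableType disp}
    (F : nat -> set X) (c : nat -> X -> R) (g : X -> R) :
  (forall n, measurable (F n)) -> (forall n, measurable_fun setT (c n)) ->
  (forall n x, F n x -> g x = c n x) ->
  (forall x, ~ (\bigcup_n F n) x -> g x = 0) -> measurable_fun setT g.
Proof.
move=> mF mc gc g0 _ B mB; rewrite setTI.
have -> : g @^-1` B = (\bigcup_n (F n `&` c n @^-1` B)) `|`
    (if 0 \in B then ~` (\bigcup_n F n) else set0).
  apply/seteqP; split => x /=.
    move=> Bgx; have [[n _ Fnx]|nFx] := pselect ((\bigcup_n F n) x).
      by left; exists n => //; split => //=; rewrite -(gc n x).
    by right; rewrite -(g0 x) ?mem_set.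
  move=> [[n _ [Fnx /=]]|]; first by rewrite -(gc n x).
  by case: ifPn => // /set_mem B0 nFx; rewrite g0.
apply: measurableU.
  apply: bigcup_measurable => n _; apply: measurableI => //.
  by rewrite -[X in measurable X]setTI; exact: mc.
by case: ifP => // _; apply: measurableC; exact: bigcup_measurable.
Qed.

Lemma L0P {R : realType} {k : scalar_kind} {d n : nat} (f : Rd R d -> 'cV[sfield R k]_n) :
  (forall i, measurable_scalar (fun x => f x i 0)) <-> L0 f.
Proof. by []. Qed.

Opaque L0 integrable_on Lp_norm osc_const.

Section weighted_norm.
Context {R : realType} {k : scalar_kind} {d n : nat}.
Local Notation F := (sfield R k).
Local Notation X := (Rd R d).
Local Notation V := 'cV[sfield R k]_n.
Local Notation mu := (leb R d).
Variables (p : X -> \bar R) (W : X -> 'M[F]_n).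
Hypothesis ep : exponent p.
Hypothesis mW : matrix_weight W.
Local Notation N := (LpW_norm p W).
Implicit Types (f g : X -> V) (Q : set X) (u : V).

Lemma measurable_Wnorm f : L0 f -> measurable_fun setT (fun x => vnorm (W x *m f x)).
Proof.
by move=> mf; apply: measurable_vnorm; apply: msc_mulmx; [exact: mW.1|exact/L0P].
Qed.

Lemma N_ge0 f : (0 <= N f)%E.
Proof. exact: gLp_ge0. Qed.

Lemma N_ae_homo f g : L0 f -> L0 g ->
  {ae mu, forall x, vnorm (W x *m f x) <= vnorm (W x *m g x)} -> (N f <= N g)%E.
Proof.
move=> mf mg fg; apply: gLp_ae_homo; [exact: ep.1|exact: ep.2| | |].
- exact: measurable_Wnorm.
- exact: measurable_Wnorm.
- by apply: filterS fg => x fgx; rewrite !ger0_norm ?vnorm_ge0.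
Qed.

Lemma N_homo f g : L0 f -> L0 g ->
  (forall x, vnorm (W x *m f x) <= vnorm (W x *m g x)) -> (N f <= N g)%E.
Proof. by move=> mf mg fg; apply: N_ae_homo => //; exact: aeW. Qed.

Lemma vnorm_mulmxZ (A : 'M[F]_n) (a : F) u : vnorm (A *m (a *: u)) = sc_abs a * vnorm (A *m u).
Proof. by rewrite -scalemxAr vnormZ. Qed.

Lemma sc_abs_indic (A : set X) x : sc_abs (\1_A x : F) = \1_A x.
Proof. by rewrite sc_indic sc_abs_real ger0_norm. Qed.

Definition restrict_vec Q f : X -> V := fun x => (\1_Q x : F) *: f x.

Lemma L0_restrict_vec Q f : measurable Q -> L0 f -> L0 (restrict_vec Q f).
Proof.
move=> mQ /L0P mf; apply/L0P => i; exact: mscZ (msc_indic mQ) (mf i).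
Qed.

Lemma L0_cst u : L0 (fun _ : X => u).
Proof. by apply/L0P => i; exact: msc_cst. Qed.

Lemma L0_indic_vec Q u : measurable Q -> L0 (indic_vec Q u).
Proof. by move=> mQ; apply: (@L0_restrict_vec Q (fun=> u)) => //; exact: L0_cst. Qed.

Lemma N_restrict_vec Q f :
  N (restrict_vec Q f) = Lp_norm p (fun x => \1_Q x * vnorm (W x *m f x)).
Proof.
rewrite /LpW_norm; congr Lp_norm; apply/funext => x.
by rewrite vnorm_mulmxZ sc_abs_indic.
Qed.

Lemma restrict_vec_le Q f : measurable Q -> L0 f -> (N (restrict_vec Q f) <= N f)%E.
Proof.
move=> mQ mf; apply: N_homo => //; first exact: L0_restrict_vec.
move=> x; by rewrite vnorm_mulmxZ sc_abs_indic ler_piMl ?vnorm_ge0// indicE.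
Qed.

Lemma average_restrict_vec Q f : average Q (restrict_vec Q f) = average Q f.
Proof.
apply/colP => i; rewrite !mxE; congr (sc_mk k (_ * _) (_ * _)); congr fine;
  apply: eq_integral => x xQ; by rewrite /restrict_vec mxE indicE xQ mul1r.
Qed.

Lemma averaging_in (P : set (set X)) f Q x : disjoint_cubes P -> P Q -> Q x ->
  averaging P f x = average Q f.
Proof.
move=> [_ tP] PQ Qx; rewrite /averaging -(@fsbig_widen _ _ _ _ [set Q])/=.
- by rewrite fsbig_set1 /indic_vec indicE mem_set// scale1r.
- by move=> _ ->.
- move=> Q' [PQ' Q'Q] /=; rewrite /indic_vec indicE memNset ?scale0r// => Q'x; apply: Q'Q.
  by apply: tP => //; exists x.
Qed.

Lemma averaging_out (P : set (set X)) f x : ~ (\bigcup_(Q in P) Q) x ->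
  averaging P f x = 0.
Proof.
move=> nPx; apply: fsbig1 => Q PQ; rewrite /indic_vec indicE memNset ?scale0r//.
by move=> Qx; apply: nPx; exists Q.
Qed.

Lemma disjoint_cubes1 Q : is_cube Q -> disjoint_cubes [set Q].
Proof.
by move=> cQ; split => [_ ->//|A B -> ->].
Qed.

Lemma averaging1 Q f : is_cube Q -> averaging [set Q] f = indic_vec Q (average Q f).
Proof.
move=> cQ; apply/funext => x; rewrite /indic_vec indicE; case: (boolP (x \in Q)).
  move=> /set_mem Qx; rewrite scale1r; apply: averaging_in => //; exact: disjoint_cubes1.
rewrite notin_setE scale0r => nQx; apply: averaging_out => -[_ -> //].
Qed.

Lemma L0_averaging (P : set (set X)) f : disjoint_cubes P -> L0 (averaging P f).
Proof.
move=> dP; have [C [PC tC CP]] := disjoint_cubes_enum dP.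
have mC m : measurable (C m).
  have [/dP.1 PCm|->] := PC m; [exact: cube_measurable|exact: measurable0].
apply/L0P => i; split.
  apply: (@measurable_fun_piecewise _ _ _ C (fun m => cst (sc_Re (average (C m) f i 0)))) => //.
    move=> m x Cx; rewrite (averaging_in f dP _ Cx)//.
    by have [//|C0] := PC m; rewrite C0 in Cx.
  by move=> x; rewrite -(bigcup_enum PC CP) => /averaging_out ->; rewrite mxE sc_Re0.
apply: (@measurable_fun_piecewise _ _ _ C (fun m => cst (sc_Im (average (C m) f i 0)))) => //.
  move=> m x Cx; rewrite (averaging_in f dP _ Cx)//.
  by have [//|C0] := PC m; rewrite C0 in Cx.
by move=> x; rewrite -(bigcup_enum PC CP) => /averaging_out ->; rewrite mxE sc_Im0.
Qed.

Lemma averaging_normP (P : set (set X)) (C : R) : (averaging_norm N P < C%:E)%E ->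
  averaging_bound N P C.
Proof.
move=> /ereal_inf_lt[_ [C' [C'0 h] <-]]; rewrite lte_fin => /ltW CC' f sf.
have [h1 [h2 h3]] := h f sf; split => //; split => //.
by apply: le_trans h3 _; rewrite lee_wpmul2r ?N_ge0// lee_fin.
Qed.

Lemma averaging_norm_ge0 (P : set (set X)) : (0 <= averaging_norm N P)%E.
Proof. by apply: le_ereal_inf_tmp => _ [C [C0 _] <-]; rewrite lee_fin. Qed.

Lemma A_constP (C : R) Q : (A_const N < C%:E)%E -> is_cube Q -> averaging_bound N [set Q] C.
Proof.
move=> AC cQ; apply: averaging_normP; apply: (@le_lt_trans _ _ (A_const N)) => //.
by apply: ereal_sup_ubound; exists Q.
Qed.

Lemma A_const_le_A_strong : (A_const N <= A_strong_const N)%E.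
Proof.
apply: ge_ereal_sup => _ [Q cQ <-]; apply: ereal_sup_ubound; exists [set Q] => //.
exact: disjoint_cubes1.
Qed.

Lemma A_const_ge0 : (0 < d)%N -> (0 <= A_const N)%E.
Proof.
move=> _; pose Q := @ocube R d (fun=> 0) 1.
apply: (le_trans (averaging_norm_ge0 [set Q])); apply: ereal_sup_ubound.
by exists Q => //; exact: is_cube_cube.
Qed.

(** On a cube Q of P the function T_P f is T_Q (1_Q f), so the bound for T_Q compares the
    local norms of T_P f and f, which is what localization asks for. *)
Lemma averaging_bound_strong (C1 C2 K : R) (P : set (set X)) : 0 < C1 -> 0 < C2 ->
  log_Holder_with C1 C2 p -> 0 < K -> disjoint_cubes P ->
  (forall Q, is_cube Q -> averaging_bound N [set Q] K) ->
  averaging_bound N P (4 * K * osc_const (d := d) C1 C2 ^+ 2).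
Proof.
move=> C10 C20 lH K0 dP hK f sf; have [mf fN] := sf.
split; first by move=> Q PQ; have [h _] := hK Q (dP.1 _ PQ) f sf; exact: h.
have mT := L0_averaging f dP.
have Kc : 0 < 4 * K * osc_const (d := d) C1 C2 ^+ 2.
  by apply: mulr_gt0; [exact: mulr_gt0|apply: exprn_gt0; exact: osc_const_gt0].
suff H : (N (averaging P f) <= (4 * K * osc_const (d := d) C1 C2 ^+ 2)%:E * N f)%E.
  split; last exact: H.
  split; first exact: mT.
  by apply: (le_lt_trans H); rewrite lte_mul_pinfty ?lee_fin ?(ltW Kc)// .
apply: (Lp_norm_localization C10 C20 ep lH dP K0 (measurable_Wnorm mf) (measurable_Wnorm mT)).
- move=> Q PQ; have cQ := dP.1 _ PQ; have mQ := cube_measurable cQ.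
  rewrite -!N_restrict_vec.
  have sQf : in_space N (restrict_vec Q f).
    split; first exact: L0_restrict_vec.
    by apply: le_lt_trans fN; exact: restrict_vec_le.
  have [_ [_]] := hK Q cQ _ sQf; rewrite (averaging1 _ cQ) average_restrict_vec => hQ.
  apply: le_trans hQ.
  suff -> : restrict_vec Q (averaging P f) = indic_vec Q (average Q f) by [].
  apply/funext => x; rewrite /restrict_vec /indic_vec indicE; case: (boolP (x \in Q)).
    by move=> /set_mem Qx; rewrite (averaging_in f dP PQ Qx).
  by rewrite !scale0r.
- by move=> x /averaging_out ->; rewrite mulmx0 vnorm0.
Qed.

Lemma A_strong_le_A (C1 C2 : R) : (0 < d)%N -> 0 < C1 -> 0 < C2 -> log_Holder_with C1 C2 p ->
  (A_strong_const N <= (4 * osc_const (d := d) C1 C2 ^+ 2)%:E * A_const N)%E.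
Proof.
move=> d0 C10 C20 lH.
have A0 := A_const_ge0 d0.
have c0 : 0 < 4 * osc_const (d := d) C1 C2 ^+ 2.
  by apply: mulr_gt0 => //; apply: exprn_gt0; exact: osc_const_gt0.
apply: le_scale_gt => //.
move=> K AK; have K0 : 0 < K by rewrite -lte_fin (le_lt_trans _ AK).
apply: ge_ereal_sup => _ [P dP <-]; apply: ereal_inf_lbound.
exists (4 * osc_const (d := d) C1 C2 ^+ 2 * K); last by [].
split; first by rewrite ltW// mulr_gt0.
rewrite mulrAC; apply: (averaging_bound_strong C10 C20 lH K0 dP) => Q cQ.
exact: A_constP AK cQ.
Qed.

End weighted_norm.

(** * Covering by shifted dyadic grids *)

Section dyadic.
Context {R : realType}.

Definition grid_idx (t s : R) (i : nat) (y : R) : int := Num.floor ((y - t) / (s / 2 ^+ i)).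

Lemma grid_idx_itv (t s : R) i y m : 0 < s ->
  (grid_idx t s i y == m) =
  (t + m%:~R * (s / 2 ^+ i) <= y < t + m%:~R * (s / 2 ^+ i) + s / 2 ^+ i).
Proof.
move=> s0; have si : 0 < s / 2 ^+ i by rewrite divr_gt0// exprn_gt0.
rewrite floor_eq ler_pdivlMr// ltr_pdivrMr// intrD mulrDl mul1r; congr (_ && _).
  by rewrite lerBrDl.
by rewrite ltrBlDl addrA.
Qed.

Lemma grid_idx_nested (t s : R) i y z : 0 < s ->
  grid_idx t s i.+1 y = grid_idx t s i.+1 z -> grid_idx t s i y = grid_idx t s i z.
Proof.
move=> s0 yz; apply/eqP; rewrite eq_sym /grid_idx floor_eq.
have E w : (w - t) / (s / 2 ^+ i.+1) = 2 * ((w - t) / (s / 2 ^+ i)).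
  by rewrite exprS; field; rewrite ?gt_eqF ?expf_neq0.
move: yz; rewrite /grid_idx !E; move: (_ / _) (_ / _) => b a ab.
have /andP[h1 h2] := floor_itv a; set m := Num.floor a in h1 h2 *.
have h3 : 2 * m <= Num.floor (2 * b) by rewrite -ab floor_ge_int intrM ler_pM2l.
have h4 : Num.floor (2 * b) < 2 * (m + 1) by rewrite -ab floor_lt_int intrM ltr_pM2l.
move: h3 h4; rewrite floor_ge_int floor_lt_int !intrM ler_pM2l// ltr_pM2l// => -> ->.
by [].
Qed.

(** Points of the two grids of mesh s/2^i, one shifted by s/3, are at least s/(3 2^i) apart
    because 2^i is not a multiple of 3; so a shorter interval meets at most one of them. *)
Lemma one_third_trick (s a l : R) i : 0 < s -> l < s / 2 ^+ i / 3 ->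
  exists b : bool, forall y z, a < y < a + l -> a < z < a + l ->
    grid_idx (b%:R * (s / 3)) s i y = grid_idx (b%:R * (s / 3)) s i z.
Proof.
move=> s0 ls; set si := s / 2 ^+ i in ls.
have si0 : 0 < si by rewrite divr_gt0// exprn_gt0.
have key (t : R) : ~ (forall y z, a < y < a + l -> a < z < a + l ->
    grid_idx t s i y = grid_idx t s i z) -> exists m : int, a < m%:~R * si + t < a + l.
  move=> h; apply: contrapT => h'; apply: h.
  suff H y z : a < y < a + l -> a < z < a + l -> ~~ (grid_idx t s i y < grid_idx t s i z).
    move=> y z hy hz; apply/eqP; rewrite eq_le !leNgt H//= H//.
  move=> /andP[y1 y2] /andP[z1 z2]; apply/negP => yz; apply: h'.
  exists (grid_idx t s i z); set m := grid_idx t s i z in yz *.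
  have : m%:~R <= (z - t) / si by rewrite -floor_ge_int.
  have : (y - t) / si < m%:~R by rewrite -floor_lt_int.
  by rewrite ler_pdivlMr// ltr_pdivrMr//; lra.
have [h0|/key[m0 hm0]] := pselect (forall y z, a < y < a + l -> a < z < a + l ->
    grid_idx 0 s i y = grid_idx 0 s i z); first by exists false; rewrite mul0r.
have [h1|/key[m1 hm1]] := pselect (forall y z, a < y < a + l -> a < z < a + l ->
    grid_idx (s / 3) s i y = grid_idx (s / 3) s i z); first by exists true; rewrite mul1r.
exfalso.
have sE : s = 2 ^+ i * si by rewrite /si mulrC divfK// expf_neq0.
(* three times the difference of the two grid points, in units of the mesh *)
pose k : int := 3 * (m0 - m1) - 2 ^+ i.
have kE : k%:~R * si = 3 * (m0%:~R * si - (m1%:~R * si + s / 3)).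
  by rewrite /k intrB intrM intrB rmorphXn /= [s in s / 3]sE; field.
have k1 : k%:~R < (1 : R) by rewrite -(ltr_pM2r si0) kE; move: hm0 hm1 ls; lra.
have k2 : (-1 : R) < k%:~R by rewrite -(ltr_pM2r si0) kE; move: hm0 hm1 ls; lra.
have k0 : k = 0.
  apply/eqP; rewrite eq_le; apply/andP; split.
    by rewrite -ltzD1 add0r -(ltr_int R).
  by rewrite -ltzD1 -(ltr_int R) intrD; lra.
have : (3 %| 2 ^ i)%N.
  have : (3 * (m0 - m1))%R = 2 ^+ i :> int by apply/eqP; rewrite -subr_eq0 -/k k0.
  move=> /(congr1 absz); rewrite abszM abszX /= => <-; exact: dvdn_mulr.
by rewrite Euclid_dvdX.
Qed.

Context {d : nat}.
Local Notation X := (Rd R d).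
Local Notation mu := (leb R d).
Variable s : R.
Hypothesis s0 : 0 < s.
Variable t : 'I_d -> R.

(** The cell of x among the translates by t of the dyadic cubes of side s / 2^i. *)
Definition cell (i : nat) (x : X) : set X :=
  [set y | forall j, grid_idx (t j) s i (tnth y j) = grid_idx (t j) s i (tnth x j)].

Lemma cell_refl i x : cell i x x. Proof. by []. Qed.

Lemma cell_eq i x y : cell i x y -> cell i y = cell i x.
Proof.
by move=> xy; apply/seteqP; split => z zy j; [rewrite zy xy|rewrite zy -xy].
Qed.

Lemma cellE i x : cell i x = cube
  (fun j => t j + (grid_idx (t j) s i (tnth x j))%:~R * (s / 2 ^+ i)) (s / 2 ^+ i)
  (fun=> true) (fun=> true).
Proof.
apply/seteqP; split => y h j.
  by rewrite in_itv /= -grid_idx_itv//; apply/eqP.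
by apply/eqP; have := h j; rewrite in_itv /= -grid_idx_itv.
Qed.

Lemma cell_is_cube i x : is_cube (cell i x).
Proof. by rewrite cellE; apply: is_cube_cube; rewrite divr_gt0// exprn_gt0. Qed.

Lemma leb_cell i x : mu (cell i x) = ((s / 2 ^+ i) ^+ d)%:E.
Proof. by rewrite cellE leb_cube// divr_gt0// exprn_gt0. Qed.

Lemma cell_nested i j x : (i <= j)%N -> cell j x `<=` cell i x.
Proof.
move=> ij; rewrite -(subnK ij); elim: (j - i)%N => [|m ih]//.
move=> y h; apply: ih => q; apply: grid_idx_nested => //; exact: h.
Qed.

Definition maximal_cells (Pr : set (set X)) : set (set X) :=
  [set Q | exists i x, [/\ Q = cell i x, Pr Q &
     forall i', (i' < i)%N -> ~ Pr (cell i' x)]].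

Lemma maximal_cells_disjoint Pr : disjoint_cubes (maximal_cells Pr).
Proof.
split; first by move=> _ [i [x [-> _ _]]]; exact: cell_is_cube.
have H i x j y z : (i <= j)%N -> cell i x z -> cell j y z -> Pr (cell i x) ->
    (forall j', (j' < j)%N -> ~ Pr (cell j' y)) -> cell i x = cell j y.
  rewrite leq_eqVlt => /orP[/eqP -> /cell_eq <- /cell_eq <-//|ij xz yz Prx ny].
  exfalso; apply: (ny i ij); rewrite -(cell_eq (cell_nested (ltnW ij) yz)).
  by rewrite (cell_eq xz).
move=> _ _ [i [x [-> Pi ni]]] [j [y [-> Pj nj]]] [z [xz yz]].
by have [ij|/ltnW ji] := leqP i j; [exact: (H _ _ _ _ z)|apply/esym; exact: (H _ _ _ _ z)].
Qed.

Lemma maximal_cells_sub Pr : maximal_cells Pr `<=` Pr.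
Proof. by move=> _ [i [x [-> ]]]. Qed.

(** There is a coarsest admissible cell, as no cell is coarser than level 0. *)
Lemma maximal_cells_cover Pr i x : Pr (cell i x) -> (\bigcup_(Q in maximal_cells Pr) Q) x.
Proof.
move=> Pi; have ex : exists j, `[< Pr (cell j x) >] by exists i; apply/asboolP.
have := ex_minnP ex => -[j /asboolP Pj jmin].
exists (cell j x); last exact: cell_refl.
exists j, x; split => // j' j'j Pj'; have := jmin j' (introT (asboolP _) Pj').
by rewrite leqNgt j'j.
Qed.

End dyadic.

Section dyadic_cover.
Context {R : realType} {d : nat}.
Local Notation X := (Rd R d).
Local Notation mu := (leb R d).

(** By the one-third trick in each coordinate, a cube of side l < L lies in a cell of side
    at most 6 l of one of 2^d shifted dyadic grids. Inside a grid, cells are nested or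
    disjoint, so the maximal ones with a given property are disjoint. *)
Lemma dyadic_cover (Pr : set (set X)) (L : R) : 0 < L ->
  exists P : {ffun 'I_d -> bool} -> set (set X),
    (forall e, disjoint_cubes (P e) /\ P e `<=` Pr) /\
    forall a l, 0 < l < L ->
      (forall Q, is_cube Q -> ocube a l `<=` Q ->
         (mu Q <= (6 ^+ d)%:E * mu (ocube a l))%E -> Pr Q) ->
      forall x, ocube a l x -> exists e, (\bigcup_(Q in P e) Q) x.
Proof.
(* at level 0 the one-third trick then applies to all sides below L *)
move=> L0; pose s := 3 * L.
have s0 : 0 < s by rewrite mulr_gt0.
pose t (e : {ffun 'I_d -> bool}) j := (e j)%:R * (s / 3).
exists (fun e => maximal_cells s (t e) Pr); split.
  by move=> e; split; [exact: maximal_cells_disjoint|exact: maximal_cells_sub].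
move=> a l /andP[l0 lL] hPr x Qx.
have [i [li il]] : exists i, l < s / 2 ^+ i / 3 /\ s / 2 ^+ i <= 6 * l.
  have ex : exists i, s / 2 ^+ i <= 6 * l.
    exists (Num.bound (s / (6 * l))); rewrite ler_pdivrMr ?exprn_gt0// mulrC.
    rewrite -ler_pdivrMr ?mulr_gt0//; apply/ltW/upper_nthrootP; exact: leqnn.
  have := ex_minnP ex => -[[|i] hi imin].
    by exists 0%N; split => //; rewrite expr0 divr1 /s mulrC mulKf.
  exists i.+1; split => //; have : ~~ (s / 2 ^+ i <= 6 * l).
    by apply/negP => /imin; rewrite ltnn.
  rewrite -ltNge exprS invfM mulrCA; lra.
have /choice[b hb] : forall j, exists b : bool, forall y z,
    a j < y < a j + l -> a j < z < a j + l ->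
    grid_idx (b%:R * (s / 3)) s i y = grid_idx (b%:R * (s / 3)) s i z.
  by move=> j; exact: one_third_trick.
exists [ffun j => b j]; apply: (maximal_cells_cover (i := i)).
apply: hPr; first exact: cell_is_cube.
  move=> y Qy j; rewrite /t ffunE.
  by apply: hb; [exact: (ocubeE _ _ _).1|exact: (ocubeE _ _ _).1].
rewrite leb_cell// leb_cube// -EFinM lee_fin -exprMn.
by rewrite lerXn2r// nnegrE ltW// ?divr_gt0 ?exprn_gt0// mulr_gt0.
Qed.

End dyadic_cover.

(** * Countable unions and convex bodies *)

Lemma bigcup_countType_measurable {disp} {X : measurableType disp} (T : countType)
    (D : set T) (S : T -> set X) :
  (forall t, D t -> measurable (S t)) -> measurable (\bigcup_(t in D) S t).
Proof.
move=> mS; pose G n := if choice.unpickle n is Some t then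
  (if t \in D then S t else set0) else set0.
rewrite (_ : \bigcup_(t in D) S t = \bigcup_n G n).
  apply: bigcup_measurable => n _; rewrite /G.
  case: (choice.unpickle n) => [t|]; last exact: measurable0.
  by case: ifPn => [/set_mem|_]; [exact: mS|exact: measurable0].
apply/seteqP; split => x.
  by move=> [t Dt Stx]; exists (choice.pickle t) => //; rewrite /G choice.pickleK mem_set.
move=> [n _]; rewrite /G; case: (choice.unpickle n) => [t|]//.
by case: ifPn => // /set_mem Dt Stx; exists t.
Qed.

(** A point of an open cube lies in a box with rational faces inside that cube, so a union
    of open cubes is a countable union of boxes. *)
Lemma bigcup_ocube_measurable {R : realType} {d : nat} (S : ('I_d -> R) -> R -> Prop) :
  measurable [set x : Rd R d | exists a l, S a l /\ ocube a l x].
Proof.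
set U := [set _ | _].
pose B (q : {ffun 'I_d -> rat * rat}) : set (Rd R d) :=
  box (fun i => [set` `](ratr (q i).1), (ratr (q i).2)[%R]).
rewrite (_ : U = \bigcup_(q in [set q | B q `<=` U]) B q).
  by apply: bigcup_countType_measurable => q _; apply: box_measurable.
apply/seteqP; split => x; last by move=> [q BqU /BqU].
move=> [a [l [Sal Qx]]].
have /choice[q hq] : forall i, exists q : rat * rat,
    [/\ a i < ratr q.1, ratr q.1 < tnth x i, tnth x i < ratr q.2 & ratr q.2 < a i + l].
  move=> i; have /andP[h1 h2] := (ocubeE _ _ _).1 Qx i.
  have [q1] := rat_in_itvoo h1; have [q2] := rat_in_itvoo h2.
  by rewrite !in_itv/= => /andP[? ?] /andP[? ?]; exists (q1, q2).
exists [ffun i => q i] => /=.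
  move=> y By; exists a, l; split => //; apply/ocubeE => i.
  have := By i; rewrite /= ffunE in_itv/= => /andP[y1 y2]; have [q1 _ _ q2] := hq i.
  by rewrite (lt_trans q1 y1) (lt_trans y2 q2).
by move=> i; have [_ q1 q2 _] := hq i; rewrite /= ffunE in_itv/= q1 q2.
Qed.

Section vector_topology.
Context {R : realType} {k : scalar_kind} {n : nat}.
Local Notation F := (sfield R k).
Local Notation V := 'cV[sfield R k]_n.
Implicit Types (u v : V) (A K : set V).

Definition vclose (e : R) u v := forall i, sc_abs (u i 0 - v i 0) < e.

Lemma nbhs_vclose u A :
  nbhs u A <-> exists2 e : R, 0 < e & forall v, vclose e u v -> A v.
Proof.
split.
  move=> /nbhs_ballP[e /= e0 eA].
  have er : e = sc_real (sc_Re e).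
    by have := ger0_norm (ltW e0); rewrite sc_normE => <-; rewrite sc_Re_real.
  exists (sc_Re e); first by rewrite -(@sc_lt_real R k) -er sc_real0.
  move=> v uv; apply: eA; split => // i j; rewrite (ord1 j).
  by rewrite -ball_normE /= sc_normE er sc_lt_real.
move=> [e e0 eA]; apply/nbhs_ballP; exists (sc_real e : F) => /=.
  by rewrite -sc_real0 sc_lt_real.
move=> v [_ uv]; apply: eA => i.
by have := uv i 0; rewrite -ball_normE /= sc_normE sc_lt_real.
Qed.

Lemma closure_vclose A u :
  closure A u <-> forall e : R, 0 < e -> exists2 v, A v & vclose e u v.
Proof.
split=> h.
  move=> e e0; have [|v [Av uv]] := h [set v | vclose e u v]; last by exists v.
  by apply/nbhs_vclose; exists e.
move=> B /nbhs_vclose[e e0 eB]; have [v Av uv] := h e e0; exists v; split => //.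
exact: eB.
Qed.

Lemma in_K_combination K u v r : in_K K -> K u -> K v -> 0 <= r <= 1 ->
  K (sc_real r *: u + sc_real (1 - r) *: v).
Proof.
move=> [_ _ cK _] Ku Kv /andP[r0 r1].
have r0' : 0 <= (sc_real r : F) by rewrite -sc_real0 sc_le_real.
have r1' : (sc_real r : F) <= 1 by rewrite -sc_real1 sc_le_real.
have := cK u v (Itv01 r0' r1') (mem_set Ku) (mem_set Kv).
by rewrite inE sc_realB sc_real1.
Qed.

(** 0 is the midpoint of u and -u. *)
Lemma in_K0 K : in_K K -> K 0.
Proof.
move=> hK; have [[u Ku] _ _ bK] := hK.
have KNu : K (- u) by rewrite -scaleN1r; apply: bK => //; rewrite normrN1.
have h2 : 0 <= (2^-1 : R) <= 1 by apply/andP; split; lra.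
have := in_K_combination hK Ku KNu h2.
by rewrite (_ : 1 - 2^-1 = 2^-1 :> R) ?scalerN ?subrr//; lra.
Qed.

Lemma in_K_contract K u r : in_K K -> K u -> 0 <= r <= 1 -> K (sc_real r *: u).
Proof.
move=> hK Ku r01; have := in_K_combination hK Ku (in_K0 hK) r01.
by rewrite scaler0 addr0.
Qed.

End vector_topology.

(** * Averages and the maximal operator *)

Section averages.
Context {R : realType} {k : scalar_kind} {d n : nat}.
Local Notation F := (sfield R k).
Local Notation X := (Rd R d).
Local Notation V := 'cV[sfield R k]_n.
Local Notation mu := (leb R d).
Implicit Types (f g : X -> V) (Q : set X) (u v : V) (G : X -> set V).

Lemma average_ext Q f g : (forall x, Q x -> f x = g x) -> average Q f = average Q g.
Proof.
move=> fg; apply/colP => i; rewrite !mxE; congr (sc_mk k (_ * _) (_ * _));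
  by apply: eq_Rintegral => x /set_mem Qx; rewrite fg.
Qed.

Lemma integrable_onP Q f : integrable_on Q f <->
  forall i, mu.-integrable Q (fun x => (sc_Re (f x i 0))%:E) /\
            mu.-integrable Q (fun x => (sc_Im (f x i 0))%:E).
Proof. by []. Qed.

Lemma average_scale Q (c : R) f : measurable Q -> integrable_on Q f ->
  average Q (fun x => sc_real c *: f x) = sc_real c *: average Q f.
Proof.
move=> mQ /integrable_onP intf; apply/colP => i; have [i1 i2] := intf i.
rewrite !mxE sc_realM_mk; congr (sc_mk k _ _); rewrite [RHS]mulrCA; congr (_ * _).
  rewrite -RintegralZl//; by apply: eq_Rintegral => x _; rewrite mxE sc_ReZ.
rewrite -RintegralZl//; by apply: eq_Rintegral => x _; rewrite mxE sc_ImZ.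
Qed.

Lemma Rintegral_restrict Q Q' (g : X -> R) : Q `<=` Q' ->
  \int[mu]_(x in Q') (\1_Q x * g x) = \int[mu]_(x in Q) g x.
Proof.
move=> QQ'; rewrite -{2}(setIidr QQ') Rintegral_mkcondr; apply: eq_Rintegral => x _.
by rewrite patchE indicE; case: ifP; rewrite ?mul1r ?mul0r.
Qed.

Lemma average_sub Q Q' f : Q `<=` Q' -> fine (mu Q) != 0 ->
  average Q' (restrict_vec Q f) = sc_real (fine (mu Q) / fine (mu Q')) *: average Q f.
Proof.
move=> QQ' Q0; apply/colP => i; rewrite !mxE sc_realM_mk; congr (sc_mk k _ _).
  rewrite mulrA (mulrAC (fine _)) mulfV// mul1r; congr (_ * _).
  rewrite -(Rintegral_restrict _ QQ'); apply: eq_Rintegral => x _.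
  by rewrite mxE sc_indic sc_ReZ.
rewrite mulrA (mulrAC (fine _)) mulfV// mul1r; congr (_ * _).
rewrite -(Rintegral_restrict _ QQ'); apply: eq_Rintegral => x _.
by rewrite mxE sc_indic sc_ImZ.
Qed.

Lemma bernoulli_ineq (m : nat) (x : R) : 0 <= x <= 1 -> 1 - m%:R * x <= (1 - x) ^+ m.
Proof.
move=> /andP[x0 x1]; elim: m => [|m ih]; first by rewrite mul0r subr0.
rewrite exprS; apply: (@le_trans _ _ ((1 - x) * (1 - m%:R * x))).
  rewrite -natr1; have : 0 <= m%:R * x * x by rewrite !mulr_ge0.
  nra.
by rewrite ler_wpM2l// subr_ge0.
Qed.

Lemma S0_restrict_sub G Q Q' f : L0K G -> measurable Q -> Q `<=` Q' ->
  S0 (restrict_K G Q) f -> S0 (restrict_K G Q') (restrict_vec Q f).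
Proof.
move=> [hG _] mQ QQ' [mf fG]; split; first exact: L0_restrict_vec.
apply: filterS fG => x; rewrite /restrict_K /restrict_vec indicE.
case: (boolP (x \in Q)) => [/set_mem Qx|_ _]; first by rewrite scale1r mem_set//; exact: QQ'.
by rewrite scale0r; case: ifP => // _; exact: (in_K0 (hG x)).
Qed.

Lemma S0_restrict G Q f : L0K G -> S0 (restrict_K G Q) f -> S0 G f.
Proof.
move=> [hG _] [mf fG]; split => //; apply: filterS fG => x; rewrite /restrict_K.
by case: ifP => // _ ->; exact: (in_K0 (hG x)).
Qed.

(** Enlarging a cube slightly changes the averages of functions supported on it only
    slightly, so open cubes suffice in the definition of the maximal operator. *)
Lemma maximal_ocube G x u : L0K G ->
  maximal G x u <-> forall e : R, 0 < e -> exists a l f,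
    [/\ 0 < l, ocube a l x, S0 (restrict_K G (ocube a l)) f &
        vclose e u (average (ocube a l) f)].
Proof.
move=> hG; rewrite /maximal; split; last first.
  move=> h; apply/closure_vclose => e e0; have [a [l [f [l0 Qx fG uf]]]] := h e e0.
  exists (average (ocube a l) f) => //; exists (ocube a l); last by exists f.
  by split => //; exact: is_cube_cube.
move=> /closure_vclose h e e0.
have e20 : 0 < e / 2 by rewrite divr_gt0.
have [v [Q [/is_cubeP[a [l [bl [br [l0 ->]]]]] Qx] [f fG fv] uv]] := h _ e20.
set C := cube a l bl br in Qx fG fv.
have v0 := vnorm_ge0 v.
(* so small that enlarging the side by 2 t moves the average v by less than e / 2 *)
pose t := l * e / (4 * d.+1%:R * (vnorm v + 1)).
have den : 0 < 4 * d.+1%:R * (vnorm v + 1) by rewrite !mulr_gt0// ltr_wpDl.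
have t0 : 0 < t by rewrite divr_gt0// mulr_gt0.
have t2 : 0 <= 2 * t by rewrite mulr_ge0// ltW.
have l'0 : 0 < l + 2 * t by rewrite ltr_pwDl.
pose C' := @ocube R d (fun i => a i - t) (l + 2 * t).
have CC' : C `<=` C'.
  move=> y /mem_cube Cy; apply/ocubeE => i; have /andP[y1 y2] := Cy i.
  by apply/andP; split; lra.
have mC : measurable C by apply: cube_measurable; exact: is_cube_cube.
exists (fun i => a i - t), (l + 2 * t), (restrict_vec C f); split.
- exact: l'0.
- exact: CC'.
- exact: S0_restrict_sub hG mC CC' fG.
move=> i; rewrite -/C' (average_sub _ CC') ?fv; last by rewrite leb_cube//= gt_eqF// exprn_gt0.
rewrite mxE !leb_cube//= -expr_div_n.
set th := (l / (l + 2 * t)) ^+ d.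
have x01 : 0 <= 2 * t / (l + 2 * t) <= 1.
  apply/andP; split; last by rewrite ler_pdivrMr// mul1r lerDr ltW.
  by apply: divr_ge0; [apply: mulr_ge0 => //; exact: ltW|exact: ltW].
have thE : l / (l + 2 * t) = 1 - 2 * t / (l + 2 * t) by field; rewrite gt_eqF.
have th1 : th <= 1.
  rewrite /th exprn_ile1//; first by apply: divr_ge0; exact: ltW.
  by rewrite ler_pdivrMr// mul1r lerDl.
have hth : 1 - th <= d%:R * (2 * t / l).
  have := bernoulli_ineq d x01; rewrite -thE -/th.
  have : d%:R * (2 * t / (l + 2 * t)) <= d%:R * (2 * t / l).
    by rewrite ler_wpM2l// ler_wpM2l// lef_pV2 ?posrE// lerDl.
  lra.
have hv : (1 - th) * sc_abs (v i 0) < e / 2.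
  apply: (@le_lt_trans _ _ (d%:R * (2 * t / l) * vnorm v)).
    by apply: ler_pM; rewrite ?subr_ge0 ?sc_abs_ge0// vnorm_coord.
  have -> : d%:R * (2 * t / l) * vnorm v = e / 2 * ((d%:R / d.+1%:R) * (vnorm v / (vnorm v + 1))).
    have aux (A B D E L : R) : D != 0 -> E != 0 -> L != 0 ->
        A * (2 * (L * e / (4 * D * E)) / L) * B = e / 2 * ((A / D) * (B / E)).
      by move=> D0 E0 L0; field; rewrite D0 E0 L0.
    by rewrite /t aux// gt_eqF// ltr_wpDl.
  rewrite gtr_pMr//; apply: (@le_lt_trans _ _ (vnorm v / (vnorm v + 1))).
    apply: ler_piMl; first by rewrite divr_ge0// addr_ge0.
    by rewrite ler_pdivrMr// mul1r ler_nat.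
  by rewrite ltr_pdivrMr ?ltr_wpDl// mul1r ltrDl.
have -> : u i 0 - sc_real th * v i 0 = (u i 0 - v i 0) + sc_real (1 - th) * v i 0.
  by rewrite sc_realB sc_real1; ring.
apply: le_lt_trans (sc_abs_triangle _ _) _.
rewrite sc_absM sc_abs_real (ger0_norm (x := 1 - th)) ?subr_ge0//.
have := uv i; move: hv; lra.
Qed.

Lemma maximal_measurable G u : L0K G -> measurable [set x | maximal G x u].
Proof.
move=> hG.
rewrite (_ : [set _ | _] = \bigcap_m [set x | exists a l, (0 < l /\ exists f,
    S0 (restrict_K G (ocube a l)) f /\ vclose m.+1%:R^-1 u (average (ocube a l) f)) /\
    ocube a l x]).
  by apply: bigcap_measurableType => m _; exact: bigcup_ocube_measurable.
apply/seteqP; split => x /=.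
  move=> /(maximal_ocube _ _ hG) h m _.
  have m0 : 0 < m.+1%:R^-1 :> R by rewrite invr_gt0.
  have [a [l [f [l0 Qx fG uf]]]] := h _ m0.
  by exists a, l; split => //; split => //; exists f.
move=> h; apply/maximal_ocube => // e e0.
have [a [l [[l0 [f [fG uf]]] Qx]]] := h (Num.bound e^-1) I.
exists a, l, f; split => // i; apply: lt_trans (uf i) _.
rewrite invf_plt ?posrE//; apply: (@lt_le_trans _ _ (Num.bound e^-1)%:R).
  by apply: archi_boundP; rewrite invr_ge0 ltW.
by rewrite ler_nat.
Qed.

End averages.

(** * Local bounds *)

Section bounded_functions.
Context {R : realType} {disp} {X : measurableType disp} (mu : {measure set X -> \bar R}).
Variable p : X -> \bar R.
Hypothesis mp : measurable_fun setT p.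
Hypothesis p1 : forall x, (1 <= p x)%E.

Lemma gLp_bounded (f : X -> R) (Q : set X) (q M : R) : measurable_fun setT f ->
  measurable Q -> mu Q = q%:E -> 0 <= q -> 0 <= M ->
  (forall x, `|f x| <= M * \1_Q x) -> (gLp mu p f <= ((M + 1) * (q + 1))%:E)%E.
Proof.
move=> mf mQ muQ q0 M0 fM.
have M10 : 0 < M + 1 by rewrite ltr_wpDl.
have q10 : 0 < q + 1 by rewrite ltr_wpDl.
have l0 : 0 < (M + 1) * (q + 1) by rewrite mulr_gt0.
apply: gLp_le => //.
rewrite /gmodular; apply: (@le_trans _ _ (\int[mu]_x (((q + 1)^-1 : R)%:E * (\1_Q x : R)%:E))%E).
  apply: ge0_le_integral => //.
  - by move=> x _; exact: phi_ge0.
  - by apply: measurable_phi => //; exact: measurable_funM.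
  - by apply: emeasurable_funM => //; apply/measurable_EFinP; exact: measurable_indic.
  move=> x _; rewrite normrM normfV (gtr0_norm l0) invfM mulrA.
  have h1 : `|f x| / (M + 1) / (q + 1) <= (q + 1)^-1 * \1_Q x.
    rewrite mulrC ler_wpM2l ?invr_ge0 ?(ltW q10)// ler_pdivrMr//.
    apply: (le_trans (fM x)); rewrite mulrDr mulr1 mulrC lerDl indicE; by case: (_ \in _).
  have h2 : (q + 1)^-1 * \1_Q x <= 1.
    have i1 : \1_Q x <= 1 :> R by rewrite indicE; case: (x \in Q).
    by rewrite mulr_ile1 ?invr_ge0 ?(ltW q10)// invf_le1// lerDr.
  have h0 : 0 <= `|f x| / (M + 1) / (q + 1) by rewrite !divr_ge0// ltW.
  apply: (le_trans (phi_le_id (p1 x) _)); first by rewrite h0 (le_trans h1 h2).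
  by rewrite -EFinM lee_fin.
rewrite ge0_integralZl//; last 2 first.
- by apply/measurable_EFinP; exact: measurable_indic.
- by rewrite lee_fin invr_ge0 ltW.
by rewrite integral_indic// setIT muQ -EFinM lee_fin ler_pdivrMl// mulr1 lerDl.
Qed.

(** A set of positive measure on which |f| >= s forces the norm of f to be at least
    a fixed multiple of s, because phi_q(t) >= ln t uniformly in q. *)
Lemma gLp_lower (E : set X) (m : R) : measurable E -> 0 < m -> mu E = m%:E ->
  forall (f : X -> R) (s : R), measurable_fun setT f -> 0 <= s ->
  (forall x, E x -> s <= `|f x|) -> (s%:E <= (expR m^-1)%:E * gLp mu p f)%E.
Proof.
move=> mE m0 muE f s mf s0 fs.
apply: le_scale_gt; [exact: expR_gt0|exact: gLp_ge0|] => l /(gLp_lt mp p1 mf)[l0 fl].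
rewrite lee_fin -ler_pdivrMr//; have [sl|sl] := leP (s / l) 1.
  by apply: (le_trans sl); rewrite -expR0 ler_expR invr_ge0 ltW.
have sl0 : 0 < s / l by exact: lt_trans sl.
rewrite -[leLHS]lnK ?posrE// ler_expR -[leRHS]mul1r ler_pdivlMr// -lee_fin.
apply: le_trans fl; rewrite EFinM -muE -[mu E]mul1e.
apply: (@le_trans _ _ (\int[mu]_(x in E) (ln (s / l))%:E)%E).
  by rewrite integral_cst// mul1e.
apply: (@le_trans _ _ (\int[mu]_(x in E) phi (p x) `|(f x / l)%R|)%E).
  apply: ge0_le_integral => //.
  - by move=> x _; rewrite lee_fin ln_ge0// ltW.
  - by apply: measurable_phi => //; exact: measurable_funM.
  move=> x Ex; apply: (@le_trans _ _ (phi (p x) (s / l))).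
    by apply: phi_ge_ln => //; exact: ltW.
  apply: phi_homo => //; first exact: ltW.
  by rewrite normrM normfV (gtr0_norm l0) ler_wpM2r ?invr_ge0 ?(ltW l0)// fs.
apply: ge0_subset_integral => //; first by apply: measurable_phi => //; exact: measurable_funM.
by move=> x _; exact: phi_ge0.
Qed.

Lemma measurable_sign (g : X -> R) : measurable_fun setT g ->
  measurable_fun setT (fun x => if 0 <= g x then 1 else - 1 : R).
Proof. by move=> mg; apply: measurable_fun_ifT => //; exact: measurable_fun_ler. Qed.

Lemma integral_vnorm_le (k : scalar_kind) (n : nat) (f : X -> 'cV[sfield R k]_n) (Q : set X)
    (A : \bar R) : measurable Q -> (forall i, measurable_scalar (fun x => f x i 0)) ->
  (forall i, \int[mu]_(x in Q) `|sc_Re (f x i 0)|%:E <= A)%E ->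
  (forall i, \int[mu]_(x in Q) `|sc_Im (f x i 0)|%:E <= A)%E ->
  (0 <= A)%E -> (\int[mu]_(x in Q) (vnorm (f x))%:E <= (n%:R * 2)%:E * A)%E.
Proof.
move=> mQ mf hR hI A0.
pose g i x := (`|sc_Re (f x i 0)|%:E + `|sc_Im (f x i 0)|%:E)%E.
have mR i : measurable_fun Q (fun x => `|sc_Re (f x i 0)|%:E).
  by apply/measurable_EFinP; apply: measurable_funTS; apply: measurableT_comp => //; case: (mf i).
have mI i : measurable_fun Q (fun x => `|sc_Im (f x i 0)|%:E).
  by apply/measurable_EFinP; apply: measurable_funTS; apply: measurableT_comp => //; case: (mf i).
have mg i : measurable_fun Q (g i) by exact: emeasurable_funD.
apply: (@le_trans _ _ (\int[mu]_(x in Q) (\sum_i g i x))%E).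
  apply: ge0_le_integral => //.
  - by move=> x _; rewrite lee_fin vnorm_ge0.
  - by apply/measurable_EFinP; apply: measurable_funTS; exact: measurable_vnorm.
  - exact: emeasurable_sum.
  move=> x _; rewrite /g; under eq_bigr do rewrite -EFinD; rewrite sumEFin lee_fin.
  apply: (le_trans (vnorm_le_sum _)); apply: ler_sum => i _; exact: sc_abs_le.
rewrite ge0_integral_sum//; last by move=> i x _; exact: adde_ge0.
apply: (@le_trans _ _ (\sum_(i < n) (2%:E * A))%E).
  apply: lee_sum => i _; rewrite ge0_integralD//.
  by rewrite (_ : 2%:E * A = A + A)%E ?leeD// mule_natl mule2n.
have -> // : (\sum_(i < n) (2%:E * A) = (n%:R * 2)%:E * A)%E.
rewrite -ge0_sume_distrl; last by move=> i _; rewrite lee_fin.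
by rewrite sumEFin sumr_const card_ord mulr_natl.
Qed.

Lemma positive_measure_bigcup (Q : set X) (E : nat -> set X) :
  measurable Q -> (forall j, measurable (E j)) -> (0 < mu Q)%E ->
  {ae mu, forall x, Q x -> exists j, E j x} -> exists j, (0 < mu (E j))%E.
Proof.
move=> mQ mE Q0 QE; apply: contrapT => h.
have E0 j : mu (E j) = 0%E.
  apply/eqP; rewrite eq_le measure_ge0 andbT leNgt; apply/negP => Ej.
  by apply: h; exists j.
have : mu Q = 0%E.
  apply: measure_negligible => //; apply: negligibleS; last first.
    apply: (@negligibleU _ _ _ mu); [exact: QE|].
    apply: (@negligible_bigcup _ _ _ mu E) => j.
    by exists (E j); split.
  move=> x Qx; have [[j Ejx]|nE] := pselect (exists j, E j x).
    by right; exists j.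
  by left => /(_ Qx).
by move=> muQ0; rewrite muQ0 ltxx in Q0.
Qed.

End bounded_functions.

Lemma ereal_chain {R : realType} (q a c C : R) (x y z : \bar R) : 0 <= q -> 0 <= c -> 0 <= C ->
  (a%:E <= c%:E * x)%E -> (x <= C%:E * y)%E -> (y <= z)%E ->
  (q%:E * a%:E <= (q * (c * C))%:E * z)%E.
Proof.
move=> q0 c0 C0 h1 h2 h3; rewrite EFinM -muleA lee_wpmul2l// EFinM -muleA.
apply: (le_trans h1); rewrite lee_wpmul2l//; apply: (le_trans h2).
by rewrite lee_wpmul2l.
Qed.

Section local_bounds.
Context {R : realType} {k : scalar_kind} {d n : nat}.
Local Notation F := (sfield R k).
Local Notation X := (Rd R d).
Local Notation V := 'cV[sfield R k]_n.
Local Notation mu := (leb R d).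
Variables (p : X -> \bar R) (W : X -> 'M[F]_n).
Hypothesis ep : exponent p.
Hypothesis mW : matrix_weight W.
Local Notation N := (LpW_norm p W).
Implicit Types (f g : X -> V) (Q : set X) (u v : V).

Lemma mW_entry i j : measurable_scalar (fun x => W x i j).
Proof. exact: mW.1. Qed.

Lemma ae_det_neq0 : {ae mu, forall x, \det (W x) != 0}.
Proof.
apply: filterS mW.2 => x [_ pos]; apply/negP => /eqP det0.
have /eqP/det0P[v v0 vW] : \det (W x)^T = 0 by rewrite det_tr.
have Wv : W x *m v^T = 0 by apply: trmx_inj; rewrite trmx_mul trmxK vW trmx0.
have := pos v^T; rewrite Wv => /(_ _)/wrap[].
  by apply: contraNneq v0 => /(congr1 trmx); rewrite trmxK trmx0 => ->.
by rewrite /vdot big1 ?ltxx// => i _; rewrite mxE mul0r.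
Qed.

Lemma sc_abs_mulmx_le (A : 'M[F]_n) u c i : (forall j, sc_abs (u j 0) <= c) ->
  sc_abs ((A *m u) i 0) <= (\sum_i' \sum_j sc_abs (A i' j)) * c.
Proof.
move=> uc; rewrite mxE; apply: (le_trans (sc_abs_sum _)).
apply: (@le_trans _ _ ((\sum_j sc_abs (A i j)) * c)).
  by rewrite mulr_suml; apply: ler_sum => j _; rewrite sc_absM ler_wpM2l ?sc_abs_ge0.
apply: ler_wpM2r.
  by apply: le_trans (uc i); exact: sc_abs_ge0.
rewrite [leRHS](bigD1 i)//= lerDl; apply: sumr_ge0 => i' _; apply: sumr_ge0 => j _.
exact: sc_abs_ge0.
Qed.

(** On this set the cofactor formula bounds the inverse of W. *)
Definition coercive_part Q (m : nat) : set X := Q `&`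
  ([set x | 1 <= m%:R * sc_abs (\det (W x))] `&`
   [set x | \sum_i \sum_j sc_abs (\adj (W x) i j) <= m%:R]).

Lemma coercive_part_measurable Q m : measurable Q -> measurable (coercive_part Q m).
Proof.
move=> mQ; apply: measurableI => //; apply: measurableI; apply: measurable_le.
- exact: measurable_cst.
- apply: measurable_funM; first exact: measurable_cst.
  by apply: measurable_sc_abs; apply: msc_det; exact: mW_entry.
- by apply: measurable_entry_sum; apply: msc_adj; exact: mW_entry.
- exact: measurable_cst.
Qed.

Lemma coercive_part_lower Q m x v i : coercive_part Q m x ->
  sc_abs (v i 0) <= m%:R ^+ 2 * vnorm (W x *m v).
Proof.
move=> [_ [/= hdet hadj]]; set D := sc_abs (\det (W x)) in hdet.
have vi : D * sc_abs (v i 0) <= m%:R * vnorm (W x *m v).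
  rewrite /D -sc_absM (_ : _ * _ = (\adj (W x) *m (W x *m v)) i 0); last first.
    by rewrite mulmxA mul_adj_mx mul_scalar_mx mxE.
  apply: le_trans (sc_abs_mulmx_le _ _ (fun j => vnorm_coord _ j)) _.
  by rewrite ler_wpM2r ?vnorm_ge0.
rewrite expr2 -mulrA; apply: le_trans (ler_wpM2l _ vi); last by [].
by rewrite mulrA ler_peMl ?sc_abs_ge0.
Qed.

Lemma coercive_part_positive Q : is_cube Q ->
  exists (m : nat) (e : R), 0 < e /\ mu (coercive_part Q m) = e%:E.
Proof.
move=> cQ; have mQ := cube_measurable cQ; have [q q0 muQ] := leb_is_cube cQ.
have [|||m mpos] := @positive_measure_bigcup _ _ _ mu Q (coercive_part Q) mQ.
- by move=> j; exact: coercive_part_measurable.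
- by rewrite muQ lte_fin.
- apply: filterS ae_det_neq0 => x Wx Qx.
  set D := sc_abs (\det (W x)); set S := \sum_i \sum_j sc_abs (\adj (W x) i j).
  have D0 : 0 < D.
    rewrite lt_neqAle sc_abs_ge0 andbT eq_sym; apply: contraNneq Wx => D0.
    by rewrite -normr_eq0 sc_normE -/D D0 sc_real0.
  exists (Num.bound (Num.max D^-1 S)); split => //; split => /=.
    rewrite -/D -ler_pdivrMr// mul1r; apply: ltW; apply: le_lt_trans (archi_boundP _).
      by rewrite le_max lexx.
    by rewrite le_max invr_ge0 (ltW D0).
  apply: ltW; apply: le_lt_trans (archi_boundP _); first by rewrite le_max lexx orbT.
  by rewrite le_max invr_ge0 (ltW D0).
have fin : (mu (coercive_part Q m) <= q%:E)%E.
  rewrite -muQ; apply: le_measure; rewrite ?inE//; first exact: coercive_part_measurable.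
  by move=> x [].
exists m, (fine (mu (coercive_part Q m))).
have finE : (fine (mu (coercive_part Q m)))%:E = mu (coercive_part Q m).
  by rewrite fineK// ge0_fin_numE ?(le_lt_trans fin) ?ltry// ltW.
by rewrite -lte_fin finE.
Qed.

(** On a subset of Q of positive measure W is bounded below, so |W v| >= c |v|
    there. *)
Lemma N_indic_lower Q : is_cube Q -> exists2 c : R, 0 < c &
  forall v i, ((sc_abs (v i 0))%:E <= c%:E * N (indic_vec Q v))%E.
Proof.
move=> cQ; have mQ := cube_measurable cQ.
have [m [e [e0 me]]] := coercive_part_positive cQ.
have c0 : 0 < (m%:R ^+ 2 + 1) * expR e^-1 by rewrite mulr_gt0 ?expR_gt0// ltr_wpDl// sqr_ge0.
exists ((m%:R ^+ 2 + 1) * expR e^-1) => // v i.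
have m0 : 0 < m%:R ^+ 2 + 1 :> R by rewrite ltr_wpDl// sqr_ge0.
have mWv := measurable_Wnorm mW (L0_indic_vec v mQ).
have s0 : 0 <= sc_abs (v i 0) / (m%:R ^+ 2 + 1) by rewrite divr_ge0 ?sc_abs_ge0 ?ltW.
have h := gLp_lower ep.1 ep.2 (coercive_part_measurable m mQ) e0 me mWv s0.
have -> : (sc_abs (v i 0))%:E =
    ((m%:R ^+ 2 + 1)%:E * (sc_abs (v i 0) / (m%:R ^+ 2 + 1))%:E)%E.
  by rewrite -EFinM mulrC divfK// gt_eqF.
rewrite [X in (_ <= X * _)%E]EFinM -muleA lee_pmul2l ?lte_fin//; apply: h => x Ex.
have Qx : Q x by case: Ex.
rewrite ger0_norm ?vnorm_ge0// /indic_vec indicE mem_set// scale1r ler_pdivrMr//.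
apply: le_trans (coercive_part_lower v i Ex) _.
by rewrite mulrC ler_wpM2l ?vnorm_ge0// lerDl.
Qed.

Lemma average_Re Q f i : sc_Re (average Q f i 0) =
  (fine (mu Q))^-1 * \int[mu]_(x in Q) sc_Re (f x i 0).
Proof. by rewrite mxE sc_Re_mk. Qed.

Lemma average_Im Q f i : sc_Im (average Q f i 0) =
  (fine (mu Q))^-1 * \int[mu]_(x in Q) sc_Im (f x i 0).
Proof.
rewrite mxE /sc_mk /sc_Im; case: (k) f => f //=.
by rewrite /Rintegral integral0_eq ?mulr0.
Qed.

(** Meant for g the real or the imaginary part of a coordinate of f. The sign of g does not
    change the norm of f, and makes the average of f the integral of |g|. *)
Lemma integral_abs_le_N Q (C c : R) f (g : X -> R) : is_cube Q -> 0 <= C -> 0 < c ->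
  averaging_bound N [set Q] C ->
  (forall v i, (sc_abs (v i 0))%:E <= c%:E * N (indic_vec Q v))%E ->
  in_space N f -> measurable_fun setT g -> mu.-integrable Q (EFin \o g) ->
  (forall h : X -> R, exists i, `|\int[mu]_(x in Q) (h x * g x)| <=
     fine (mu Q) * sc_abs (average Q (fun x => sc_real (h x) *: f x) i 0)) ->
  (\int[mu]_(x in Q) (`|g x|)%:E <= (fine (mu Q) * (c * C))%:E * N f)%E.
Proof.
move=> cQ C0 c0 bC hc [mf fN] mg ig hav.
have [q q0 muQ] := leb_is_cube cQ.
pose s (x : X) : R := if 0 <= g x then 1 else - 1.
have ms : measurable_fun setT s.
  exact: measurable_sign.
pose h x := sc_real (s x) *: f x.
have s1 x : `|s x| = 1 by rewrite /s; case: ifP => _; rewrite ?normrN normr1.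
have mh : L0 h.
  apply/L0P => i; exact: mscZ (msc_real ms) ((L0P f).2 mf i).
have hN : (N h <= N f)%E.
  by apply: (N_homo ep mW mh mf) => x; rewrite vnorm_mulmxZ sc_abs_real s1 mul1r.
have [_ [_ bh]] := bC h (conj mh (le_lt_trans hN fN)).
rewrite (averaging1 _ cQ) in bh.
have [i hi] := hav s.
have sg x : s x * g x = `|g x|.
  by rewrite /s; case: ifPn => [/ger0_norm ->|]; rewrite ?mul1r// -ltNge mulN1r => /ltr0_norm.
have -> : (\int[mu]_(x in Q) (`|g x|)%:E = (\int[mu]_(x in Q) `|g x|)%:E)%E.
  rewrite /Rintegral fineK//; apply: integrable_fin_num; first exact: cube_measurable.
  exact: integrable_abse ig.
have -> : \int[mu]_(x in Q) `|g x| = \int[mu]_(x in Q) (s x * g x).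
  by apply: eq_Rintegral => x _; rewrite sg.
apply: (@le_trans _ _ ((fine (mu Q))%:E * (sc_abs (average Q h i 0))%:E)%E).
  by rewrite -EFinM lee_fin; apply: le_trans (ler_norm _) hi.
by apply: (ereal_chain _ (ltW c0) C0 (hc _ i) bh hN); rewrite muQ ltW.
Qed.

(** Averages of f multiplied by unimodular functions control the integral of |f|, and the
    norm of 1_Q v controls |v| by [N_indic_lower]. *)
Lemma integral_le_N Q (C : R) : is_cube Q -> 0 <= C -> averaging_bound N [set Q] C ->
  exists2 C' : R, 0 < C' &
    forall f, in_space N f -> (\int[mu]_(x in Q) (vnorm (f x))%:E <= C'%:E * N f)%E.
Proof.
move=> cQ C0 bC; have mQ := cube_measurable cQ; have [q q0 muQ] := leb_is_cube cQ.
have [c c0 hc] := N_indic_lower cQ.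
pose C1 := fine (mu Q) * (c * C).
have C10 : 0 <= C1 by rewrite /C1 muQ /= !mulr_ge0// ltW.
exists (n%:R * (C1 + C1) + 1); first by rewrite ltr_wpDl// mulr_ge0// addr_ge0.
move=> f sf; have [mf fN] := sf.
have mRe i : measurable_fun setT (fun x => sc_Re (f x i 0)).
  by move/L0P: mf => /(_ i) [].
have mIm i : measurable_fun setT (fun x => sc_Im (f x i 0)).
  by move/L0P: mf => /(_ i) [].
have [/(_ Q erefl)/integrable_onP iQ _] := bC f sf.
have qi : fine (mu Q) != 0 by rewrite muQ gt_eqF.
have hRe i : (\int[mu]_(x in Q) (`|sc_Re (f x i 0)|)%:E <= C1%:E * N f)%E.
  apply: (@integral_abs_le_N Q C c) => //; first exact: (iQ i).1.
  move=> h; exists i; set A := average _ _.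
  have -> : \int[mu]_(x in Q) (h x * sc_Re (f x i 0)) = fine (mu Q) * sc_Re (A i 0).
    rewrite average_Re mulrA mulfV// mul1r; apply: eq_Rintegral => x _.
    by rewrite mxE sc_ReZ.
  rewrite normrM ger0_norm; last by rewrite muQ ltW.
  by rewrite ler_wpM2l ?sc_Re_le_abs// muQ ltW.
have hIm i : (\int[mu]_(x in Q) (`|sc_Im (f x i 0)|)%:E <= C1%:E * N f)%E.
  apply: (@integral_abs_le_N Q C c) => //; first exact: (iQ i).2.
  move=> h; exists i; set A := average _ _.
  have -> : \int[mu]_(x in Q) (h x * sc_Im (f x i 0)) = fine (mu Q) * sc_Im (A i 0).
    rewrite average_Im mulrA mulfV// mul1r; apply: eq_Rintegral => x _.
    by rewrite mxE sc_ImZ.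
  rewrite normrM ger0_norm; last by rewrite muQ ltW.
  by rewrite ler_wpM2l ?sc_Im_le_abs// muQ ltW.
have A0 : (0 <= C1%:E * N f)%E by rewrite mule_ge0 ?lee_fin// N_ge0.
have mfi : forall i, measurable_scalar (fun x => f x i 0) by apply/L0P.
apply: (le_trans (integral_vnorm_le mQ mfi hRe hIm A0)).
rewrite muleA -EFinM lee_wpmul2r ?N_ge0// lee_fin -mulrA (mulr_natl C1 2) mulr2n.
by rewrite lerDl.
Qed.

End local_bounds.

(** * From disjoint families of cubes to the maximal operator *)

Section limits.
Context {R : realType} {disp} {X : measurableType disp} (mu : {measure set X -> \bar R}).
Variable p : X -> \bar R.
Hypothesis mp : measurable_fun setT p.
Hypothesis p1 : forall x, (1 <= p x)%E.

Lemma measurable_cstM (c : R) (f : X -> R) :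
  measurable_fun setT f -> measurable_fun setT (fun x => c * f x).
Proof. by move=> mf; exact: measurable_funM. Qed.

Lemma integral_le_support (Q : set X) (g : X -> R) : measurable Q -> measurable_fun setT g ->
  (forall x, 0 <= g x) -> {ae mu, forall x, ~ Q x -> g x = 0} ->
  (\int[mu]_x (g x)%:E <= \int[mu]_(x in Q) (g x)%:E)%E.
Proof.
move=> mQ mg g0 gQ; rewrite [leRHS]integral_mkcond; apply: ae_ge0_le_integral => //.
- by move=> x _; rewrite lee_fin.
- exact/measurable_EFinP.
- by move=> x _; apply: erestrict_ge0 => y _; rewrite lee_fin.
- apply/(measurable_restrictT _ mQ).1; apply/measurable_EFinP; exact: measurable_funTS.
apply: filterS gQ => x gx _; rewrite patchE; case: ifPn => // /negP xQ.
by rewrite lee_fin gx// => Qx; apply: xQ; exact: mem_set.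
Qed.

(** The limit j -> oo comes first, then e -> 0, and m -> oo last; the sets B m serve to keep the
    error term b m * e finite. *)
Lemma gLp_covering (g : X -> R) (E : set X) (B : nat -> set X) (U : R -> nat -> set X)
    (a : R) (b : nat -> R) :
  measurable_fun setT g -> measurable E ->
  (forall m, measurable (B m)) -> nondecreasing_seq B -> (forall x, exists m, B m x) ->
  (forall e j, measurable (U e j)) -> (forall e, nondecreasing_seq (U e)) ->
  (forall e x, 0 < e -> E x -> exists j, U e j x) -> (forall m, 0 <= b m) ->
  (forall e j m, (0 < e)%R -> gLp mu p (fun x => \1_(U e j `&` B m) x * g x)%R <=
                          (a + b m * e)%R%:E)%E ->
  (gLp mu p (fun x => \1_E x * g x)%R <= a%:E)%E.
Proof.
move=> mg mE mB ndB BT mU ndU EU b0 h.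
have mI A : measurable A -> measurable_fun setT (fun x => \1_A x * g x).
  by move=> mA; apply: measurable_funM.
have step m : (gLp mu p (fun x => \1_(E `&` B m) x * g x)%R <= a%:E)%E.
  apply/lee_addgt0Pr => r r0; pose e := r / (b m + 1).
  have bm : 0 < b m + 1 by rewrite ltr_wpDl.
  have e0 : 0 < e by rewrite divr_gt0.
  apply: (@le_trans _ _ (a + b m * e)%:E); last first.
    by rewrite -EFinD lee_fin lerD2l /e mulrA ler_pdivrMr// [b m * r]mulrC ler_wpM2l ?lerDl// ltW.
  apply: (@le_trans _ _ (gLp mu p (fun x => \1_(\bigcup_j (U e j `&` B m)) x * g x)%R)).
    apply: gLp_homo => //.
    - by apply: mI; exact: measurableI.
    - by apply: mI; apply: bigcup_measurable => j _; exact: measurableI.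
    move=> x; rewrite !normrM ler_wpM2r// !ger0_norm//.
    rewrite !indicE; case: (boolP (x \in E `&` B m)) => // /set_mem[Ex Bx].
    by have [j Ux] := EU e x e0 Ex; rewrite mem_set//; exists j.
  apply: gLp_bigcup => //.
  - by move=> j; exact: measurableI.
  - by move=> i j ij; apply/subsetPset; apply: setSI; apply/subsetPset; exact: ndU.
  - by move=> j; exact: h.
have -> : (fun x => \1_E x * g x) = (fun x => \1_(\bigcup_m (E `&` B m)) x * g x).
  apply/funext => x; congr (_ * _); rewrite -setI_bigcupr; congr (\1_ _ x).
  rewrite (_ : \bigcup_i B i = setT) ?setIT//; apply/seteqP; split => // y _.
  by have [m By] := BT y; exists m.
apply: gLp_bigcup => //.
- by move=> m; exact: measurableI.
- by move=> i j ij; apply/subsetPset; apply: setIS; apply/subsetPset; exact: ndB.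
Qed.

End limits.

Section strong_to_weak.
Context {R : realType} {k : scalar_kind} {d n : nat}.
Local Notation F := (sfield R k).
Local Notation X := (Rd R d).
Local Notation V := 'cV[sfield R k]_n.
Local Notation mu := (leb R d).
Variables (p : X -> \bar R) (W : X -> 'M[F]_n).
Hypothesis ep : exponent p.
Hypothesis mW : matrix_weight W.
Local Notation N := (LpW_norm p W).
Implicit Types (f g : X -> V) (Q : set X) (u v : V) (G : X -> set V).

Lemma K_norm_ge0 G : L0K G -> (0 <= K_norm N G)%E.
Proof.
move=> [hG _]; apply: (@le_trans _ _ (N (fun=> 0))); first exact: N_ge0.
apply: ereal_sup_ubound; exists (fun=> 0) => //; split; first exact: L0_cst.
by apply: aeW => x; exact: in_K0.
Qed.

Lemma S0_le_K_norm G f : S0 G f -> (N f <= K_norm N G)%E.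
Proof. by move=> sf; apply: ereal_sup_ubound; exists f. Qed.

(** Local integrability of all selections, uniformly: [integral_le_N] bounds the integral
    over Q of each of them by its norm. *)
Lemma L1locK_of_averaging :
  (forall Q, is_cube Q -> exists2 C : R, 0 <= C & averaging_bound N [set Q] C) ->
  in_spaceK N `<=` L1locK.
Proof.
move=> bC G [hG sG kG]; split => // Q cQ; have [C C0 hC] := bC Q cQ.
have [C' C'0 hC'] := integral_le_N ep mW cQ C0 hC.
have kfin : (C'%:E * K_norm N G < +oo)%E by rewrite lte_mul_pinfty// lee_fin ltW.
apply: le_lt_trans kfin; apply: ge_ereal_sup => _ [f sf <-].
have sGf := S0_restrict hG sf; have [mf fG] := sf.
apply: (@le_trans _ _ (\int[mu]_(x in Q) (vnorm (f x))%:E)%E).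
  apply: integral_le_support; first exact: cube_measurable.
  - by apply: measurable_vnorm; exact/L0P.
  - by move=> x; exact: vnorm_ge0.
  - apply: filterS fG => x; rewrite /restrict_K; case: ifPn; first by move/set_mem.
    by move=> _ /= -> _; exact: vnorm0.
apply: (le_trans (hC' f (sG _ sGf))); rewrite lee_wpmul2l ?lee_fin ?(ltW C'0)//.
exact: S0_le_K_norm.
Qed.

(** A selection may be prescribed separately on each of countably many disjoint cubes; off
    them it is 0, which belongs to all values of G. *)
Lemma K_glue G (P : set (set X)) (S : set X -> V -> Prop) : L0K G -> disjoint_cubes P ->
  (forall Q, P Q -> exists g, S0 G g /\ S Q (average Q g)) ->
  exists2 f, S0 G f & forall Q, P Q -> S Q (average Q f).
Proof.
move=> [hG _] dP hP; have [C [PC tC CP]] := disjoint_cubes_enum dP.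
have S00 : S0 G (fun=> 0).
  by split; [exact: L0_cst|apply: aeW => x; exact: in_K0].
have /choice[g hg] : forall m, exists g, S0 G g /\ (P (C m) -> S (C m) (average (C m) g)).
  move=> m; have [/hP[g [g1 g2]]|nP] := pselect (P (C m)); first by exists g.
  by exists (fun=> 0).
have mC m : measurable (C m).
  have [/dP.1 PCm|->] := PC m; [exact: cube_measurable|exact: measurable0].
pose idx x := xget 0%N [set m | C m x].
have idxE m x : C m x -> idx x = m.
  move=> Cx; rewrite /idx; case: xgetP => [m' _ /= Cm'|/(_ m)//].
  by apply: tC => //; exists x.
pose f x : V := if x \in \bigcup_m C m then g (idx x) x else 0.
have fin m x : C m x -> f x = g m x.
  by move=> Cx; rewrite /f mem_set ?(idxE _ _ Cx)//; exists m.
have fout x : ~ (\bigcup_m C m) x -> f x = 0 by move=> nC; rewrite /f memNset.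
exists f.
  split.
    apply/L0P => i; split.
      apply: (@measurable_fun_piecewise _ _ _ C (fun m x => sc_Re (g m x i 0)) _ mC).
      - by move=> m; have [/L0P/(_ i) []] := (hg m).1.
      - by move=> m x /fin ->.
      - by move=> x /fout ->; rewrite mxE sc_Re0.
    apply: (@measurable_fun_piecewise _ _ _ C (fun m x => sc_Im (g m x i 0)) _ mC).
    - by move=> m; have [/L0P/(_ i) []] := (hg m).1.
    - by move=> m x /fin ->.
    - by move=> x /fout ->; rewrite mxE sc_Im0.
  have : {ae mu, forall x m, G x (g m x)}.
    by apply: ae_foralln => m; exact: (hg m).1.2.
  apply: filterS => x hx; rewrite /f; case: ifP => // _; exact: in_K0.
move=> Q PQ; have [m mQ] := CP Q PQ; rewrite -mQ in PQ *.
have -> : average (C m) f = average (C m) (g m) by apply: average_ext => x; exact: fin.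
exact: (hg m).2 PQ.
Qed.

(** The factor 6^-d is the worst proportion of a cube in the dyadic cube around it. *)
Definition good_cube G u (e : R) : set (set X) := [set Q | exists g,
  S0 G g /\ vclose (6 ^- d * e) (sc_real (6 ^- d) *: u) (average Q g)].

(** A selection on the small cube is extended by 0 and multiplied by a number in [0, 1]; since
    the values of G are convex and contain 0, the result is again a selection. The number
    6^-d |Q| / |O| makes its average over Q equal to 6^-d times that over the small cube O,
    whatever the size of Q. *)
Lemma good_cube_of_ocube G u (e : R) a l f Q : in_spaceK N G ->
  (forall Q, is_cube Q -> exists2 C : R, 0 <= C & averaging_bound N [set Q] C) ->
  0 < l -> S0 (restrict_K G (ocube a l)) f -> vclose e u (average (ocube a l) f) ->
  is_cube Q -> ocube a l `<=` Q -> (mu Q <= (6 ^+ d)%:E * mu (ocube a l))%E ->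
  good_cube G u e Q.
Proof.
move=> [hG sG kG] bC l0 sf uf cQ oQ muQ6.
set O := ocube a l in sf uf oQ muQ6.
have cO : is_cube O by exact: is_cube_cube.
have mO := cube_measurable cO; have mQ := cube_measurable cQ.
have [ob o0 muO] := leb_is_cube cO; have [q q0 muQ] := leb_is_cube cQ.
have six : 0 < 6 ^+ d :> R by rewrite exprn_gt0.
have q6 : q <= 6 ^+ d * ob by move: muQ6; rewrite muQ muO -EFinM lee_fin.
pose r := 6 ^- d * (q / ob).
have r01 : 0 <= r <= 1.
  apply/andP; split; first by rewrite /r mulr_ge0 ?invr_ge0 ?divr_ge0// ltW.
  by rewrite /r mulrA ler_pdivrMr// mul1r mulrC ler_pdivrMr// mulrC.
have sh : S0 G (restrict_vec O f).
  exact: (S0_restrict hG (S0_restrict_sub hG mO oQ sf)).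
have [C C0 hC] := bC Q cQ.
have [/(_ Q erefl) iQ _] := hC _ (sG _ sh).
exists (fun x => sc_real r *: restrict_vec O f x); split.
  have [mh hGx] := sh; split.
    by apply/L0P => i; apply: mscZ (msc_cst _) ((L0P _).2 mh i).
  by apply: filterS hGx => x hx; exact: in_K_contract (hG.1 x) hx r01.
have oN0 : fine (mu O) != 0 by rewrite muO gt_eqF.
rewrite (average_scale r mQ iQ) (average_sub f oQ oN0) scalerA -sc_realM muO muQ /=.
have -> : r * (ob / q) = 6 ^- d.
  by rewrite /r -mulrA mulf_div mulrC [ob * q]mulrC divff ?mul1r// mulf_neq0 ?gt_eqF.
move=> i; rewrite !mxE -mulrBr sc_absM sc_abs_real ger0_norm ?invr_ge0 ?(ltW six)//.
by rewrite ltr_pM2l ?invr_gt0//; have := uf i; rewrite mxE.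
Qed.

Definition near_maximal G u (e : R) (j : nat) : set X :=
  [set x | exists a l, (0 < l < j.+1%:R /\ exists f,
    S0 (restrict_K G (ocube a l)) f /\ vclose e u (average (ocube a l) f)) /\ ocube a l x].

Lemma near_maximal_mono G u e : nondecreasing_seq (near_maximal G u e).
Proof.
move=> i j ij; apply/subsetPset => x [a [l [[/andP[l0 li] hf] Ox]]].
exists a, l; split => //; split => //; rewrite l0 (lt_le_trans li)//.
by rewrite ler_nat.
Qed.

Lemma maximal_near G u e x : L0K G -> 0 < e -> maximal G x u ->
  exists j, near_maximal G u e j x.
Proof.
move=> hG e0 /(maximal_ocube _ _ hG)/(_ e e0)[a [l [f [l0 Ox sf uf]]]].
exists (Num.bound l), a, l; split => //; split; last by exists f.
rewrite l0 /=; apply: (lt_trans (archi_boundP (ltW l0))); by rewrite ltr_nat.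
Qed.

(** On these sets W is bounded and the measure is finite. *)
Definition bounded_part (m : nat) : set X :=
  dyadic_ball m `&` [set x | \sum_i \sum_j sc_abs (W x i j) <= m%:R].

Lemma bounded_part_measurable m : measurable (bounded_part m).
Proof.
apply: measurableI; first by apply: cube_measurable; exact: dyadic_ball_cube.
apply: measurable_le; last exact: measurable_cst.
by apply: measurable_entry_sum; exact: mW_entry.
Qed.

Lemma bounded_part_mono : nondecreasing_seq bounded_part.
Proof.
move=> i j ij; apply/subsetPset => x [/dyadic_ballE h1 /= h2]; split.
  by apply/dyadic_ballE => q; apply: (le_trans (h1 q)); rewrite ler_eXn2l// ltr1n.
by apply: (le_trans h2); rewrite ler_nat.
Qed.

Lemma bounded_part_cover x : exists m, bounded_part m x.
Proof.
set S := \sum_i \sum_j sc_abs (W x i j).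
have S0' : 0 <= S by apply: sumr_ge0 => i _; apply: sumr_ge0 => j _; exact: sc_abs_ge0.
have x0 := norm_Rd_ge0 x.
exists (Num.bound (norm_Rd x + S)); split.
  apply/dyadic_ballE => i; apply: (le_trans (norm_Rd_coord x i)).
  apply: (@le_trans _ _ (norm_Rd x + S)); first by rewrite lerDl.
  by apply/ltW/upper_nthrootP; exact: leqnn.
rewrite /= -/S; apply: ltW; apply: (@le_lt_trans _ _ (norm_Rd x + S)); first by rewrite lerDr.
by apply: archi_boundP; rewrite addr_ge0.
Qed.

Lemma vnorm_split m x u v (e : R) : bounded_part m x -> 0 < e ->
  vclose (6 ^- d * e) (sc_real (6 ^- d) *: u) v ->
  vnorm (W x *m u) <= 2 * Num.max (6 ^+ d * vnorm (W x *m v)) (n%:R * (m%:R * e)).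
Proof.
move=> [_ /= Wm] e0 uv; have six : 0 < 6 ^+ d :> R by rewrite exprn_gt0.
pose w := u - sc_real (6 ^+ d) *: v.
have we i : sc_abs (w i 0) <= e.
  have -> : w i 0 = sc_real (6 ^+ d) * ((sc_real (6 ^- d) *: u) i 0 - v i 0).
    rewrite /w !mxE mulrBr mulrA -sc_realM mulfV ?gt_eqF// sc_real1 mul1r.
    by [].
  rewrite sc_absM sc_abs_real (gtr0_norm six).
  by rewrite mulrC -ler_pdivlMr// mulrC; exact: ltW.
have -> : u = sc_real (6 ^+ d) *: v + w by rewrite /w addrC subrK.
rewrite mulmxDr; apply: (le_trans (vnormD_max _ _)).
rewrite ler_wpM2l// ge_max vnorm_mulmxZ sc_abs_real (gtr0_norm six) le_max lexx /=.
rewrite le_max; apply/orP; right.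
apply: vnorm_le_coord => i; apply: (le_trans (sc_abs_mulmx_le _ _ we)).
by rewrite ler_wpM2r// ltW.
Qed.

(** 2 * 2^d functions enter [gLp_max]: one per grid and its error term; each contributes
    2 * 6^d, with 6^d from the size of the dyadic cubes and 2 from [vnormD_max]. *)
Definition weak_const : R := 2 ^+ d.+2 * 6 ^+ d.

Lemma weak_const_gt0 : 0 < weak_const.
Proof. by apply: mulr_gt0; exact: exprn_gt0. Qed.

(** The union of the good cubes of one grid is covered by the maximal ones; gluing their
    selections gives one f in S^0(G) whose averages over them are 6^-d u up to 6^-d e. Hence
    |W u| is at most twice the larger of 6^d |W T_P f| and an error of size n m e there, and
    the norm of T_P f is at most C times that of G. *)
Lemma near_maximal_bound G u (C kp e : R) (j m : nat) : in_spaceK N G ->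
  0 < C -> (forall P, disjoint_cubes P -> averaging_bound N P C) ->
  K_norm N G = kp%:E -> 0 <= kp -> 0 < e ->
  (Lp_norm p (fun x => \1_(near_maximal G u e j `&` bounded_part m) x *
      vnorm (W x *m u))%R <=
    (weak_const * C * kp +
      2 ^+ d.+2 * (n%:R * m%:R * ((1 + 1) * ((2 ^+ m.+1) ^+ d + 1))) * e)%:E)%E.
Proof.
move=> sG C0 bC kE kp0 e0; have [hG _ _] := sG.
have six : 0 < 6 ^+ d :> R by rewrite exprn_gt0.
have bC1 Q : is_cube Q -> exists2 C' : R, 0 <= C' & averaging_bound N [set Q] C'.
  by move=> cQ; exists C; [exact: ltW|apply: bC; exact: disjoint_cubes1].
have [P [hP cov]] := dyadic_cover (good_cube G u e) (ltr0Sn R j).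
have /choice[f hf] : forall t, exists f, S0 G f /\ forall Q, P t Q ->
    vclose (6 ^- d * e) (sc_real (6 ^- d) *: u) (average Q f).
  move=> t; have [f f1 f2] := K_glue hG (hP t).1
    (fun Q PQ => (hP t).2 Q PQ : exists g, S0 G g /\
      (fun _ v => vclose (6 ^- d * e) (sc_real (6 ^- d) *: u) v) Q (average Q g)).
  by exists f.
pose s1 : R := 2 * 6 ^+ d.
pose s2 : R := 2 * (n%:R * (m%:R * e)).
pose Fi (i : {ffun 'I_d -> bool} * bool) (x : X) : R :=
  if i.2 then s1 * vnorm (W x *m averaging (P i.1) (f i.1) x)
  else s2 * \1_(dyadic_ball m) x.
have s10 : 0 <= s1 by rewrite /s1 mulr_ge0// ltW.
have s20 : 0 <= s2 by rewrite /s2 !mulr_ge0// ltW.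
have mD : measurable (@dyadic_ball R d m).
  by apply: cube_measurable; exact: dyadic_ball_cube.
have mDi : measurable_fun setT (fun x : X => \1_(dyadic_ball m) x : R).
  exact: measurable_indic.
have mT i : measurable_fun setT (fun x => vnorm (W x *m averaging (P i) (f i) x)).
  exact: (measurable_Wnorm mW (L0_averaging (f i) (hP i).1)).
have mN : measurable (near_maximal G u e j) by exact: bigcup_ocube_measurable.
pose A : R := s1 * (C * kp) + s2 * ((1 + 1) * ((2 ^+ m.+1) ^+ d + 1)).
have A1 : 0 <= s1 * (C * kp) by rewrite !mulr_ge0// ltW.
have q0 : 0 <= (2 ^+ m.+1) ^+ d :> R by rewrite exprn_ge0// exprn_ge0.
have A2 : 0 <= s2 * ((1 + 1) * ((2 ^+ m.+1) ^+ d + 1)).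
  by rewrite mulr_ge0// mulr_ge0// addr_ge0.
have -> : (weak_const * C * kp +
    2 ^+ d.+2 * (n%:R * m%:R * ((1 + 1) * ((2 ^+ m.+1) ^+ d + 1))) * e)%:E =
    ((#|{: {ffun 'I_d -> bool} * bool}|%:R : R)%:E * A%:E)%E.
  rewrite card_prod card_ffun card_bool card_ord -EFinM; congr EFin.
  rewrite natrM natrX /A /s1 /s2 /weak_const !exprS; ring.
apply: (gLp_max ep.1 ep.2 (f := Fi)).
- by rewrite card_prod card_ffun card_bool muln_gt0 expn_gt0.
- apply: measurable_funM; last exact: (measurable_Wnorm mW (L0_cst u)).
  by apply: measurable_indic; apply: measurableI => //; exact: bounded_part_measurable.
- by move=> [t []]; [exact: (measurable_cstM s1 (mT t))|exact: (measurable_cstM s2 mDi)].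
- move=> x; rewrite indicE.
  case: (boolP (x \in _)) => [/set_mem[[a [l [[ll [g [sg ug]]] Ox]]] Bx]|_]; last first.
    by exists ([ffun=> false], true); rewrite mul0r normr0.
  have [t [Q PQ Qx]] := cov a l ll (fun Q cQ oQ mQ =>
    good_cube_of_ocube sG bC1 (proj1 (andP ll)) sg ug cQ oQ mQ) x Ox.
  have uv := (hf t).2 Q PQ; rewrite -(averaging_in (f t) (hP t).1 PQ Qx) in uv.
  have := vnorm_split Bx e0 uv; rewrite mul1r (ger0_norm (vnorm_ge0 _)).
  have [ab|/ltW ab] := leP (6 ^+ d * vnorm (W x *m averaging (P t) (f t) x))
    (n%:R * (m%:R * e)) => hv.
    exists (t, false); rewrite /Fi /= indicE mem_set ?mulr1 ?(ger0_norm s20)//.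
    by case: Bx.
  by exists (t, true); rewrite /Fi /= ger0_norm ?mulr_ge0 ?vnorm_ge0// /s1 -mulrA.
move=> [t []].
  apply: (le_trans (gLpZ mu ep.1 ep.2 s1 (mT t))); rewrite (ger0_norm s10).
  apply: (@le_trans _ _ (s1 * (C * kp))%:E); last by rewrite lee_fin lerDl.
  rewrite [X in (_ <= X)%E]EFinM lee_wpmul2l ?lee_fin//.
  have sft : in_space N (f t) by case: sG => _ h _; apply: h; exact: (hf t).1.
  have [_ [_ h]] := bC _ (hP t).1 _ sft; apply: (le_trans h).
  rewrite [X in (_ <= X)%E]EFinM lee_wpmul2l ?lee_fin ?(ltW C0)// -kE; apply: S0_le_K_norm.
  exact: (hf t).1.
apply: (le_trans (gLpZ mu ep.1 ep.2 s2 mDi)); rewrite (ger0_norm s20).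
apply: (@le_trans _ _ (s2 * ((1 + 1) * ((2 ^+ m.+1) ^+ d + 1)))%:E).
  rewrite [X in (_ <= X)%E]EFinM lee_wpmul2l ?lee_fin//.
  apply: (gLp_bounded ep.1 ep.2 mDi mD (leb_dyadic_ball m) q0 ler01) => x.
  by rewrite mul1r ger0_norm.
by rewrite lee_fin lerDr.
Qed.

Lemma maximal_weak_bound_of_strong (C : R) : 0 < C ->
  (forall P, disjoint_cubes P -> averaging_bound N P C) ->
  maximal_weak_bound N (weak_const * C).
Proof.
move=> C0 bC G sG; have [hG _ kG] := sG.
have k0 := K_norm_ge0 hG.
have kE : K_norm N G = (fine (K_norm N G))%:E by rewrite fineK// ge0_fin_numE.
have kp0 : 0 <= fine (K_norm N G) by rewrite fine_ge0.
rewrite kE -EFinM.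
have main u : (N (indic_vec [set x | maximal G x u] u) <=
    (weak_const * C * fine (K_norm N G))%:E)%E.
  have mE := maximal_measurable u hG.
  have -> : N (indic_vec [set x | maximal G x u] u) =
      gLp mu p (fun x => \1_[set x | maximal G x u] x * vnorm (W x *m u))%R.
    exact: (N_restrict_vec p W [set x | maximal G x u] (fun=> u)).
  apply: (gLp_covering ep.1 ep.2 (B := bounded_part) (U := near_maximal G u)
    (b := fun m => 2 ^+ d.+2 * (n%:R * m%:R * ((1 + 1) * ((2 ^+ m.+1) ^+ d + 1))))).
  - exact: (measurable_Wnorm mW (L0_cst u)).
  - exact: mE.
  - exact: bounded_part_measurable.
  - exact: bounded_part_mono.
  - exact: bounded_part_cover.
  - by move=> e j; exact: bigcup_ocube_measurable.
  - exact: near_maximal_mono.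
  - by move=> e x e0 Ex; exact: (maximal_near hG e0 Ex).
  - move=> m; apply: mulr_ge0; first exact: exprn_ge0.
    apply: mulr_ge0; first exact: mulr_ge0.
    apply: mulr_ge0 => //; apply: addr_ge0 => //; apply: exprn_ge0; exact: exprn_ge0.
  - by move=> e j m e0; exact: near_maximal_bound.
split; last by apply: ge_ereal_sup => _ [u _ <-].
move=> u; split; first by apply: L0_indic_vec; exact: maximal_measurable.
by apply: (le_lt_trans (main u)); rewrite ltry.
Qed.

End strong_to_weak.

(** * From the maximal operator to single cubes *)

Section generic.
Context {R : realType} {k : scalar_kind} {disp} {X : measurableType disp}.
Context (mu : {measure set X -> \bar R}) {n : nat}.
Local Notation F := (sfield R k).
Implicit Types (f : X -> 'cV[sfield R k]_n) (Q : set X).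

Lemma integral_vnorm_restrict f Q : measurable Q ->
  (forall i, measurable_scalar (fun x => f x i 0)) ->
  (\int[mu]_(x in Q) (vnorm (f x))%:E <=
   \int[mu]_x (vnorm ((\1_Q x : F) *: f x))%:E)%E.
Proof.
move=> mQ mf.
have m1 : measurable_fun setT (fun x => vnorm ((\1_Q x : F) *: f x)).
  by apply: measurable_vnorm => i; apply: mscZ (mf i); exact: msc_indic.
apply: (@le_trans _ _ (\int[mu]_(x in Q) (vnorm ((\1_Q x : F) *: f x))%:E)%E).
  rewrite le_eqVlt; apply/orP; left; apply/eqP; apply: eq_integral => x xQ.
  by rewrite indicE xQ scale1r.
apply: ge0_subset_integral => //; first exact/measurable_EFinP.
by move=> x _; rewrite lee_fin vnorm_ge0.
Qed.

Lemma integrable_of_vnorm f Q (g : X -> R) : measurable Q ->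
  (forall i, measurable_scalar (fun x => f x i 0)) ->
  (\int[mu]_(x in Q) (vnorm (f x))%:E < +oo)%E ->
  measurable_fun setT g -> (forall x, `|g x| <= vnorm (f x)) ->
  mu.-integrable Q (fun x => (g x)%:E).
Proof.
move=> mQ mf fin mg gf; apply/integrableP; split.
  by apply/measurable_EFinP; exact: measurable_funTS.
apply: le_lt_trans fin; apply: ge0_le_integral => //.
- by apply: measurableT_comp => //; apply/measurable_EFinP; exact: measurable_funTS.
- by apply/measurable_EFinP; apply: measurable_funTS; exact: measurable_vnorm.
- by move=> x _; rewrite lee_fin.
Qed.

Lemma integral_vdot_indic f Q (u : 'cV[F]_n) : measurable Q ->
  (forall i, measurable_scalar (fun x => f x i 0)) ->
  (\int[mu]_x (sc_abs (vdot (f x) ((\1_Q x : F) *: u)))%:E <=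
   (n%:R * vnorm u)%:E * \int[mu]_(x in Q) (vnorm (f x))%:E)%E.
Proof.
move=> mQ mf; have c0 : 0 <= n%:R * vnorm u by rewrite mulr_ge0 ?vnorm_ge0.
have mv : measurable_fun setT (fun x => (vnorm (f x))%:E).
  by apply/measurable_EFinP; exact: measurable_vnorm.
have conj_abs (z : F) : sc_abs (sc_conj z) = sc_abs z.
  rewrite !sc_absE /sc_conj /sc_mk /sc_Re /sc_Im; case: (k) z => //= -[a b] /=.
  by rewrite sqrrN.
have mconj (g : X -> F) : measurable_scalar g -> measurable_scalar (fun x => sc_conj (g x)).
  rewrite /measurable_scalar /sc_conj /sc_mk /sc_Re /sc_Im; case: (k) g => //= g [h1 h2].
  by split => //; under eq_fun do rewrite -mulN1r; exact: measurable_funM.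
rewrite -ge0_integralZl//; last 2 first.
- exact: measurable_funTS.
- by move=> x _; rewrite lee_fin vnorm_ge0.
rewrite [leRHS]integral_mkcond; apply: ge0_le_integral => //.
- by move=> x _; rewrite lee_fin sc_abs_ge0.
- apply/measurable_EFinP; apply: measurable_sc_abs; apply: msc_sum => i.
  apply: mscM (mf i) _; apply: mconj; apply: mscZ; [exact: msc_indic|exact: msc_cst].
- apply/(measurable_restrictT _ mQ).1; apply: measurable_funTS.
  exact: emeasurable_funM.
move=> x _; rewrite patchE; have sum_abs : sc_abs (vdot (f x) ((\1_Q x : F) *: u)) <=
    \sum_(i < n) \1_Q x * (vnorm u * vnorm (f x)).
  apply: (@le_trans _ _ (\sum_i sc_abs (f x i 0 * sc_conj (((\1_Q x : F) *: u) i 0)))).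
    exact: sc_abs_sum.
  apply: ler_sum => i _.
  rewrite sc_absM conj_abs mxE sc_absM sc_indic sc_abs_real ger0_norm//.
  rewrite mulrCA ler_wpM2l// mulrC ler_pM ?sc_abs_ge0 ?vnorm_coord//.
move: sum_abs; set s := sc_abs _; rewrite sumr_const card_ord indicE; case: ifPn => _ /=.
  by rewrite mul1r => h; rewrite -EFinM lee_fin -mulrA [leRHS]mulr_natl.
by rewrite mul0r mul0rn lee_fin.
Qed.

Lemma msc_preimage_open (f : X -> 'cV[F]_n) (E : set 'cV[F]_n) :
  (forall i, measurable_scalar (fun x => f x i 0)) -> open E -> measurable (f @^-1` E).
Proof.
move=> mf oE.
pose D (q : {ffun 'I_n -> rat * rat} * rat) : set 'cV[F]_n := [set v | forall i,
  `|sc_Re (v i 0) - ratr (q.1 i).1| < ratr q.2 /\ `|sc_Im (v i 0) - ratr (q.1 i).2| < ratr q.2].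
rewrite (_ : f @^-1` E = \bigcup_(q in [set q | D q `<=` E]) (f @^-1` D q)).
  apply: bigcup_countType_measurable => q _.
  rewrite (_ : f @^-1` D q = \bigcap_(i in [set: 'I_n])
    ([set x | `|sc_Re (f x i 0) - ratr (q.1 i).1| < ratr q.2] `&`
     [set x | `|sc_Im (f x i 0) - ratr (q.1 i).2| < ratr q.2])); last first.
    by apply/seteqP; split => x h i *; [split; case: (h i)|case: (h i I)].
  apply: fin_bigcap_measurable => // i _; have [m1 m2] := mf i.
  have mlt (g : X -> R) (c r : R) : measurable_fun setT g ->
      measurable [set x | `|g x - c| < r].
    move=> mg; rewrite -[X in measurable X]setTI.
    apply: (measurable_fun_ltr (f := fun x => `|g x - c|) (g := cst r) _ _ measurableT (Y := [set true])) => //.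
    by apply: measurableT_comp => //; exact: measurable_funB.
  by apply: measurableI; apply: mlt.
apply/seteqP; split => x; last by move=> [q qE /qE].
move=> Efx; have /nbhs_vclose[e e0 he] : nbhs (f x) E.
  by rewrite nbhsE /=; exists E.
have e4 : 0 < e / 4 by rewrite divr_gt0.
have [r] := rat_in_itvoo e4; rewrite in_itv/= => /andP[r0 re].
have approx (y : R) : exists q : rat, `|y - ratr q| < ratr r.
  have [|q] := @rat_in_itvoo R (y - ratr r) (y + ratr r); first by lra.
  by rewrite in_itv/= => /andP[h1 h2]; exists q; rewrite ltr_norml; apply/andP; split; lra.
have /choice[q hq] : forall i, exists q : rat * rat,
    `|sc_Re (f x i 0) - ratr q.1| < ratr r /\ `|sc_Im (f x i 0) - ratr q.2| < ratr r.
  move=> i; have [q1 h1] := approx (sc_Re (f x i 0)); have [q2 h2] := approx (sc_Im (f x i 0)).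
  by exists (q1, q2).
exists ([ffun i => q i], r); last by move=> i; rewrite /= ffunE; exact: hq.
move=> v /= hv; apply: he => i; have := hv i; have := hq i; rewrite /= ffunE.
move=> [a1 a2] [b1 b2]; apply: (le_lt_trans (sc_abs_le _)); rewrite sc_ReB sc_ImB.
move: a1 a2 b1 b2; rewrite !ltr_norml => /andP[? ?] /andP[? ?] /andP[? ?] /andP[? ?].
have h1 : `|sc_Re (f x i 0) - sc_Re (v i 0)| < 2 * ratr r.
  by rewrite ltr_norml; apply/andP; split; lra.
have h2 : `|sc_Im (f x i 0) - sc_Im (v i 0)| < 2 * ratr r.
  by rewrite ltr_norml; apply/andP; split; lra.
lra.
Qed.

End generic.

Section ray.
Context {R : realType} {k : scalar_kind} {n : nat}.
Local Notation F := (sfield R k).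
Local Notation V := 'cV[sfield R k]_n.
Implicit Types (u v w : V).

(** Contracting a towards 0 before rounding its coordinates keeps the modulus below 1. *)
Lemma sc_rat_dense (a : F) (e : R) : sc_abs a <= 1 -> 0 < e <= 1 ->
  exists q : rat * rat, let z : F := sc_mk k (ratr q.1) (ratr q.2) in
    sc_abs z <= 1 /\ sc_abs (z - a) <= 2 * e.
Proof.
move=> a1 /andP[e0 e1].
have e2 : 0 < e / 2 by rewrite divr_gt0.
have approx (y : R) : exists q : rat, `|ratr q - y| <= e / 2.
  have [|q] := @rat_in_itvoo R (y - e / 2) (y + e / 2); first by lra.
  by rewrite in_itv/= => /andP[h1 h2]; exists q; rewrite ler_norml; apply/andP; split; lra.
pose b := sc_real (1 - e) * a.
have [q1 h1] := approx (sc_Re b); have [q2 h2] := approx (sc_Im b).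
exists (q1, q2) => /=; set z : F := sc_mk _ _ _.
have zb : sc_abs (z - b) <= e.
  apply: (le_trans (sc_abs_le _)).
  have im (c : F) (r s : R) : `|sc_Im (sc_mk k r s) - sc_Im c| <= `|s - sc_Im c|.
    by rewrite /sc_mk /sc_Im; case: (k) c => //= c; rewrite subr0 normr0.
  have : `|sc_Im (z - b)| <= e / 2.
    by apply: le_trans h2; rewrite sc_ImB; exact: im.
  rewrite sc_ReB sc_Re_mk; lra.
have bE : sc_abs b = (1 - e) * sc_abs a by rewrite sc_absM sc_abs_real ger0_norm// subr_ge0.
have ba : sc_abs (b - a) = e * sc_abs a.
  rewrite (_ : b - a = sc_real (- e) * a) ?sc_absM ?sc_abs_real ?normrN ?gtr0_norm//.
  by rewrite /b -[X in _ - X]mul1r -sc_real1 -mulrBl -sc_realB; congr (sc_real _ * _); lra.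
have a0 := sc_abs_ge0 a; split.
  have -> : z = (z - b) + b by rewrite subrK.
  apply: (le_trans (sc_abs_triangle _ _)); rewrite bE.
  have : (1 - e) * sc_abs a <= 1 - e by rewrite ler_piMr// subr_ge0.
  lra.
have -> : z - a = (z - b) + (b - a) by rewrite addrA subrK.
apply: (le_trans (sc_abs_triangle _ _)); rewrite ba.
have : e * sc_abs a <= e by rewrite ler_piMr// ltW.
lra.
Qed.

(** The image of the unit disc of scalars under a |-> a *: w; equations and inequalities between
    entries pass to limits, so it is closed. *)
Definition ray w : set V := [set v |
  (forall i j, v i 0 * w j 0 = v j 0 * w i 0) /\
  forall i, sc_abs (v i 0) <= sc_abs (w i 0)].

Lemma rayP w v : ray w v <-> exists2 a : F, sc_abs a <= 1 & v = a *: w.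
Proof.
split.
  move=> [h1 h2]; have [w0|/cV0Pn[j wj]] := eqVneq w 0.
    exists 0; first by rewrite -sc_real0 sc_abs_real normr0.
    rewrite w0 scaler0; apply/colP => i; rewrite mxE; have := h2 i; rewrite w0 mxE.
    rewrite -sc_real0 sc_abs_real normr0 => h; apply/eqP; rewrite sc_real0 -normr_eq0 sc_normE.
    by rewrite (_ : sc_abs _ = 0) ?sc_real0//; apply/eqP; rewrite eq_le h sc_abs_ge0.
  have aw : sc_abs (v j 0 / w j 0) * sc_abs (w j 0) = sc_abs (v j 0).
    by rewrite -sc_absM divfK.
  exists (v j 0 / w j 0).
    have wj0 : 0 < sc_abs (w j 0).
      by rewrite -(@sc_lt_real R k) -sc_normE sc_real0 normr_gt0.
    by rewrite -(ler_pM2r wj0) aw mul1r.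
  by apply/colP => i; rewrite mxE mulrAC -h1 mulfK.
move=> [a a1 ->]; split=> [i j|i]; rewrite !mxE; first by rewrite mulrAC.
by rewrite sc_absM ler_piMl ?sc_abs_ge0.
Qed.

Lemma ray_self w : ray w w.
Proof. by split=> [i j|i]; [rewrite mulrC|exact: lexx]. Qed.

Lemma ray_in_K w : in_K (ray w).
Proof.
split.
- by exists w; exact: ray_self.
- move=> u /closure_vclose h.
  have le_eps (x c : R) : 0 <= c -> (forall e, 0 < e -> x <= c * e) -> x <= 0.
    move=> c0 hx; apply/ler_addgt0Pr => e e0; rewrite add0r.
    have c10 : 0 < c + 1 by rewrite ltr_wpDl.
    apply: (le_trans (hx (e / (c + 1)) _)); first by rewrite divr_gt0.
    by rewrite mulrA ler_pdivrMr// mulrC ler_wpM2l ?lerDl// ltW.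
  split.
    move=> i j; apply/eqP; rewrite -subr_eq0 -normr_eq0 sc_normE.
    rewrite (_ : sc_abs _ = 0) ?sc_real0//; apply/eqP; rewrite eq_le sc_abs_ge0 andbT.
    apply: (le_eps _ (sc_abs (w j 0) + sc_abs (w i 0))); first by rewrite addr_ge0 ?sc_abs_ge0.
    move=> e e0; have [v [v1 _] uv] := h e e0.
    have -> : u i 0 * w j 0 - u j 0 * w i 0 =
        (u i 0 - v i 0) * w j 0 + - ((u j 0 - v j 0) * w i 0).
      by have := v1 i j; move=> v1ij; rewrite !mulrBl opprB v1ij; ring.
    apply: (le_trans (sc_abs_triangle _ _)); rewrite sc_absN !sc_absM.
    rewrite mulrDl; apply: lerD; rewrite mulrC ler_wpM2l ?sc_abs_ge0//; exact: ltW.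
  move=> i; rewrite -subr_le0; apply: (le_eps _ 1) => // e e0; rewrite mul1r.
  have [v [_ v2] uv] := h e e0; rewrite lerBlDr.
  have -> : u i 0 = (u i 0 - v i 0) + v i 0 by rewrite subrK.
  by apply: (le_trans (sc_abs_triangle _ _)); rewrite lerD// ltW.
- move=> x y l; rewrite !inE => /rayP[a a1 ->] /rayP[b b1 ->]; apply/rayP.
  have [l0 l1] : 0 <= l%:num /\ l%:num <= 1 by split.
  have lE : l%:num = sc_real (sc_abs l%:num) by rewrite -sc_normE ger0_norm.
  exists (l%:num * a + (1 - l%:num) * b); last by rewrite scalerDl -!scalerA.
  have s1 : sc_abs l%:num <= 1 by rewrite -(@sc_le_real R k) -lE sc_real1.
  apply: (le_trans (sc_abs_triangle _ _)); rewrite lE -sc_real1 -sc_realB !sc_absM !sc_abs_real.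
  have s0 := sc_abs_ge0 (l%:num).
  rewrite (ger0_norm s0) ger0_norm ?subr_ge0//.
  have := sc_abs_ge0 a; have := sc_abs_ge0 b; nra.
- move=> v a /rayP[b b1 ->] a1; apply/rayP; exists (a * b); last by rewrite scalerA.
  have : sc_abs a = 1 by have := congr1 (@sc_Re R k) a1; rewrite sc_normE sc_Re_real sc_Re1.
  by rewrite sc_absM => ->; rewrite mul1r.
Qed.

(** Countably many multiples of w detect whether its ray meets an open set, which
    makes the ray of a measurable function measurable. *)
Lemma ray_meets_open w (E : set V) : open E ->
  (ray w `&` E !=set0) <-> exists q : rat * rat,
    sc_abs (sc_mk k (ratr q.1) (ratr q.2) : F) <= 1 /\
    E ((sc_mk k (ratr q.1) (ratr q.2) : F) *: w).
Proof.
move=> oE; split; last first.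
  by move=> [q [q1 Eq]]; eexists; split; last exact: Eq; apply/rayP; eexists; first exact: q1.
move=> [_ [/rayP[a a1 ->] Eaw]].
have /nbhs_vclose[e e0 he] : nbhs (a *: w) E by rewrite nbhsE /=; exists E.
have w0 := vnorm_ge0 w; have w40 : 0 < 4 * (vnorm w + 1) by rewrite mulr_gt0// ltr_wpDl.
pose t := Num.min 1 (e / (4 * (vnorm w + 1))).
have t01 : 0 < t <= 1 by rewrite lt_min ltr01 divr_gt0//= ge_min lexx.
have [q [q1 qa]] := sc_rat_dense a1 t01; exists q; split => //; apply: he => i.
rewrite !mxE -mulrBl sc_absM -[a - _]opprB sc_absN; apply: (@le_lt_trans _ _ (2 * t * vnorm w)).
  by apply: ler_pM; rewrite ?sc_abs_ge0// vnorm_coord.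
have te : t <= e / (4 * (vnorm w + 1)) by rewrite ge_min lexx orbT.
have t0 : 0 < t by case/andP: t01.
move: te; rewrite ler_pdivlMr// => te; have := mulr_ge0 (ltW t0) w0; nra.
Qed.

End ray.

Section weak_to_class_A.
Context {R : realType} {k : scalar_kind} {d n : nat}.
Local Notation F := (sfield R k).
Local Notation X := (Rd R d).
Local Notation V := 'cV[sfield R k]_n.
Local Notation mu := (leb R d).
Variables (p : X -> \bar R) (W : X -> 'M[F]_n).
Hypothesis ep : exponent p.
Hypothesis mW : matrix_weight W.
Local Notation N := (LpW_norm p W).
Implicit Types (f g : X -> V) (Q : set X) (u v : V).

Lemma L0K_ray f : L0 f -> L0K (fun x => ray (f x)).
Proof.
move=> /L0P mf; split=> [x|E oE]; first exact: ray_in_K.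
pose z (q : rat * rat) : F := sc_mk k (ratr q.1) (ratr q.2).
rewrite (_ : [set x | _] =
    \bigcup_(q in [set q | sc_abs (z q) <= 1]) ((fun x => z q *: f x) @^-1` E)).
  apply: bigcup_countType_measurable => q _; apply: (msc_preimage_open _ oE) => i.
  exact: mscZ (msc_cst _) (mf i).
apply/seteqP; split=> [x /(ray_meets_open (f x) oE)[q [q1 Eq]]|x [q q1 Eq]].
  by exists q.
by apply/(ray_meets_open (f x) oE); exists q; split; [exact: q1|exact: Eq].
Qed.

Lemma N_ray_le f g : L0 f -> S0 (fun x => ray (f x)) g -> (N g <= N f)%E.
Proof.
move=> mf [mg gf]; apply: (N_ae_homo ep mW mg mf); apply: filterS gf => x.
by move=> /rayP[a a1 ->]; rewrite vnorm_mulmxZ ler_piMl// vnorm_ge0.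
Qed.

(** Every selection a f of the ray of f satisfies |W a f| <= |W f|. *)
Lemma in_spaceK_ray f : in_space N f -> in_spaceK N (fun x => ray (f x)) /\
  (K_norm N (fun x => ray (f x)) <= N f)%E.
Proof.
move=> [mf fN].
have le : (K_norm N (fun x => ray (f x)) <= N f)%E.
  by apply: ge_ereal_sup => _ [g sg <-]; exact: N_ray_le.
split; last exact: le.
split; [exact: L0K_ray| |exact: (le_lt_trans le fN)].
by move=> g sg; split; [exact: sg.1|exact: (le_lt_trans (N_ray_le mf sg) fN)].
Qed.

Lemma S0_ray Q f : measurable Q -> L0 f ->
  S0 (restrict_K (fun x => ray (f x)) Q) (restrict_vec Q f).
Proof.
move=> mQ mf; split; first exact: L0_restrict_vec.
apply: aeW => x; rewrite /restrict_K /restrict_vec indicE; case: ifP => _.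
  by rewrite scale1r; exact: ray_self.
by rewrite scale0r.
Qed.

Lemma integrable_on_of_L1locK Q f : is_cube Q -> L0 f -> L1locK (fun x => ray (f x)) ->
  integrable_on Q f.
Proof.
move=> cQ mf [_ /(_ Q cQ) fin]; have mQ := cube_measurable cQ; have mf' := (L0P f).2 mf.
have fQ : (\int[mu]_(x in Q) (vnorm (f x))%:E < +oo)%E.
  apply: (le_lt_trans (integral_vnorm_restrict mu mQ mf')); apply: le_lt_trans fin.
  by apply: ereal_sup_ubound; exists (restrict_vec Q f); [exact: S0_ray|exact: erefl].
apply/integrable_onP => i; have [m1 m2] := mf' i; split.
  apply: (integrable_of_vnorm mQ mf' fQ m1) => x.
  by apply: (le_trans (sc_Re_le_abs _)); exact: vnorm_coord.
apply: (integrable_of_vnorm mQ mf' fQ m2) => x.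
by apply: (le_trans (sc_Im_le_abs _)); exact: vnorm_coord.
Qed.

(** The vector u = <f>_Q is a value of the maximal operator of the ray of f at every point
    of Q, so the weak bound for this u controls the norm of T_Q f = 1_Q u. *)
Lemma averaging_bound_of_weak Q (C : R) : is_cube Q -> 0 <= C ->
  in_spaceK N `<=` L1locK -> maximal_weak_bound N C -> averaging_bound N [set Q] C.
Proof.
move=> cQ C0 hL hC f sf; have [mf fN] := sf; have mQ := cube_measurable cQ.
have [sG kG] := in_spaceK_ray sf; have [hG _ _] := sG.
set G := (fun x => ray (f x)) in sG kG hG.
pose u := average Q f.
have uM x : Q x -> maximal G x u.
  move=> Qx; apply: subset_closure; exists Q => //.
  by exists (restrict_vec Q f); [exact: S0_ray|exact: average_restrict_vec].
have [sM hM] := hC G sG; have Nu : (N (indic_vec Q u) <= C%:E * N f)%E.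
  apply: (@le_trans _ _ (N (indic_vec [set x | maximal G x u] u))).
    apply: (N_homo ep mW (L0_indic_vec u mQ) (sM u).1) => x; rewrite !vnorm_mulmxZ !sc_abs_indic.
    rewrite ler_wpM2r ?vnorm_ge0// !indicE; case: (boolP (x \in Q)) => [/set_mem /uM hx|_].
      by rewrite mem_set.
    by rewrite ler0n.
  apply: (le_trans _ (le_trans hM _)); last by rewrite lee_wpmul2l ?lee_fin.
  by apply: ereal_sup_ubound; exists u.
split; first by move=> _ ->; exact: (integrable_on_of_L1locK cQ mf (hL _ sG)).
rewrite (averaging1 f cQ); split; last exact: Nu.
split; first exact: L0_indic_vec.
by apply: (le_lt_trans Nu); rewrite lte_mul_pinfty// lee_fin.
Qed.

Lemma A_const_le_weak (C : R) : 0 <= C ->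
  in_spaceK N `<=` L1locK -> maximal_weak_bound N C -> (A_const N <= C%:E)%E.
Proof.
move=> C0 hL hC; apply: ge_ereal_sup => _ [Q cQ <-]; apply: ereal_inf_lbound.
exists C; last exact: erefl.
by split; [exact: C0|exact: (averaging_bound_of_weak cQ C0 hL hC)].
Qed.

Lemma bounded_part_positive Q : is_cube Q ->
  exists m, (0 < mu (Q `&` bounded_part W m))%E.
Proof.
move=> cQ; have mQ := cube_measurable cQ; have [q q0 muQ] := leb_is_cube cQ.
apply: (@positive_measure_bigcup _ _ _ mu Q) => //.
- by move=> j; apply: measurableI => //; exact: bounded_part_measurable.
- by rewrite muQ lte_fin.
- by apply: aeW => x Qx; have [m hm] := bounded_part_cover W x; exists m.
Qed.

Lemma average_part Q E u : measurable E -> E `<=` Q -> fine (mu E) != 0 ->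
  average Q (indic_vec E u) = sc_real (fine (mu E) / fine (mu Q)) *: u.
Proof.
move=> mE EQ E0; rewrite -[indic_vec E u]/(restrict_vec E (fun=> u)) (average_sub _ EQ E0).
congr (_ *: _); apply/colP => i; rewrite !mxE.
have cI (c : R) : \int[mu]_(x in E) c = c * fine (mu E).
  exact: Rintegral_cst.
by rewrite !cI ![_ * fine _]mulrC !mulKf// sc_mkK.
Qed.

(** If W is bounded on a subset E of Q of positive measure, then 1_E u is in the space, and
    T_Q maps it to a positive multiple of 1_Q u. *)
Lemma N_indic_fin Q (C : R) u : is_cube Q -> averaging_bound N [set Q] C ->
  (N (indic_vec Q u) < +oo)%E.
Proof.
move=> cQ bC; have mQ := cube_measurable cQ; have [q q0 muQ] := leb_is_cube cQ.
have [m Epos] := bounded_part_positive cQ.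
set E := Q `&` bounded_part W m in Epos.
have EQ : E `<=` Q by move=> x [].
have mE : measurable E by apply: measurableI => //; exact: bounded_part_measurable.
have muE : mu E = (fine (mu E))%:E.
  rewrite fineK// ge0_fin_numE ?measure_ge0//.
  by apply: (@le_lt_trans _ _ (mu Q)); [rewrite le_measure// inE|rewrite muQ ltry].
have E0 : 0 < fine (mu E) by rewrite -lte_fin -muE.
have sE : in_space N (indic_vec E u).
  split; first exact: L0_indic_vec.
  apply: (@le_lt_trans _ _ ((n%:R * (m%:R * vnorm u) + 1) * (fine (mu E) + 1))%:E); last first.
    by rewrite ltry.
  apply: (gLp_bounded ep.1 ep.2 _ mE muE (ltW E0)).
  - exact: (measurable_Wnorm mW (L0_indic_vec u mE)).
  - by rewrite !mulr_ge0 ?vnorm_ge0.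
  move=> x; rewrite ger0_norm ?vnorm_ge0// vnorm_mulmxZ sc_abs_indic indicE mulrC.
  case: (boolP (x \in E)) => [/set_mem[_ [_ /= Wm]]|_]; last by rewrite !mulr0.
  rewrite !mulr1; apply: vnorm_le_coord => i.
  apply: (le_trans (sc_abs_mulmx_le _ _ (fun j => vnorm_coord u j))).
  by rewrite ler_wpM2r ?vnorm_ge0.
have [_ [[_ fin] _]] := bC _ sE; move: fin; rewrite (averaging1 _ cQ).
rewrite (average_part u mE EQ (lt0r_neq0 E0)) muQ /=; set r := _ / _.
have r0 : 0 < r by rewrite divr_gt0.
move=> fin; have mv := measurable_Wnorm mW (L0_indic_vec (sc_real r *: u) mQ).
have -> : N (indic_vec Q u) =
    gLp mu p (fun x => r^-1 * vnorm (W x *m indic_vec Q (sc_real r *: u) x))%R.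
  congr (gLp mu p); apply/funext => x.
  rewrite /indic_vec !vnorm_mulmxZ sc_abs_real (gtr0_norm r0) mulrCA.
  by rewrite [X in _ = _ * X]mulKf// gt_eqF.
apply: (le_lt_trans (gLpZ mu ep.1 ep.2 r^-1 mv)).
by rewrite lte_mul_pinfty// lee_fin.
Qed.

Lemma contains_cube_indicators_of_averaging :
  (forall Q, is_cube Q -> exists2 C : R, 0 <= C & averaging_bound N [set Q] C) ->
  contains_cube_indicators N.
Proof.
move=> bC Q u cQ; have [C C0 hC] := bC Q cQ; have mQ := cube_measurable cQ.
have mu0 := L0_indic_vec u mQ.
split; first by split; [exact: mu0|exact: (N_indic_fin u cQ hC)].
split; first exact: mu0.
have [C' C'0 h] := integral_le_N ep mW cQ C0 hC.
apply: (@le_lt_trans _ _ ((n%:R * vnorm u) * C')%:E); last by rewrite ltry.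
apply: ge_ereal_sup => _ [f [sf Nf] <-]; have mf := (L0P f).2 sf.1.
apply: (le_trans (integral_vdot_indic mu u mQ mf)); rewrite [X in (_ <= X)%E]EFinM.
rewrite lee_wpmul2l ?lee_fin ?mulr_ge0 ?vnorm_ge0//.
by apply: (le_trans (h f sf)); rewrite Nf mule1.
Qed.

Lemma class_A_of_weak : maximal_weak N -> class_A N.
Proof.
move=> [hL [C [C0 hC]]]; split; last first.
  by apply: (le_lt_trans (A_const_le_weak (ltW C0) hL hC)); rewrite ltry.
apply: contains_cube_indicators_of_averaging => Q cQ; exists C; first exact: ltW.
exact: (averaging_bound_of_weak cQ (ltW C0) hL hC).
Qed.

End weak_to_class_A.

(** * Equivalence and comparison of the constants *)

Section assembly.
Context {R : realType} {k : scalar_kind} {d n : nat}.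
Hypothesis hd : (0 < d)%N.
Local Notation X := (Rd R d).
Variables (p : X -> \bar R) (W : X -> 'M[sfield R k]_n).
Hypothesis ep : exponent p.
Hypothesis mW : matrix_weight W.
Local Notation N := (LpW_norm p W).

Definition strong_const (C1 C2 : R) : R := 4 * osc_const (d := d) C1 C2 ^+ 2.

Lemma strong_const_gt0 C1 C2 : 0 < C1 -> 0 < C2 -> 0 < strong_const C1 C2.
Proof.
by move=> C10 C20; apply: mulr_gt0 => //; apply: exprn_gt0; exact: osc_const_gt0.
Qed.

Lemma maximal_weak_norm_ge0 : (0 <= maximal_weak_norm N)%E.
Proof. by apply: le_ereal_inf_tmp => _ [C [C0 _] <-]; rewrite lee_fin ltW. Qed.

Section log_Holder.
Variables C1 C2 : R.
Hypotheses (C10 : 0 < C1) (C20 : 0 < C2).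
Hypothesis lH : log_Holder_with C1 C2 p.

Lemma averaging_bound_of_A_const (K : R) : (A_const N < K%:E)%E -> 0 < K /\
  forall P, disjoint_cubes P -> averaging_bound N P (strong_const C1 C2 * K).
Proof.
move=> AK; have K0 : 0 < K by rewrite -lte_fin (le_lt_trans (A_const_ge0 p W hd) AK).
split; first exact: K0.
move=> P dP; rewrite /strong_const mulrAC.
apply: (averaging_bound_strong ep mW C10 C20 lH K0 dP) => Q cQ; exact: A_constP AK cQ.
Qed.

Lemma weak_norm_le_A_const :
  (maximal_weak_norm N <= (weak_const (R := R) (d := d) * strong_const C1 C2)%:E * A_const N)%E.
Proof.
have s0 := strong_const_gt0 C10 C20; have w0 := weak_const_gt0 (R := R) (d := d).
apply: le_scale_gt; [exact: mulr_gt0|exact: A_const_ge0|].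
move=> K /averaging_bound_of_A_const[K0 bP]; apply: ereal_inf_lbound.
exists (weak_const (d := d) * strong_const C1 C2 * K); last exact: erefl.
split; first by apply: mulr_gt0 => //; exact: mulr_gt0.
rewrite -mulrA; apply: (maximal_weak_bound_of_strong ep mW) => //; exact: mulr_gt0.
Qed.

Lemma A_const_fin_bound : (A_const N < +oo)%E -> exists2 K : R, (A_const N < K%:E)%E & 0 < K.
Proof.
move=> Afin; have A0 := A_const_ge0 p W hd.
have AE : A_const N = (fine (A_const N))%:E by rewrite fineK// ge0_fin_numE.
exists (fine (A_const N) + 1); first by rewrite {1}AE lte_fin ltrDl.
by rewrite ltr_wpDl// fine_ge0.
Qed.

Lemma class_A_weak : class_A N -> maximal_weak N.
Proof.
move=> [_ Afin]; have [K AK _] := A_const_fin_bound Afin.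
have [K0 bP] := averaging_bound_of_A_const AK; have s0 := strong_const_gt0 C10 C20.
split.
  apply: (L1locK_of_averaging ep mW) => Q cQ; exists K; first exact: ltW.
  exact: A_constP AK cQ.
exists (weak_const (d := d) * (strong_const C1 C2 * K)); split.
  by apply: mulr_gt0; [exact: weak_const_gt0|exact: mulr_gt0].
by apply: (maximal_weak_bound_of_strong ep mW) => //; exact: mulr_gt0.
Qed.

Lemma class_A_strong_of_class_A : class_A N -> class_A_strong N.
Proof.
move=> [cI Afin]; split; first exact: cI.
apply: (le_lt_trans (A_strong_le_A ep mW hd C10 C20 lH)).
by rewrite lte_mul_pinfty ?lee_fin ?(ltW (strong_const_gt0 C10 C20))// ?A_const_ge0.
Qed.

End log_Holder.

Lemma class_A_of_strong : class_A_strong N -> class_A N.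
Proof.
move=> [cI Afin]; split; first exact: cI.
exact: (le_lt_trans (A_const_le_A_strong p W) Afin).
Qed.

Lemma A_const_le_weak_norm : in_spaceK N `<=` L1locK -> (A_const N <= maximal_weak_norm N)%E.
Proof.
move=> hL; apply: le_ereal_inf_tmp => _ [C [C0 hC] <-].
exact: (A_const_le_weak ep mW (ltW C0) hL hC).
Qed.

End assembly.

Lemma comparable_of_le {R : realType} (K c c' : R) (a b : \bar R) : (0 <= a)%E -> (0 <= b)%E ->
  c <= K -> c' <= K -> (a <= c%:E * b)%E -> (b <= c'%:E * a)%E -> comparable_up_to K a b.
Proof.
move=> a0 b0 cK c'K ab ba; split.
  by apply: (le_trans ab); rewrite lee_wpmul2r// lee_fin.
by apply: (le_trans ba); rewrite lee_wpmul2r// lee_fin.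
Qed.

Theorem theorem8p2 (R : realType) (d n : nat) (hd : (0 < d)%N) (hn : (0 < n)%N) :
  (forall (k : scalar_kind) (p : Rd R d -> \bar R) (W : Rd R d -> 'M[sfield R k]_n),
     exponent p -> globally_log_Holder p -> matrix_weight W ->
     (maximal_weak (LpW_norm p W) <-> class_A (LpW_norm p W)) /\
     (class_A (LpW_norm p W) <-> class_A_strong (LpW_norm p W)))
  /\
  (forall C1 C2 : R, 0 < C1 -> 0 < C2 -> exists K : R, 0 < K /\
     forall (k : scalar_kind) (p : Rd R d -> \bar R) (W : Rd R d -> 'M[sfield R k]_n),
       exponent p -> log_Holder_with C1 C2 p -> matrix_weight W ->
       class_A (LpW_norm p W) ->
       comparable_up_to K (maximal_weak_norm (LpW_norm p W)) (A_const (LpW_norm p W)) /\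
       comparable_up_to K (A_const (LpW_norm p W)) (A_strong_const (LpW_norm p W)) /\
       comparable_up_to K (maximal_weak_norm (LpW_norm p W)) (A_strong_const (LpW_norm p W))).
Proof.
split.
  move=> k p W ep [C1 [C2 [C10 [C20 lH]]]] mW; split; split.
  - exact: class_A_of_weak.
  - exact: (class_A_weak hd ep mW C10 C20 lH).
  - exact: (class_A_strong_of_class_A hd ep mW C10 C20 lH).
  - exact: class_A_of_strong.
move=> C1 C2 C10 C20.
pose s := strong_const (d := d) C1 C2; pose w := weak_const (R := R) (d := d).
have s0 : 0 < s := strong_const_gt0 C10 C20; have w0 : 0 < w := weak_const_gt0.
exists (w * s + s + 1); split; first by rewrite !addr_gt0// mulr_gt0.
move=> k p W ep lH mW hA; have ws0 : 0 < w * s := mulr_gt0 w0 s0.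
have sK : s <= w * s + s + 1 by rewrite -addrA addrCA lerDl addr_ge0 ?(ltW ws0).
have wsK : w * s <= w * s + s + 1 by rewrite -addrA lerDl addr_ge0 ?(ltW s0).
have oneK : 1 <= w * s + s + 1 by rewrite lerDr addr_ge0 ?(ltW s0) ?(ltW ws0).
have A0 := A_const_ge0 p W hd; have M0 := maximal_weak_norm_ge0 p W.
have AS := A_const_le_A_strong p W; have S0 := le_trans A0 AS.
have SA : (_ <= s%:E * _)%E := A_strong_le_A ep mW hd C10 C20 lH.
have AM := A_const_le_weak_norm ep mW (class_A_weak hd ep mW C10 C20 lH hA).1.
have MA : (_ <= (w * s)%:E * _)%E := weak_norm_le_A_const hd ep mW C10 C20 lH.
split; [|split].
- by apply: (comparable_of_le M0 A0 wsK oneK MA); rewrite mul1e.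
- by apply: (comparable_of_le A0 S0 oneK sK _ SA); rewrite mul1e.
- apply: (comparable_of_le M0 S0 wsK sK).
    by apply: (le_trans MA); rewrite lee_wpmul2l ?lee_fin ?(ltW ws0).
  by apply: (le_trans SA); rewrite lee_wpmul2l ?lee_fin ?(ltW s0).
Qed.
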